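(* Let $\rho$ be an invariant Vishik-Fursikov measure on $\mathcal{C}_{\mathrm{w}}=\mathcal{C}_{\mathrm{loc}}([0,\infty),H_{\mathrm{w}})$ for the three-dimensional incompressible Navier-Stokes equations, and let $\rho_0=\Pi_0\rho$ be the associated Vishik-Fursikov stationary statistical solution. Let $E$ be a Borel subset of $H$ with $\rho_0(E)>0$. Then, for $\rho$-almost every Leray-Hopf weak solution $\mathbf{u}$ on $[0,\infty)$ with $\mathbf{u}(0)\in E$, the mean sojourn time in $E$ of the orbit $\mathbf{u}=\mathbf{u}(t)$, $$\mathrm{Soj}_E(\mathbf{u})=\lim_{T\to\infty}\frac{|\{t\in[0,T]:\ \mathbf{u}(t)\in E\}|}{T}=\lim_{T\to\infty}\frac1T\int_0^T\chi_E(\mathbf{u}(t))\,\mathrm{d}t,$$ is well-defined (the limit exists) and is positive, i.e. $\mathrm{Soj}_E(\mathbf{u})>0$. In particular, for $\rho_0$-almost every $\mathbf{u}_0\in E$, there exists at least one Leray-Hopf weak solution $\mathbf{u}$ on $[0,\infty)$ with $\mathbf{u}(0)=\mathbf{u}_0$ and such that the mean sojourn time in $E$ of the orbit $\mathbf{u}=\mathbf{u}(t)$ is positive, i.e. $\mathrm{Soj}_E(\mathbf{u})>0$.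
   Context: Setting. Let $\Omega\subset\mathbb{R}^3$ be a bounded domain with smooth boundary $\partial\Omega$, let $\nu>0$, and let $\mathbf{f}\in H$ be time-independent, with $H$ defined below. The incompressible Navier-Stokes equations for the velocity $\mathbf{u}=\mathbf{u}(t,\mathbf{x})$ and pressure $p=p(t,\mathbf{x})$ are $$\frac{\partial\mathbf{u}}{\partial t}-\nu\Delta\mathbf{u}+(\mathbf{u}\cdot\nabla)\mathbf{u}+\nabla p=\mathbf{f},\qquad \nabla\cdot\mathbf{u}=0\quad\text{on }(0,\infty)\times\Omega,\qquad \mathbf{u}=0\quad\text{on }(0,\infty)\times\partial\Omega.$$ Spaces. $H$ (resp. $V$) is the closure in $L^2(\Omega)^3$ (resp. in $H_0^1(\Omega)^3$) of the space of infinitely differentiable divergence-free vector fields with compact support in $\Omega$, with the inherited inner product. $H_{\mathrm{w}}$ is $H$ endowed with its weak topology; the Borel $\sigma$-algebras of $H$ and $H_{\mathrm{w}}$ coincide. $\mathcal{C}_{\mathrm{w}}=\mathcal{C}_{\mathrm{loc}}([0,\infty),H_{\mathrm{w}})$ is the space of continuous functions from $[0,\infty)$ into $H_{\mathrm{w}}$, endowed with the topology of uniform convergence on compact subintervals of $[0,\infty)$ with values in $H_{\mathrm{w}}$. Leray-Hopf weak solutions. A Leray-Hopf weak solution on $[0,\infty)$ is a function $\mathbf{u}\in L^\infty_{\mathrm{loc}}(0,\infty;H)\cap L^2_{\mathrm{loc}}(0,\infty;V)$ that satisfies the equations in the weak sense, i.e. for every $\mathbf{v}\in V$, $$\frac{\mathrm{d}}{\mathrm{d}t}(\mathbf{u},\mathbf{v})_{L^2}+\nu(\nabla\mathbf{u},\nabla\mathbf{v})_{L^2}+((\mathbf{u}\cdot\nabla)\mathbf{u},\mathbf{v})_{L^2}=(\mathbf{f},\mathbf{v})_{L^2}$$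 in the sense of distributions in time; is strongly continuous in $H$ from the right at $t=0$; and satisfies the energy inequality $$\frac12\frac{\mathrm{d}}{\mathrm{d}t}\|\mathbf{u}\|_{L^2}^2+\nu\|\nabla\mathbf{u}\|_{L^2}^2\le(\mathbf{f},\mathbf{u})_{L^2}$$ in the distribution sense on $[0,\infty)$. Such a solution belongs to $\mathcal{C}_{\mathrm{w}}$. Let $\mathcal{U}\subset\mathcal{C}_{\mathrm{w}}$ be the set of Leray-Hopf weak solutions on $[0,\infty)$; it is a Borel subset of $\mathcal{C}_{\mathrm{w}}$. Operators. $\Pi_0:\mathcal{C}_{\mathrm{w}}\to H_{\mathrm{w}}$, $\Pi_0\mathbf{u}=\mathbf{u}(0)$. For $\tau\ge0$, $\sigma_\tau:\mathcal{C}_{\mathrm{w}}\to\mathcal{C}_{\mathrm{w}}$, $(\sigma_\tau\mathbf{u})(t)=\mathbf{u}(t+\tau)$ for all $t\ge0$. Measures. An invariant (space-time) Vishik-Fursikov measure is a Borel probability measure $\rho$ on $\mathcal{C}_{\mathrm{w}}$ such that $\rho(\mathcal{U})=1$ and $\rho(\sigma_\tau^{-1}\mathcal{E})=\rho(\mathcal{E})$ for every $\tau\ge0$ and every Borel set $\mathcal{E}\subset\mathcal{C}_{\mathrm{w}}$. The push-forward $\rho_0=\Pi_0\rho$, i.e. $\rho_0(E)=\rho(\Pi_0^{-1}E)$ for Borel $E\subset H$, is a Borel probability measure on $H$, called the associated Vishik-Fursikov stationary statistical solution. Notation. $\chi_E$ is the characteristic function of $E$, and $|\cdot|$ is the one-dimensional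 (Borel/Lebesgue) measure of a Borel subset of $\mathbb{R}$. *)

(* Defs.v *)
From HB Require Import structures.
From mathcomp Require Import all_boot all_order all_algebra.
From mathcomp Require Import all_classical all_reals all_analysis.
From mathcomp Require Import measurable_realfun lra.
Import Order.TTheory GRing.Theory Num.Theory.
Import numFieldNormedType.Exports.

Set Implicit Arguments.
Unset Strict Implicit.
Unset Printing Implicit Defensive.

Local Open Scope classical_set_scope.
Local Open Scope ring_scope.

Notation E3 R := (R * R * R)%type.

Definition coord (R : realType) (p : E3 R) (i : 'I_3) : R :=
  if val i == 0%N then p.1.1 else if val i == 1%N then p.1.2 else p.2.

(* the coordinates of [p] other than [coord p i] *)
Definition others (R : realType) (p : E3 R) (i : 'I_3) : R * R :=
  if val i == 0%N then (p.1.2, p.2)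
  else if val i == 1%N then (p.1.1, p.2) else (p.1.1, p.1.2).

Definition basis_vec (R : realType) (i : 'I_3) : E3 R :=
  (((val i == 0%N)%:R, (val i == 1%N)%:R), (val i == 2%N)%:R).

Fixpoint iter_derive (R : realType) (V : normedModType R) (vs : seq V)
    (g : V -> R) : V -> R :=
  if vs is v :: vs' then 'D_v (iter_derive vs' g) else g.

Definition smooth (R : realType) (V : normedModType R) (g : V -> R) : Prop :=
  forall vs : seq V, continuous (iter_derive vs g) /\
    forall v x, derivable (iter_derive vs g) x v.

Definition test_function (R : realType) (V : normedModType R) (O : set V)
    (g : V -> R) : Prop :=
  smooth g /\
  exists K : set V, [/\ compact K, K `<=` O & forall x, ~ K x -> g x = 0].

(* Up to relabelling and reorienting the axes, [D] is locally the region above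
   the graph of a smooth function of two variables. *)
Definition smooth_boundary (R : realType) (D : set (E3 R)) : Prop :=
  forall x, (closure D `\` interior D) x ->
  exists (i : 'I_3) (reorient : bool) (gamma : R * R -> R) (r : R),
    [/\ 0 < r, smooth gamma &
      forall y, ball x r y ->
        (D y <-> if reorient then coord y i < gamma (others y i)
                 else gamma (others y i) < coord y i)].

Lemma test_function0 (R : realType) (V : normedModType R) (O : set V) :
  test_function O (cst 0).
Proof.
have D0 (vs : seq V) : iter_derive vs (cst (0 : R)) = cst 0.
  elim: vs => //= v vs ->; apply/funext => x; exact: derive_cst.
split; last by exists set0; split => //; exact: compact0.
move=> vs; rewrite D0; split; last by move=> v x; exact: derivable_cst.
by move=> x; exact: cst_continuous.
Qed.

Record smooth_domain (R : realType) := SmoothDomain {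
  dom : set (E3 R);
  dom_nonempty : dom !=set0;
  dom_open : open dom;
  dom_connected : connected dom;
  dom_bounded : bounded_set dom;
  dom_smooth : smooth_boundary dom }.

Notation M3 R := (measurableTypeR R * measurableTypeR R * measurableTypeR R)%type.

Section measure3.
Variable R : realType.

Definition lebesgue3 : {measure set (M3 R) -> \bar R} :=
  (@lebesgue_measure R \x @lebesgue_measure R \x @lebesgue_measure R)%E.

Lemma open_measurable3 (D : set (E3 R)) : open D -> measurable (D : set (M3 R)).
Proof.
move=> oD.
pose bx (q : rat * rat * rat * rat) : set (M3 R) :=
  (ball (ratr q.1.1.1 : R) (ratr q.2) `*` ball (ratr q.1.1.2 : R) (ratr q.2))
   `*` ball (ratr q.1.2 : R) (ratr q.2).
pose F q := if `[< bx q `<=` D >] then bx q else set0.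
have -> : D = \bigcup_q F q.
  apply/seteqP; split => [x Dx|x [q _]]; last first.
    by rewrite /F; case: asboolP => // + ?; exact.
  have /nbhs_ballP[e /= e0 sD] : nbhs x D by apply: open_nbhs_nbhs; split.
  have [r] : exists r, ratr r \in `]0, (e / 2)[%R.
    by apply: rat_in_itvoo; rewrite divr_gt0.
  rewrite in_itv/= => /andP[r0 re].
  have P (t : R) : exists q : rat, ball (ratr q : R) (ratr r) t.
    have [q] : exists q : rat, (ratr q : R) \in `](t - ratr r), (t + ratr r)[%R.
      by apply: rat_in_itvoo; rewrite ltrBlDr -addrA ltrDl addr_gt0.
    rewrite in_itv/= => /andP[q1 q2]; exists q.
    rewrite /ball/= ltr_norml. move: q1 q2; lra.
  have [q1 Q1] := P x.1.1; have [q2 Q2] := P x.1.2; have [q3 Q3] := P x.2.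
  exists (q1, q2, q3, r) => //; rewrite /F asboolT//= => y [[/= y1 y2] y3].
  apply: sD.
  have e2 : ratr r + ratr r <= e :> R by rewrite [leRHS]splitr ltW// ltrD.
  split; [split|]; (apply: (le_ball e2); apply: ball_triangle; last by eassumption);
    by apply: ball_sym.
apply: (@countable_bigcupT_measurable _ _ (rat * rat * rat * rat)%type); first exact: countableP.
move=> q; rewrite /F; case: asboolP => // _.
by apply: measurableX => //; [apply: measurableX|];
  by apply: open_measurable; exact: ball_open.
Qed.

End measure3.

Section time.
Variable R : realType.

Definition time : Type := set_type [set t : R | 0 <= t].
HB.instance Definition _ := Topological.on time.
HB.instance Definition _ := Choice.on time.

Definition time_val (t : time) : R := val t.

Lemma time_of_subproof (t : R) : Num.max 0 t \in [set t : R | 0 <= t].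
Proof. by apply/mem_set; rewrite /= le_max lexx. Qed.

(* Negative reals are sent to 0; only used for 0 <= t. *)
Definition time_of (t : R) : time :=
  exist (fun t => t \in [set t : R | 0 <= t]) _ (time_of_subproof t).

Lemma time_add_subproof (tau t : time) :
  time_val t + time_val tau \in [set t : R | 0 <= t].
Proof.
case: t tau => [t tp] [tau taup]; apply/mem_set => /=.
by apply: addr_ge0; [exact: (set_mem tp)|exact: (set_mem taup)].
Qed.

Definition time_add (tau t : time) : time :=
  exist (fun t => t \in [set t : R | 0 <= t]) _ (time_add_subproof tau t).

Lemma time_add_continuous (tau : time) : continuous (time_add tau).
Proof.
apply: continuous_comp_initial => t.
have -> : set_val \o time_add tau = (fun s : time => time_val s + time_val tau) by [].
apply: (@cvgD _ R^o _ (nbhs t)); last exact: cvg_cst.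
exact: (@initial_continuous _ _ (@set_val _ [set t : R | 0 <= t])).
Qed.

Definition compact_intervals : set (set time) :=
  [set [set t | a <= time_val t <= b] | a in [set: R] & b in [set: R]].

End time.

Section spaces.
Variables (R : realType) (Om : smooth_domain R).

Definition lebesgue_dom : {measure set (M3 R) -> \bar R} :=
  mrestr (lebesgue3 R) (open_measurable3 (@dom_open R Om)).

Definition L2 : Type := LspaceType2 lebesgue_dom.
HB.instance Definition _ := gen_eqMixin L2.
HB.instance Definition _ := gen_choiceMixin L2.

Definition L2_fun (u : L2) : E3 R -> R := u.

Definition vL2 := {ffun 'I_3 -> L2}.
Definition mL2 := {ffun 'I_3 * 'I_3 -> L2}.

Section families.
Variable I : finType.

Definition components (u : {ffun I -> L2}) : I -> E3 R -> R :=
  fun i => L2_fun (u i).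

Definition dotL2 (u v : I -> E3 R -> R) : R :=
  \sum_(i : I) \int[lebesgue_dom]_x (u i x * v i x).

Definition normL2 (u : I -> E3 R -> R) : R := Num.sqrt (dotL2 u u).

Definition distL2 (u v : I -> E3 R -> R) : R :=
  normL2 (fun i x => u i x - v i x).

End families.

Let zero_class : {mfun_ lebesgue_dom, M3 R >-> measurableTypeR R} :=
  \pi_({mfun_ lebesgue_dom, M3 R >-> measurableTypeR R})%qT
    (cst 0 : {mfun M3 R >-> measurableTypeR R}).

Lemma zero_class_ae :
  \forall x \ae lebesgue_dom, (zero_class : M3 R -> R) x = 0.
Proof.
have : repr zero_class =
    (cst 0 : {mfun M3 R >-> measurableTypeR R}) %[mod {mfun_ lebesgue_dom, M3 R >-> measurableTypeR R}]%qT.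
  by rewrite reprK.
move/eqP; rewrite eqmodE => /asboolP.
by apply: filterS => x /(_ I).
Qed.

Lemma zero_class_finite : finite_norm lebesgue_dom 2%:R%:E zero_class.
Proof.
rewrite /finite_norm unlock /Lnorm.
rewrite (ge0_ae_eq_integral (g := cst 0%E))//=.
- by rewrite integral0 poweR0r// invr_neq0.
- apply/measurable_EFinP; apply: (@measurableT_comp _ _ _ _ _ _ (fun y : R => y `^ 2)) => //.
  by apply: measurableT_comp => //; exact: measurable_funP.
- apply: filterS zero_class_ae => x /= -> _.
  by rewrite normr0 powR0.
Qed.

HB.instance Definition _ :=
  isFinLebesgue.Build _ _ _ _ _ (lee1n 2) zero_class zero_class_finite.

Definition zeroL2 : L2 := zero_class : LspaceType2 lebesgue_dom.

HB.instance Definition _ := isPointed.Build L2 zeroL2.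

Definition solenoidal_test (phi : 'I_3 -> E3 R -> R) : Prop :=
  (forall i, test_function (dom Om) (phi i)) /\
  forall x, \sum_(i < 3) 'D_(basis_vec R i) (phi i) x = 0.

Definition Hset : set vL2 := [set u | forall eps : R, 0 < eps ->
  exists2 phi, solenoidal_test phi & distL2 (components u) phi < eps].

Lemma zero_in_H : [ffun=> zeroL2] \in Hset.
Proof.
apply/mem_set => e e0; exists (fun=> cst 0).
  split; first by move=> i; exact: test_function0.
  by move=> x; rewrite big1// => i _; rewrite derive_cst.
rewrite /distL2 /normL2 /dotL2 big1 ?sqrtr0// => i _.
have mz : measurable_fun [set: M3 R]
    (fun x => components [ffun=> zeroL2] i x - (cst 0 : E3 R -> R) x).
  apply: measurable_funB => //; rewrite /components ffunE.
  exact: (measurable_funP (repr zero_class)).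
rewrite /Rintegral (ae_eq_integral (cst 0%E))//; first by rewrite integral0.
- by apply/measurable_EFinP; exact: measurable_funM.
- apply: filterS zero_class_ae => x zx _.
  by rewrite /components ffunE /L2_fun /= zx subr0 mulr0.
Qed.

Definition gradient_field (phi : 'I_3 -> E3 R -> R) : 'I_3 * 'I_3 -> E3 R -> R :=
  fun ij => 'D_(basis_vec R ij.2) (phi ij.1).

Definition is_weak_gradient (u : vL2) (g : mL2) : Prop :=
  forall (i j : 'I_3) (phi : E3 R -> R), test_function (dom Om) phi ->
    \int[lebesgue_dom]_x (components u i x * 'D_(basis_vec R j) phi x) =
    - \int[lebesgue_dom]_x (components g (i, j) x * phi x).

(* Unique when it exists; entry (i, j) is the j-th derivative of the i-th
   component. *)
Definition grad (u : vL2) : mL2 := xget [ffun=> zeroL2] (is_weak_gradient u).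

Definition distH1 (u : 'I_3 -> E3 R -> R) (du : 'I_3 * 'I_3 -> E3 R -> R)
    (v : 'I_3 -> E3 R -> R) (dv : 'I_3 * 'I_3 -> E3 R -> R) : R :=
  Num.sqrt (distL2 u v ^+ 2 + distL2 du dv ^+ 2).

Definition H1 : set vL2 := [set u | exists g, is_weak_gradient u g].

Definition H10 : set vL2 := [set u | H1 u /\ forall eps : R, 0 < eps ->
  exists2 phi, (forall i, test_function (dom Om) (phi i)) &
    distH1 (components u) (components (grad u)) phi (gradient_field phi) < eps].

Definition Vset : set vL2 := [set u | H10 u /\ forall eps : R, 0 < eps ->
  exists2 phi, solenoidal_test phi &
    distH1 (components u) (components (grad u)) phi (gradient_field phi) < eps].

Definition distH (u v : vL2) : R := distL2 (components u) (components v).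

Definition distV (u v : vL2) : R :=
  distH1 (components u) (components (grad u)) (components v) (components (grad v)).

Definition Hspace : Type := set_type Hset.
HB.instance Definition _ := Choice.on Hspace.
HB.instance Definition _ := isPointed.Build Hspace (exist (fun u => u \in Hset) _ zero_in_H).

Definition Hval (u : Hspace) : vL2 := val u.

Definition openH (A : set Hspace) : Prop := forall u, A u ->
  exists2 r : R, 0 < r & forall v,
    distH (Hval v) (Hval u) < r -> A v.

Definition borelH := g_sigma_algebraType openH.

(* Since H is a Hilbert space, its weak topology (and uniformity) is the one
   generated by the inner products with the elements of H. *)
Definition weak_coordinates (u : Hspace) : {ptws Hspace -> R} :=
  fun v => dotL2 (components (Hval u)) (components (Hval v)).

Definition Hw : Type := initial_topology weak_coordinates.
HB.instance Definition _ := Uniform.on Hw.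
HB.instance Definition _ := Pointed.on Hw.

Definition Cw : Type := initial_topology
  (fun u : continuousType (time R) Hw =>
    (u : time R -> Hw) : {family @compact_intervals R, time R -> Hw}).
HB.instance Definition _ := Uniform.on Cw.

Definition Cw_fun (u : Cw) : time R -> Hspace :=
  (u : continuousType (time R) Hw).

Lemma zero_path_continuous : continuous (cst point : time R -> Hw).
Proof. by move=> t; exact: cst_continuous. Qed.
HB.instance Definition _ := isPointed.Build Cw
  (mkcts zero_path_continuous : continuousType (time R) Hw).

Definition borelCw := g_sigma_algebraType (@open Cw).

Lemma shift_continuous (tau : time R) (u : Cw) :
  continuous (Cw_fun u \o time_add tau : time R -> Hw).
Proof.
move=> t; apply: (@continuous_comp _ _ _ (time_add tau) (Cw_fun u : _ -> Hw)).
  exact: time_add_continuous.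
exact: (@cts_fun _ _ (u : continuousType (time R) Hw)).
Qed.

Definition shift (tau : time R) (u : Cw) : Cw :=
  (mkcts (@shift_continuous tau u) : continuousType (time R) Hw).

Definition initial_value (u : borelCw) : borelH := Cw_fun u (time_of 0).

End spaces.

Section bochner.
Variables (R : realType) (Om : smooth_domain R).

(* Strong (Bochner) measurability on (0, +oo) of a function with values in the
   subset [X] of L^2, for the metric [d] of [X]. *)
Definition strongly_measurable (X : set (vL2 Om)) (d : vL2 Om -> vL2 Om -> R)
    (w : R -> vL2 Om) : Prop :=
  exists s : nat -> R -> vL2 Om,
    (forall n, [/\ finite_set (range (s n)), range (s n) `<=` X &
       forall y, measurable (s n @^-1` [set y] : set (measurableTypeR R))]) /\
    {ae @lebesgue_measure R, forall t, 0 < t ->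
       X (w t) /\ (d (s n t) (w t) @[n --> \oo] --> (0 : R^o))}.

Definition Linfty_loc (X : set (vL2 Om)) (d : vL2 Om -> vL2 Om -> R)
    (w : R -> vL2 Om) : Prop :=
  strongly_measurable X d w /\
  forall a b : R, 0 < a -> a < b -> exists M : R,
    {ae @lebesgue_measure R, forall t, a <= t <= b ->
       d (w t) [ffun=> zeroL2 Om] <= M}.

Definition L2_loc (X : set (vL2 Om)) (d : vL2 Om -> vL2 Om -> R)
    (w : R -> vL2 Om) : Prop :=
  strongly_measurable X d w /\
  forall a b : R, 0 < a -> a < b ->
    (\int[@lebesgue_measure R]_(t in `[a, b])
       (d (w t) [ffun=> zeroL2 Om] ^+ 2)%:E < +oo)%E.

End bochner.

Section leray_hopf.
Variables (R : realType) (Om : smooth_domain R) (nu : R) (f : Hspace Om).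

Definition dotH (u v : vL2 Om) : R := dotL2 Om (components u) (components v).

Definition dot_grad (u v : vL2 Om) : R :=
  dotL2 Om (components (grad u)) (components (grad v)).

(* ((u . nabla) u, v) *)
Definition convection (u v : vL2 Om) : R :=
  \sum_(i < 3) \sum_(j < 3) \int[lebesgue_dom Om]_x
    (components u j x * components (grad u) (i, j) x * components v i x).

Definition trajectory (u : Cw Om) (t : R) : vL2 Om :=
  Hval (Cw_fun u (time_of t)).

Definition int_time (g : R -> R) : R :=
  \int[@lebesgue_measure R]_(t in `]0, +oo[) g t.

Definition time_test (psi : R -> R) : Prop :=
  test_function (V := R^o) [set t : R | 0 < t] psi.

(* Distributions in time are tested on (0, +oo), so that the time derivative
   moves to [psi] with a minus sign and without a term at t = 0. *)
Definition weak_equation (w : R -> vL2 Om) : Prop :=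
  forall v : vL2 Om, Vset v -> forall psi : R -> R, time_test psi ->
    - int_time (fun t => dotH (w t) v * derive1 psi t)
    + nu * int_time (fun t => dot_grad (w t) v * psi t)
    + int_time (fun t => convection (w t) v * psi t)
    = int_time (fun t => dotH (Hval f) v * psi t).

Definition energy_inequality (w : R -> vL2 Om) : Prop :=
  forall psi : R -> R, time_test psi -> (forall t, 0 <= psi t) ->
    - (2^-1 * int_time (fun t => dotH (w t) (w t) * derive1 psi t))
    + nu * int_time (fun t => dot_grad (w t) (w t) * psi t)
    <= int_time (fun t => dotH (Hval f) (w t) * psi t).

Definition leray_hopf : set (Cw Om) := [set u |
  [/\ Linfty_loc (@Hset R Om) (@distH R Om) (trajectory u),
      L2_loc (@Vset R Om) (@distV R Om) (trajectory u),
      weak_equation (trajectory u),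
      distH (trajectory u t) (trajectory u 0) @[t --> 0^'+] --> (0 : R^o) &
      energy_inequality (trajectory u)]].

(* The event of full measure is stated with [{ae rho, _}], which for the Borel
   set [leray_hopf] means [rho leray_hopf = 1]. *)
Definition invariant_Vishik_Fursikov (rho : probability (borelCw Om) R) : Prop :=
  {ae rho, forall u, leray_hopf u} /\
  forall (tau : time R) (A : set (borelCw Om)), measurable A ->
    rho (shift tau @^-1` A) = rho A.

End leray_hopf.

Definition stationary_solution (R : realType) (Om : smooth_domain R)
    (rho : probability (borelCw Om) R) : set (borelH Om) -> \bar R :=
  pushforward rho (@initial_value R Om).

Section sojourn.
Variables (R : realType) (Om : smooth_domain R).

Definition mean_time_in (E : set (Hspace Om)) (u : Cw Om) (T : R) : R :=
  fine (@lebesgue_measure R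
    [set t | 0 <= t <= T /\ E (Cw_fun u (time_of t))]) / T.

Definition sojourn (E : set (Hspace Om)) (u : Cw Om) : R :=
  lim (mean_time_in E u T @[T --> +oo]).

Definition positive_sojourn (E : set (Hspace Om)) (u : Cw Om) : Prop :=
  [/\ cvg (mean_time_in E u T @[T --> +oo]),
      T^-1 * (\int[@lebesgue_measure R]_(t in `[0, T])
        \1_E (Cw_fun u (time_of t))) @[T --> +oo] --> (sojourn E u : R^o) &
      0 < sojourn E u].

End sojourn.

(* Main.v *)
From HB Require Import structures.
Require Import Defs.
From mathcomp Require Import all_boot all_order all_algebra finmap.
From mathcomp Require Import all_classical all_reals all_analysis.
From mathcomp Require Import measurable_realfun lra ring.

Import Order.TTheory GRing.Theory Num.Theory.
Import numFieldNormedType.Exports.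

Set Implicit Arguments.
Unset Strict Implicit.
Unset Printing Implicit Defensive.

Local Open Scope classical_set_scope.
Local Open Scope ring_scope.

(** Write [E] for the target set and [F u] for the time that the path [u]
    spends in [E] during ]0, 1]. The sum of [F] over the first [n] iterates of
    the unit shift is the time spent in [E] during ]0, n], so the sojourn time
    of [u] is the limit of the Birkhoff averages of [F]: it exists for almost
    every path because the shift preserves [rho] ([birkhoff_ergodic], deduced
    from the maximal inequality [maximal_ergodic]), and passing from integer
    to real times costs O(1/T) ([occupation_average_cvg]).

    The limit is positive for almost every path that starts in [E], by a
    recurrence argument. Let [Z] be the set of paths with limit zero. It is
    invariant under all shifts, so rho (Z and u(t) in E) does not depend on
    [t]; by Fubini it equals the integral of [F] over [Z]
    ([mean_occupation_zero_average]), and the maximal inequality makes that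
    integral zero because the averages of [F] tend to zero on [Z]
    ([mean_vanishing_average]). Hence almost no path of [Z] starts in [E]
    ([positive_sojourn_ae]).

    The second assertion is not a formal consequence of the first: with [N] a
    null set outside of which everything holds, the set of initial values of
    the paths outside [N] must contain almost all of [E], and the image of a
    measurable set need not be measurable. It is approximated from inside by
    measurable images ([image_inner_approximation]):
    - the paths that are bounded on bounded intervals carry the measure, since
      Leray-Hopf solutions have this property
      ([leray_hopf_locally_bounded]); on them, every Borel set belongs to the
      sigma-algebra generated by the countably many coordinates
      (u(q), d_i), with [q] rational and [d] a dense sequence of H
      ([borelCw_locally_bounded_measurable]);
    - a set of that sigma-algebra is approximated from inside, up to small
      measure, by sets that are closed for the pointwise convergence of the
      coordinates ([inner_regular]);
    - up to small measure, the paths satisfy given bounds and given moduli of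
      equicontinuity ([equicontinuous_paths_large]). Such paths form a compact
      set of coordinate functions, by the theorems of Tychonoff and Ascoli, so
      the initial values of those in a closed set form a weakly closed set
      ([initial_value_image_measurable]).

    Everything rests on H being a separable Hilbert space. Completeness is the
    Riesz-Fischer theorem ([L2dot_complete]); separability comes from
    recording, for each test field, its values to finite precision on a finite
    net ([ipH_dense]); joint measurability of (t, u) |-> u(t) follows from the
    density of [d], which turns strong balls into countable intersections of
    conditions on the coordinates ([measurable_fun_borelH]). *)

(** * Inner products given by their pairings *)

Section inner_product.
Variables (R : realType) (X : Type) (ip : X -> X -> R).

Definition ip_norm (u : X) : R := Num.sqrt (ip u u).
Definition ip_dist (u v : X) : R :=
  Num.sqrt (ip u u - 2 * ip u v + ip v v).

(** The elements of H are chosen representatives, on which the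
    vector operations act only up to null sets. A linear combination is
    therefore required only through its pairings. *)
Record inner_product : Prop := InnerProduct {
  ipC : forall u v, ip u v = ip v u;
  ip_ge0 : forall u, 0 <= ip u u;
  ip_lincomb : forall a b u v, exists w,
    forall z, ip w z = a * ip u z + b * ip v z }.

Definition ip_complete : Prop := forall h : nat -> X,
  (forall e, 0 < e -> exists N, forall n m, (N <= n)%N -> (N <= m)%N ->
     ip_dist (h n) (h m) < e) ->
  exists l, forall e, 0 < e -> exists N, forall n, (N <= n)%N ->
     ip_dist (h n) l < e.

Definition ip_dense (d : nat -> X) : Prop :=
  forall u e, 0 < e -> exists n, ip_dist (d n) u < e.

Hypothesis ipP : inner_product.
Let C := ipC ipP.
Let ge0 := ip_ge0 ipP.

Lemma ip_lincomb2 a b u v : exists2 w,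
  forall z, ip w z = a * ip u z + b * ip v z &
  ip w w = a ^+ 2 * ip u u + 2 * a * b * ip u v + b ^+ 2 * ip v v.
Proof.
have [w Hw] := ip_lincomb ipP a b u v; exists w => //.
rewrite Hw (C u w) (C v w) !Hw (C v u); ring.
Qed.

Lemma ip_cauchy_schwarz u v : ip u v ^+ 2 <= ip u u * ip v v.
Proof.
(* [w] is the usual combination (v,v)u - (u,v)v; it says nothing when
   (v,v) = 0, a case that the combination [w'] settles. *)
have [w _ Hw] := ip_lincomb2 (ip v v) (- ip u v) u v.
have [w' _ Hw'] := ip_lincomb2 (ip u v) (- (ip u u + 1)) u v.
have := ge0 w; have := ge0 w'; rewrite {}Hw {}Hw'.
have := ge0 u; have := ge0 v.
set a := ip u u; set b := ip v v; set c := ip u v => b0 a0.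
have [->|bn0] := eqVneq b 0.
  move=> + _; rewrite !mulr0 addr0 => H.
  have: c ^+ 2 * (a + 2) <= 0 by nra.
  rewrite pmulr_lle0//; lra.
have {bn0}b0 : 0 < b by rewrite lt_def bn0.
move=> _ H; have: 0 <= b * (a * b - c ^+ 2) by nra.
by rewrite pmulr_rge0// subr_ge0.
Qed.

Lemma ip_norm_ge0 u : 0 <= ip_norm u. Proof. exact: sqrtr_ge0. Qed.

Lemma ip_dist_ge0 u v : 0 <= ip_dist u v. Proof. exact: sqrtr_ge0. Qed.

Lemma ip_normE u : ip_norm u ^+ 2 = ip u u. Proof. exact/sqr_sqrtr/ge0. Qed.

Lemma ip_le u v : `|ip u v| <= ip_norm u * ip_norm v.
Proof.
rewrite -ler_sqr ?nnegrE ?mulr_ge0 ?ip_norm_ge0//.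
by rewrite exprMn !ip_normE real_normK ?num_real// ip_cauchy_schwarz.
Qed.

Lemma ip_sub u v : exists2 w,
  forall z, ip w z = ip u z - ip v z & ip_norm w = ip_dist u v.
Proof.
have [w H1 H2] := ip_lincomb2 1 (-1) u v; exists w.
  by move=> z; rewrite H1; ring.
by rewrite /ip_norm /ip_dist H2; congr Num.sqrt; ring.
Qed.

Lemma ip_distE u v : ip_dist u v ^+ 2 = ip u u - 2 * ip u v + ip v v.
Proof.
apply: sqr_sqrtr; have [w _ Hw] := ip_lincomb2 1 (-1) u v.
by move: (ge0 w); rewrite Hw; lra.
Qed.

Lemma ip_distC u v : ip_dist u v = ip_dist v u.
Proof. by rewrite /ip_dist (C u v); congr Num.sqrt; ring. Qed.

Lemma ip_dist_le u v z : `|ip u z - ip v z| <= ip_dist u v * ip_norm z.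
Proof. by have [w <- <-] := ip_sub u v; exact: ip_le. Qed.

Lemma ip_dist_triangle v u w : ip_dist u w <= ip_dist u v + ip_dist v w.
Proof.
have [a Ha Na] := ip_sub u v; have [b Hb Nb] := ip_sub v w.
rewrite -ler_sqr ?nnegrE ?addr_ge0 ?ip_dist_ge0//.
have := ip_le a b; rewrite Na Nb ler_norml => /andP[_].
rewrite Ha (C u b) (C v b) !Hb (C v u) (C w u) (C w v).
rewrite sqrrD !ip_distE; lra.
Qed.

Lemma ip_norm_le_dist u v : ip_norm u <= ip_norm v + ip_dist u v.
Proof.
have [w Hw Nw] := ip_sub u v.
rewrite -ler_sqr ?nnegrE ?addr_ge0 ?ip_norm_ge0 ?ip_dist_ge0//.
have := ip_le v w; rewrite Nw ler_norml => /andP[_].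
rewrite (C v w) Hw sqrrD !ip_normE ip_distE (C u v) (C v u); lra.
Qed.

(** The choice of an element [d i] close to [u] gives
    |u|^2 <= M |u| up to a small error, since (u, d i) is close to |u|^2 and
    |d i| is close to |u|. *)
Lemma ip_norm_lbound (d : nat -> X) (M : R) u : ip_dense d -> 0 <= M ->
  (forall i, ip u (d i) <= M * ip_norm (d i)) -> ip_norm u <= M.
Proof.
move=> dd M0 H; apply/ler_addgt0Pr => e e0.
have [->|un0] := eqVneq (ip_norm u) 0; first lra.
have u0 : 0 < ip_norm u by rewrite lt_def un0 ip_norm_ge0.
have k0 : 0 < 2 * M + ip_norm u + 1 by move: u0; lra.
have k1 : 0 < ip_norm u * e / (2 * M + ip_norm u + 1).
  by rewrite divr_gt0// mulr_gt0.
have [i Hi] := dd u _ k1.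
have := ip_norm_le_dist (d i) u.
have := ip_dist_le u (d i) u; rewrite -(ip_normE u) (ip_distC u) => H1.
have := H i; rewrite (C u) => H2 H3.
move: H1; rewrite ler_norml => /andP[_ H1].
move: Hi; rewrite ltr_pdivlMr// => Hi.
have D0 := ip_dist_ge0 (d i) u.
set D := ip_dist _ _ in H1 H2 H3 Hi D0; set n := ip_norm u in H1 H2 H3 Hi u0 k0 *.
set m := ip_norm (d i) in H1 H2 H3.
have : n ^+ 2 <= M * n + M * D + D * n by nra.
move=> H4.
have : n * n <= n * (M + e) by nra.
by rewrite ler_pM2l.
Qed.

(** Pairings with a dense sequence control all pairings uniformly on
    bounded sets: this is what reduces weak convergence of bounded vectors to
    countably many coordinates. *)
Lemma ip_diff_lt (r e : R) y z u v : 0 <= r ->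
  ip_dist y z < e / (4 * (r + 1)) -> ip_norm u <= r -> ip_norm v <= r ->
  `|ip y u - ip y v| <= e / 4 -> `|ip z u - ip z v| < e.
Proof.
move=> r0 yz ur vr; have D0 := ip_dist_ge0 y z.
have e0 : 0 < e.
  by have := le_lt_trans D0 yz; rewrite pmulr_lgt0// invr_gt0 mulr_gt0// ltr_wpDl.
have B w : ip_norm w <= r -> ip_dist y z * ip_norm w <= e / 4.
  move=> wr; apply: (@le_trans _ _ (e / (4 * (r + 1)) * (r + 1))).
    apply: ler_pM => //; [exact: ip_norm_ge0|exact: ltW|].
    by apply: (le_trans wr); rewrite lerDl.
  by rewrite invfM mulrA -mulrA mulVf ?mulr1// gt_eqF// ltr_wpDl.
move: (ip_dist_le y z u) (ip_dist_le y z v) (B u ur) (B v vr).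
rewrite !ler_norml ltr_norml.
move=> /andP[x1 x2] /andP[x3 x4] x5 x6 /andP[x7 x8]; apply/andP; split; lra.
Qed.

End inner_product.

Section weak_limit.
Variables (R : realType) (X : Type) (ip : X -> X -> R).
Hypotheses (ipP : inner_product ip) (Xc : ip_complete ip).
Let C := ipC ipP.

(** Weak compactness of balls, obtained from minimal norms. The vectors of norm
    at most [M] that match the first [n] data up to 1/(n+1) form decreasing
    convex sets [A n]; vectors of nearly minimal norm in them are a Cauchy sequence by the
    parallelogram identity, and their limit has the prescribed pairings. *)
Lemma weak_limit (d : nat -> X) (x : nat -> R) (M : R) :
  (forall n, exists2 h, ip_norm ip h <= M &
     forall i, (i <= n)%N -> `|ip h (d i) - x i| <= n.+1%:R^-1) ->
  exists2 h, ip_norm ip h <= M & forall i, ip h (d i) = x i.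
Proof.
move=> ex.
have M0 : 0 <= M by have [h + _] := ex 0%N; apply: le_trans; exact: ip_norm_ge0.
pose A n : set X := [set h | ip_norm ip h <= M /\
   forall i, (i <= n)%N -> `|ip h (d i) - x i| <= n.+1%:R^-1].
have Asub n m : (n <= m)%N -> A m `<=` A n.
  move=> nm h [h1 h2]; split=> // i ni; apply: (le_trans (h2 _ (leq_trans ni nm))).
  by rewrite lef_pV2 ?posrE// ler_nat.
pose s n := inf [set ip h h | h in A n].
have Anon n : [set ip h h | h in A n] !=set0.
  by have [h h1 h2] := ex n; exists (ip h h); exists h.
have Albd n : lbound [set ip h h | h in A n] 0.
  by move=> _ [h _ <-]; exact: ip_ge0.
have sle n h : A n h -> s n <= ip h h.
  by move=> Ah; apply: ge_inf; [exists 0; exact: Albd|exists h].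
have sM n : s n <= M ^+ 2.
  have [h h1 h2] := ex n; apply: (le_trans (sle n h _)) => //.
  by rewrite -(ip_normE ipP) ler_sqr ?nnegrE ?ip_norm_ge0.
have snd n m : (n <= m)%N -> s n <= s m.
  move=> nm; apply: lb_le_inf => // _ [h Ah <-]; apply: sle; exact: Asub nm _ Ah.
have hex n : exists h, A n h /\ ip h h < s n + n.+1%:R^-1.
  have n0 : 0 < n.+1%:R^-1 :> R by rewrite invr_gt0.
  have hi : has_inf [set ip h h | h in A n] by split=> //; exists 0; exact: Albd.
  by have [_ [h Ah <-] hy] := inf_adherent n0 hi; exists h.
pose h n := sval (cid (hex n)).
have Ah n : A n (h n) by have [] := svalP (cid (hex n)).
have hs n : ip (h n) (h n) < s n + n.+1%:R^-1 by have [] := svalP (cid (hex n)).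
pose S := sup (range s).
have Sub : has_sup (range s).
  by split; [exists (s 0%N); exists 0%N|exists (M ^+ 2) => _ [n _ <-]].
have sS n : s n <= S by apply: ub_le_sup; [exact: Sub.2|exists n].
(* The midpoint of [h n] and [h m] is still in [A n], so its squared norm is
   at least [s n]. *)
have key n m : (n <= m)%N ->
    ip_dist ip (h n) (h m) ^+ 2 <= 2 * (S - s n) + 4 * n.+1%:R^-1.
  move=> nm; rewrite (ip_distE ipP).
  have [w Hw ww] := ip_lincomb2 ipP 2^-1 2^-1 (h n) (h m).
  have [/= hm1 hm2] := Asub _ _ nm _ (Ah m).
  have [/= hn1 hn2] := Ah n.
  have Aw : A n w.
    split=> [|i ni].
      rewrite -ler_sqr ?nnegrE ?ip_norm_ge0// (ip_normE ipP) ww.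
      have := ip_le ipP (h n) (h m); rewrite ler_norml => /andP[_].
      rewrite -!(ip_normE ipP).
      have n0 := ip_norm_ge0 ip (h n); have m0 := ip_norm_ge0 ip (h m).
      have := ler_pM n0 m0 hn1 hm1.
      have := ler_pM n0 n0 hn1 hn1; have := ler_pM m0 m0 hm1 hm1.
      by rewrite -!expr2; lra.
    rewrite Hw; have := hn2 i ni; have := hm2 i ni.
    move: (n.+1%:R^-1) => e.
    by rewrite !ler_norml => /andP[? ?] /andP[? ?]; apply/andP; split; lra.
  have := sle _ _ Aw; rewrite ww.
  have := hs n; have := hs m; have := sS m.
  have : m.+1%:R^-1 <= n.+1%:R^-1 :> R by rewrite lef_pV2 ?posrE// ler_nat.
  move: (n.+1%:R^-1) (m.+1%:R^-1) => e1 e2; lra.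
have small e : 0 < e -> exists N, forall n, (N <= n)%N -> n.+1%:R^-1 < e :> R.
  move=> e0; exists (Num.truncn e^-1) => n Nn.
  rewrite invf_plt ?posrE//.
  apply: (lt_le_trans (truncnS_gt _)).
  by rewrite ler_nat.
have [|l Hl] := Xc (h := h).
  move=> e e0.
  have e1 : 0 < e ^+ 2 / 8 by rewrite divr_gt0// exprn_gt0.
  have [_ [N1 _ <-] HN1] := sup_adherent e1 Sub.
  have [N2 HN2] := small _ e1.
  have W : forall n m, (maxn N1 N2 <= n)%N -> (n <= m)%N ->
      ip_dist ip (h n) (h m) < e.
    move=> n m; rewrite geq_max => /andP[n1 n2] nm.
    rewrite -ltr_sqr ?nnegrE ?ip_dist_ge0 ?(ltW e0)//.
    apply: (le_lt_trans (key _ _ nm)).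
    have := snd _ _ n1; have := HN2 _ n2; rewrite -/S in HN1.
    by move: (n.+1%:R^-1) e1 => e3 /=; lra.
  exists (maxn N1 N2) => n m Nn Nm.
  by case: (leqP n m) => nm; [|rewrite (ip_distC ipP)]; apply: W => //; exact: ltnW.
exists l.
  apply/ler_addgt0Pr => e e0; have [N /(_ N (leqnn _)) HN] := Hl _ e0.
  have := ip_norm_le_dist ipP l (h N); rewrite (ip_distC ipP).
  have [/= ? _] := Ah N; lra.
move=> i; apply/eqP; rewrite -subr_eq0 -normr_le0; apply/ler_addgt0Pr => e e0.
rewrite add0r.
have k0 : 0 < ip_norm ip (d i) + 1 by have := ip_norm_ge0 ip (d i); lra.
have e1 : 0 < e / 2 / (ip_norm ip (d i) + 1) by rewrite !divr_gt0.
have e2 : 0 < e / 2 by rewrite divr_gt0.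
have [N1 HN1] := Hl _ e1; have [N2 HN2] := small _ e2.
pose n := maxn i (maxn N1 N2).
have := HN1 n; rewrite !leq_max leqnn orbT => /(_ isT).
rewrite ltr_pdivlMr// => D1.
have := HN2 n; rewrite !leq_max leqnn !orbT => /(_ isT) D2.
have [_ /(_ i)] := Ah n; rewrite leq_max leqnn => /(_ isT) D3.
have D4 := ip_dist_le ipP (h n) l (d i).
have D0 := ip_dist_ge0 ip (h n) l.
rewrite (_ : _ - _ = (ip (h n) (d i) - x i) - (ip (h n) (d i) - ip l (d i))); last ring.
apply: (le_trans (ler_normB _ _)).
rewrite mulrDr mulr1 in D1; move: (n.+1%:R^-1) D2 D3 => e3 D2 D3; lra.
Qed.

End weak_limit.

(** * Completeness of the space of square-integrable families *)

Lemma exists_half_pow_lt (R : archiRealFieldType) (e : R) : 0 < e ->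
  exists k, 2 ^- k < e.
Proof.
move=> e0; exists (Num.truncn e^-1).+1.
rewrite invf_plt ?posrE ?exprn_gt0//.
apply: (lt_le_trans (truncnS_gt _)).
by rewrite -natrX ler_nat ltnW// ltn_expl.
Qed.

Section square_integrable.
Context d (T : measurableType d) (R : realType).
Variable mu : {measure set T -> \bar R}.
Local Notation L := (Lfun mu 2%:E).

Lemma Lfun2P (f : T -> R) : f \in L <-> measurable_fun setT f /\
  (\int[mu]_x (f x ^+ 2)%:E < +oo)%E.
Proof.
split=> [fL|[mf fi]].
  split; first by move: fL; rewrite inE => /andP[/[!inE]].
  have /integrableP[_] := Lfun2_integrable_sqr fL.
  by under eq_integral => x _ do rewrite gee0_abs ?lee_fin ?sqr_ge0//.
rewrite inE; apply/andP; split; rewrite inE//=.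
rewrite /finite_norm unlock /Lnorm; apply: poweR_lty.
by under eq_integral => x _ do rewrite /= powR_mulrn// real_normK ?num_real//.
Qed.

Lemma Lfun2_measurable (f : T -> R) : f \in L -> measurable_fun setT f.
Proof. by move=> /Lfun2P[]. Qed.

Lemma Lfun2_lincomb (a b : R) (f g : T -> R) : f \in L -> g \in L ->
  (fun x => a * f x + b * g x) \in L.
Proof.
move=> fL gL.
have -> : (fun x => a * f x + b * g x) = a *: f + b *: g by [].
have L1 := @Lfun_submod_closed _ _ _ mu 2%:E (lee1n 2).
have Z c h : h \in L -> c *: h \in L.
  by move=> hL; have := L1.2 c h 0 hL L1.1; rewrite addr0.
by have := L1.2 1 _ _ (Z a _ fL) (Z b _ gL); rewrite scale1r.
Qed.

Lemma Lfun2_mul_integrable (f g : T -> R) : f \in L -> g \in L ->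
  mu.-integrable setT (fun x => (f x * g x)%:E).
Proof.
by move=> fL gL; have /Lfun1_integrable := Lfun2_mul_Lfun1 fL gL.
Qed.

Variable I : finType.

(** The square-integrable families of functions, with no identification
    of functions that agree almost everywhere: completeness only speaks of
    distances. *)
Definition L2family := {f : I -> T -> R | forall i, f i \in L}.

Definition family_dot (f g : I -> T -> R) : R :=
  \sum_i \int[mu]_x (f i x * g i x).

Definition L2dot (f g : L2family) : R := family_dot (sval f) (sval g).

Definition family_sqr (f : I -> T -> R) : \bar R :=
  (\sum_i \int[mu]_x (f i x ^+ 2)%:E)%E.

Lemma family_dot_lincomb (a b : R) (f g h : I -> T -> R) :
  (forall i, f i \in L) -> (forall i, g i \in L) -> (forall i, h i \in L) ->
  family_dot (fun i x => a * f i x + b * g i x) h =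
  a * family_dot f h + b * family_dot g h.
Proof.
move=> fL gL hL; rewrite /family_dot !mulr_sumr -big_split/=.
apply: eq_bigr => i _.
rewrite -!RintegralZl//; try exact: Lfun2_mul_integrable.
rewrite -RintegralD//.
- by apply: eq_Rintegral => x _ /=; ring.
- by have := integrableZl measurableT a (Lfun2_mul_integrable (fL i) (hL i)).
- by have := integrableZl measurableT b (Lfun2_mul_integrable (gL i) (hL i)).
Qed.

Lemma L2dot_inner_product : inner_product L2dot.
Proof.
split.
- move=> f g; apply: eq_bigr => i _; apply: eq_Rintegral => x _.
  exact: mulrC.
- move=> f; apply: sumr_ge0 => i _; apply: Rintegral_ge0 => x _.
  by rewrite -expr2 sqr_ge0.
- move=> a b f g.
  exists (exist (fun f : I -> T -> R => forall i, f i \in L) _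
    (fun i => Lfun2_lincomb a b (svalP f i) (svalP g i))) => h.
  exact: family_dot_lincomb (svalP f) (svalP g) (svalP h).
Qed.

Lemma family_sqrE f : (forall i, f i \in L) -> family_sqr f = (family_dot f f)%:E.
Proof.
move=> fL; rewrite /family_sqr /family_dot -sumEFin; apply: eq_bigr => i _.
rewrite fineK; first by apply: eq_integral => x _; rewrite expr2.
exact: integrable_fin_num (Lfun2_mul_integrable (fL i) (fL i)).
Qed.

Lemma L2distE (f g : L2family) :
  ((ip_dist L2dot f g) ^+ 2)%:E = family_sqr (fun i x => sval f i x - sval g i x).
Proof.
have [w Hw Nw] := ip_sub L2dot_inner_product f g.
have E : (fun i x => sval f i x - sval g i x) =
    (fun i x => 1 * sval f i x + (-1) * sval g i x).
  by apply/funext => i; apply/funext => x; ring.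
have dL i := Lfun2_lincomb 1 (-1) (svalP f i) (svalP g i).
rewrite E family_sqrE//.
pose h : L2family := exist _ _ dL.
congr EFin; rewrite (ip_distE L2dot_inner_product).
have H k : L2dot h k = L2dot f k - L2dot g k.
  have := family_dot_lincomb 1 (-1) (svalP f) (svalP g) (svalP k).
  by rewrite mul1r mulN1r.
rewrite -[RHS]/(L2dot h h) H (ipC L2dot_inner_product f h) (ipC L2dot_inner_product g h).
by rewrite !H (ipC L2dot_inner_product g f); ring.
Qed.

End square_integrable.

Section riesz_fischer.
Context d (T : measurableType d) (R : realType).
Variable mu : {measure set T -> \bar R}.
Local Notation L := (Lfun mu 2%:E).

(** Lower semicontinuity of the squared norm along almost everywhere
    convergence; it transfers the Cauchy estimates to the limit function. *)
Lemma L2_fatou (f : nat -> T -> R) (g : T -> R) (C : \bar R) :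
  (forall n, measurable_fun setT (f n)) ->
  (forall n, (\int[mu]_x (f n x ^+ 2)%:E <= C)%E) ->
  measurable_fun setT g ->
  {ae mu, forall x, f n x @[n --> \oo] --> g x} ->
  (\int[mu]_x (g x ^+ 2)%:E <= C)%E.
Proof.
move=> mf fC mg fg.
have mf2 n : measurable_fun setT (fun x => (f n x ^+ 2)%:E).
  by apply/measurable_EFinP; exact: measurable_funX.
have f20 n x : setT x -> (0 <= (f n x ^+ 2)%:E)%E.
  by rewrite lee_fin sqr_ge0.
have H := fatou mu measurableT mf2 f20.
have -> : (\int[mu]_x (g x ^+ 2)%:E = \int[mu]_x limn_einf (fun n => (f n x ^+ 2)%:E))%E.
  apply: ge0_ae_eq_integral => //.
  - by apply/measurable_EFinP; exact: measurable_funX.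
  - rewrite [X in measurable_fun _ X](_ : _ =
      -%E \o (fun x => limn_esup (fun n => (- (f n x ^+ 2)%:E)%E)))//.
    apply: (measurableT_comp (@oppe_measurable R _)).
    apply: measurable_fun_limn_esup => n.
    exact: (measurableT_comp (@oppe_measurable R _) (mf2 n)).
  - by move=> x _; rewrite lee_fin sqr_ge0.
  - move=> x _; rewrite limn_einf_lim; apply: lime_ge; first exact: is_cvg_einfs.
    by apply: nearW => n; apply: le_ereal_inf_tmp => _ [k _ <-]; exact: f20.
  - apply: filterS fg => x fx _.
    have c : (f n x ^+ 2)%:E @[n --> \oo] --> (g x ^+ 2)%:E.
      by apply: cvg_EFin; [exact: nearW|]; apply: cvgM.
    by rewrite (cvg_limn_einf_sup c).1.
apply: (le_trans H); rewrite limn_einf_lim; apply: lime_le; first exact: is_cvg_einfs.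
apply: nearW => n; apply: (le_trans _ (fC n)); apply: ereal_inf_lbound.
by exists n => //=.
Qed.

(** By |t| <= 2^-n + 2^n t^2, convergence of the series of
    increments follows from that of the series of 2^n t_n^2, whose integral is
    finite. *)
Lemma fast_cauchy_ae_cvg (f : nat -> T -> R) :
  (forall n, f n \in L) ->
  (forall n, (\int[mu]_x ((f n.+1 x - f n x) ^+ 2)%:E <= (4 ^- n)%:E)%E) ->
  exists2 g : T -> R, measurable_fun setT g &
    {ae mu, forall x, f n x @[n --> \oo] --> g x}.
Proof.
move=> fL fC.
have mf n := Lfun2_measurable (fL n).
pose a n x : \bar R := (2 ^+ n * (f n.+1 x - f n x) ^+ 2)%:E.
have a0 n x : (0 <= a n x)%E
  by rewrite lee_fin; apply: mulr_ge0; [exact: exprn_ge0|exact: sqr_ge0].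
have ma n : measurable_fun setT (a n).
  apply/measurable_EFinP; apply: measurable_funM => //.
  by apply: measurable_funX; apply: measurable_funB.
pose G x := (\sum_(n <oo) a n x)%E.
have mG : measurable_fun setT G by apply: ge0_emeasurable_sum.
have iG : (\int[mu]_x G x < +oo)%E.
  rewrite integral_nneseries//.
  apply: (@le_lt_trans _ _ (\sum_(n <oo) (2 ^- n)%:E)%E).
    apply: lee_nneseries => [n _ _|n _]; first exact: integral_ge0.
    rewrite /a; under eq_integral do rewrite EFinM.
    rewrite ge0_integralZl_EFin ?exprn_ge0//; last 2 first.
    - by move=> x _; rewrite lee_fin sqr_ge0.
    - by apply/measurable_EFinP; apply: measurable_funX; apply: measurable_funB.
    apply: le_trans; first by apply: lee_wpmul2l (fC n); rewrite lee_fin exprn_ge0.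
    rewrite -EFinM lee_fin (_ : 4 = 2 * 2 :> R); last by rewrite -natrM.
    by rewrite exprMn invfM mulrA divff ?mul1r// expf_neq0.
  apply: (@le_lt_trans _ _ 2%:E); last exact: ltry.
  apply: le_trans (@epsilon_trick0 _ 2 xpredT _) => //.
  apply: lee_nneseries => [n _ _|n _]; first by rewrite lee_fin invr_ge0 exprn_ge0.
  by rewrite lee_fin -natrX expnS natrM invfM mulrA divff ?mul1r.
have gG : mu.-integrable setT G.
  apply/integrableP; split=> //.
  by under eq_integral => x _ do rewrite gee0_abs ?nneseries_ge0//.
pose D := [set x | (G x < +oo)%E].
have mD : measurable D.
  by rewrite -[D]setTI; exact: emeasurable_fun_infty_o.
have cD x : D x -> cvgn (fun n => f n x).
  move=> Dx; pose t n := f n.+1 x - f n x.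
  have bnd n : `|t n| <= 2 ^- n + 2 ^+ n * t n ^+ 2.
    have p0 : 0 < 2 ^+ n :> R by rewrite exprn_gt0.
    rewrite -(real_normK (num_real (t n))) -(ler_pM2l p0).
    rewrite mulrDr mulfV ?gt_eqF//.
    have := normr_ge0 (t n); move: (2 ^+ n) (`|t n|) p0 => p y p0 y0; nra.
  have cT : cvgn (series t).
    apply: normed_cvg; apply: nondecreasing_is_cvgn.
      by apply: nondecreasing_series => n _ _; exact: normr_ge0.
    exists (2 + fine (G x)) => _ [N _ <-].
    have G0 : (0 <= G x)%E by apply: nneseries_ge0 => n _ _; exact: a0.
    rewrite -lee_fin EFinD fineK ?ge0_fin_numE//.
    rewrite /series/= -sumEFin.
    apply: (@le_trans _ _ (\sum_(0 <= k < N) ((2 ^- k)%:E + a k x))%E).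
      by apply: lee_sum => k _; rewrite -EFinD lee_fin bnd.
    rewrite big_split/= leeD//.
      have -> : (\sum_(0 <= k < N) (2 ^- k)%:E)%E = (2 - 2 * 2 ^- N)%:E :> \bar R.
        elim: N => [|N IH]; first by rewrite big_geq// expr0 invr1; congr EFin; ring.
        rewrite big_nat_recr//= IH -EFinD exprS invfM; congr EFin.
        by move: (2 ^- N) => y; field.
      by rewrite lee_fin gerBl mulr_ge0// invr_ge0 exprn_ge0.
    by apply: (nneseries_lim_ge (P := xpredT)) => k _ _; exact: a0.
  rewrite (_ : (fun n => f n x) = (fun n => f 0%N x + series t n)).
    by apply: is_cvgD => //; exact: is_cvg_cst.
  by apply/funext => n; rewrite (eq_sum_telescope (fun n => f n x)).
exists (fun x => limn (fun n => f n x * \1_D x)).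
  apply: (measurable_fun_cvg (h := fun n x => f n x * \1_D x)).
    by move=> n; apply: measurable_funM => //; exact: measurable_indic.
  move=> x _; have [xD|xD] := pselect (D x); rewrite indicE.
    by rewrite mem_set//=; under eq_fun do rewrite mulr1; exact: cD.
  by rewrite memNset//=; under eq_fun do rewrite mulr0; exact: is_cvg_cst.
have := integrable_ae measurableT gG.
apply: filterS => x /(_ I) Gx.
have xD : D x by rewrite /D/= ltey_eq Gx.
rewrite (_ : (fun n => f n x * \1_D x) = f^~ x); first exact: cD.
by apply/funext => n; rewrite indicE mem_set//= mulr1.
Qed.

Lemma L2dot_complete (I : finType) : ip_complete (@L2dot _ _ _ mu I).
Proof.
move=> h hC.
have key n m i : (\int[mu]_x ((sval (h n) i x - sval (h m) i x) ^+ 2)%:E <=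
    (ip_dist (@L2dot _ _ _ mu I) (h n) (h m) ^+ 2)%:E)%E.
  rewrite L2distE /family_sqr (bigD1 i)//= leeDl// sume_ge0// => j _.
  by apply: integral_ge0 => x _; rewrite lee_fin sqr_ge0.
(* Along the subsequence [h (M k)] the increments decay fast enough for almost
   everywhere convergence. *)
have [N HN] : exists N : nat -> nat, forall k n m, (N k <= n)%N -> (N k <= m)%N ->
    ip_dist (@L2dot _ _ _ mu I) (h n) (h m) < 2 ^- k.
  have ex k : exists N, forall n m, (N <= n)%N -> (N <= m)%N ->
      ip_dist (@L2dot _ _ _ mu I) (h n) (h m) < 2 ^- k.
    by apply: hC; rewrite invr_gt0 exprn_gt0.
  by exists (fun k => sval (cid (ex k))) => k; exact: svalP (cid (ex k)).
pose M k := \max_(j < k.+1) N j.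
have MN k : (N k <= M k)%N.
  by have := @leq_bigmax _ (fun j : 'I_k.+1 => N j) ord_max.
have Mnd k m : (k <= m)%N -> (M k <= M m)%N.
  move=> km; apply/bigmax_leqP => i _.
  have im : (i < m.+1)%N by apply: (leq_trans (ltn_ord i)).
  exact: (@leq_bigmax _ (fun j : 'I_m.+1 => N j) (Ordinal im)).
have gex i : exists g : T -> R, measurable_fun setT g /\
    {ae mu, forall x, sval (h (M k)) i x @[k --> \oo] --> g x}.
  have [k|k|g mg gae] := @fast_cauchy_ae_cvg (fun k => sval (h (M k)) i).
  - exact: svalP (h (M k)) i.
  - apply: (le_trans (key _ _ _)); rewrite lee_fin.
    rewrite (_ : 4 = 2 ^+ 2 :> R); last by rewrite -natrX.
    rewrite -exprM mulnC exprM -exprVn ler_sqr ?nnegrE ?ip_dist_ge0 ?invr_ge0 ?exprn_ge0//.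
    apply/ltW/HN; last exact: MN.
    by apply: leq_trans (MN k) _; exact: Mnd.
  - by exists g.
pose g i := sval (cid (gex i)).
have mg i : measurable_fun setT (g i) by have [] := svalP (cid (gex i)).
have gae i : {ae mu, forall x, sval (h (M k)) i x @[k --> \oo] --> g i x}.
  by have [] := svalP (cid (gex i)).
have mh n i : measurable_fun setT (sval (h n) i).
  exact: Lfun2_measurable (svalP (h n) i).
have lim k n i : (N k <= n)%N ->
   (\int[mu]_x ((g i x - sval (h n) i x) ^+ 2)%:E <= ((2 ^- k) ^+ 2)%:E)%E.
  move=> kn; apply: (@L2_fatou (fun j x => sval (h (M (k + j)%N)) i x - sval (h n) i x)).
  - by move=> j; exact: measurable_funB.
  - move=> j; apply: (le_trans (key _ _ _)); rewrite lee_fin.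
    rewrite ler_sqr ?nnegrE ?ip_dist_ge0 ?invr_ge0 ?exprn_ge0//.
    apply/ltW/HN => //; apply: leq_trans (MN k) _.
    by apply: Mnd; rewrite leq_addr.
  - exact: measurable_funB.
  - apply: filterS (gae i) => x gx; apply: cvgB; last exact: cvg_cst.
    rewrite -(cvg_shiftn k) in gx.
    by under eq_fun do rewrite addnC.
have gL i : g i \in Lfun mu 2%:E.
  have D : (fun x => g i x - sval (h (N 0%N)) i x) \in Lfun mu 2%:E.
    apply/Lfun2P; split; first exact: measurable_funB.
    by apply: (le_lt_trans (lim 0%N _ i (leqnn _))); exact: ltry.
  have := Lfun2_lincomb 1 1 D (svalP (h (N 0%N)) i).
  rewrite (_ : (fun x => _) = g i)//.
  by apply/funext => x; rewrite !mul1r subrK.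
exists (exist (fun f : I -> T -> R => forall i, f i \in Lfun mu 2%:E) g gL) => e e0.
have [k kP] : exists k, #|I|%:R * (2 ^- k) ^+ 2 < e ^+ 2 :> R.
  have e1 : 0 < e ^+ 2 / (#|I|%:R + 1) by rewrite divr_gt0 ?exprn_gt0// ltr_wpDl.
  have [k] := exists_half_pow_lt e1; rewrite ltr_pdivlMr ?ltr_wpDl// => kP.
  exists k; apply: le_lt_trans kP; rewrite mulrC.
  have p0 : 0 <= 2 ^- k :> R by rewrite invr_ge0 exprn_ge0.
  have p1 : 2 ^- k <= 1 :> R by rewrite invf_le1 ?exprn_gt0// exprn_ege1// ler1n.
  have := ler0n R #|I|; move: (2 ^- k) #|I|%:R p0 p1 => p m p0 p1 m0.
  have : 0 <= p * m * (1 - p) by rewrite !mulr_ge0// subr_ge0.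
  by rewrite expr2; nra.
exists (N k) => n kn.
rewrite -ltr_sqr ?nnegrE ?ip_dist_ge0 ?(ltW e0)//.
apply: le_lt_trans kP; rewrite -lee_fin ip_distC; last exact: L2dot_inner_product.
rewrite L2distE /family_sqr/=.
apply: (@le_trans _ _ (\sum_(i : I) ((2 ^- k) ^+ 2)%:E)%E).
  by apply: lee_sum => i _; exact: lim.
by rewrite sumEFin lee_fin sumr_const mulr_natl.
Qed.

End riesz_fischer.

(** * The weak topology of H and the topology of paths *)

(** The hypothesis is downward closed in [e] so that minima of radii
    can be taken along the list. *)
Lemma common_radius (R : realFieldType) (T : eqType) (s : seq T)
    (P : T -> R -> Prop) :
  (forall p, p \in s -> exists2 e, 0 < e & forall e', e' <= e -> P p e') ->
  exists2 e, 0 < e & forall p, p \in s -> P p e.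
Proof.
move=> ex; suff [e e0 eP] : exists2 e, 0 < e &
    forall e', e' <= e -> forall p, p \in s -> P p e'.
  by exists e => // p; exact: eP.
elim: s ex => [_|p s IH ex]; first by exists 1.
have [|e e0 eP] := IH; first by move=> q qs; apply: ex; rewrite inE qs orbT.
have [|e1 e10 e1P] := ex p; first by rewrite inE eqxx.
exists (Num.min e e1); first by rewrite lt_min e0.
move=> e'; rewrite le_min => /andP[h h1] q; rewrite inE => /predU1P[->|qs].
  exact: e1P.
exact: eP.
Qed.

Section path_topology.
Variables (R : realType) (Om : smooth_domain R).

Definition ipH (u v : Hspace Om) : R := dotH (Hval u) (Hval v).

Lemma ipHC u v : ipH u v = ipH v u.
Proof.
by rewrite /ipH /dotH /dotL2; apply: eq_bigr => i _; congr Rintegral;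
  apply/funext => x; rewrite mulrC.
Qed.

(** Unfolds the weak uniformity, an initial uniformity over a
    product, into finitely many pairings at a common precision. *)
Lemma weak_entourage_sub (W : set (Hw Om * Hw Om)) : entourage W ->
  exists (I : eqType) (s : seq I) (z : I -> Hspace Om) (e : R), 0 < e /\
    forall x y : Hspace Om,
      (forall i, i \in s -> `|ipH (z i) x - ipH (z i) y| < e) -> W (x, y).
Proof.
case=> V [_ [F _ <-] FV] VW.
have [|e e0 eP] := @common_radius R _ (enum_fset F) (fun p e =>
    forall f g : {ptws Hspace Om -> R},
      `|f (projT1 p).1 - g (projT1 p).1| < e -> (projT1 p).2 (f, g)).
  case=> [[i A] /= /[dup] + p]; move=> /asboolP[B entB BA] _.
  move: entB => /=; rewrite -entourage_ballE => -[e /= e0 eB].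
  exists e => // e' e'e f g fg; apply: BA; apply: eB => /=.
  exact: lt_le_trans fg e'e.
exists _, (enum_fset F), (fun p => (sval p).1 : Hspace Om), e.
split=> // x y xy; apply: VW; apply: FV => p /= pF.
have xyp : `|ipH (sval p).1 x - ipH (sval p).1 y| < e.
  exact: xy.
rewrite (ipHC _ x) (ipHC _ y) in xyp.
exact: (eP p pF (weak_coordinates x) (weak_coordinates y)).
Qed.

Lemma weak_entourage (z : Hspace Om) (e : R) : 0 < e ->
  entourage [set xy : Hw Om * Hw Om | `|ipH z xy.1 - ipH z xy.2| < e].
Proof.
move=> e0; under eq_set do rewrite 2!(ipHC z).
exists [set fg : {ptws Hspace Om -> R} * {ptws Hspace Om -> R} |
   `|fg.1 z - fg.2 z| < e]; last by [].
pose B := [set xy : R * R | `|xy.1 - xy.2| < e].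
have eB : entourage B by rewrite -entourage_ballE; exists e.
(* The subbasic entourage of the product attached to the coordinate [z]. *)
pose p1 : {classic Hspace Om} * set ({ptws Hspace Om -> R} * {ptws Hspace Om -> R}) :=
  (z, [set fg | B (fg.1 z, fg.2 z)]).
have p1P : `[< @entourage (Uniform.Pack (Uniform.class (initial_topology (@proj _ (fun _ : Hspace Om => R) p1.1)))) p1.2 >].
  by apply/asboolP; exists B.
exists [set fg : {ptws Hspace Om -> R} * {ptws Hspace Om -> R} |
   `|fg.1 z - fg.2 z| < e]; last by [].
exists [fset (exist _ p1 p1P)]%fset; first by move=> ? ?; rewrite in_setT.
by apply/seteqP; split => fg /=;[move/(_ (exist _ p1 p1P)); apply; exact: fset11|
 by move=> H p /= /fset1P ->].
Qed.

Lemma pairing_continuous (z : Hspace Om) : continuous (ipH z : Hw Om -> R).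
Proof.
move=> x A /nbhs_ballP[e /= e0 eA].
have H0 := nbhs_entourage x (weak_entourage z e0).
by apply: (@filterS _ (nbhs x) (nbhs_filter x) _ _ _ H0) => y /xsectionP; exact: eA.
Qed.

Lemma cvg_weak (T : Type) (F : set_system T) (h : T -> Hw Om) (x : Hw Om) :
  Filter F -> (forall z, ipH z (h t) @[t --> F] --> ipH z x) -> h @ F --> x.
Proof.
move=> FF hx; apply/cvg_entourageP => E /weak_entourage_sub[I [s [g [e [e0 sE]]]]].
rewrite near_map.
suff: \forall t \near F, forall i, i \in s -> `|ipH (g i) x - ipH (g i) (h t)| < e.
  by apply: filterS => t /sE.
elim: s {sE} => [|z s IH]; first by apply: nearW.
have := IH; have /cvgrPdist_lt /(_ _ e0) := hx (g z).
apply: filterS2 => t H1 H2 z'; rewrite inE => /predU1P[->//|]; exact: H2.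
Qed.

Lemma path_continuous (u : Cw Om) (z : Hspace Om) :
  continuous (fun t : time R => ipH z (Cw_fun u t)).
Proof.
move=> t.
apply: (@continuous_comp _ _ _ (Cw_fun u : _ -> Hw Om) (ipH z)).
  exact: (@cts_fun _ _ (u : continuousType (time R) (Hw Om))).
exact: pairing_continuous.
Qed.

Lemma path_of_weakly_continuous (h : time R -> Hspace Om) :
  (forall z, continuous (fun t => ipH z (h t))) ->
  exists u : Cw Om, Cw_fun u = h.
Proof.
move=> hc.
have hC : continuous (h : time R -> Hw Om).
  by move=> t; apply: (@cvg_weak _ (nbhs t) h (h t) (nbhs_filter t)) => z; exact: hc.
by exists (mkcts hC : continuousType (time R) (Hw Om)).
Qed.

Lemma nbhs_path (u : Cw Om) (m e : R) (z : Hspace Om) : 0 < e ->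
  nbhs u [set v : Cw Om | forall t, time_val t <= m ->
    `|ipH z (Cw_fun v t) - ipH z (Cw_fun u t)| < e].
Proof.
move=> e0.
pose f0 := fun u : continuousType (time R) (Hw Om) =>
    (u : time R -> Hw Om) : {family @compact_intervals R, time R -> Hw Om}.
have ci : compact_intervals [set t : time R | 0 <= time_val t <= m].
  by exists 0 => //; exists m.
have := @fam_nbhs _ _ _ _ _ (f0 u) (weak_entourage z e0) ci.
move=> /(@initial_continuous _ _ f0 u) H0.
apply: (@filterS _ (nbhs u) (nbhs_filter u) _ _ _ H0) => v /= H t tm; rewrite distrC; apply: H.
by rewrite tm andbT; exact: set_mem (svalP t).
Qed.

Lemma cvg_path (T : Type) (F : set_system T) (h : T -> Cw Om) (u : Cw Om) :
  Filter F ->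
  (forall m e z, 0 < e -> \forall v \near F, forall t, time_val t <= m ->
    `|ipH z (Cw_fun (h v) t) - ipH z (Cw_fun u t)| < e) ->
  h @ F --> u.
Proof.
move=> FF H.
pose f0 := fun u : continuousType (time R) (Hw Om) =>
    (u : time R -> Hw Om) : {family @compact_intervals R, time R -> Hw Om}.
have cv : (f0 \o h) @ F --> f0 u.
  apply/fam_cvgP => _ [a _ [b _ <-]] P /uniform_nbhs[E [/weak_entourage_sub
    [I [s [g [e [e0 sE]]]]] EP]].
  suff: \forall v \near F, forall i, i \in s -> forall t, time_val t <= b ->
      `|ipH (g i) (Cw_fun (h v) t) - ipH (g i) (Cw_fun u t)| < e.
    apply: filterS => v Hv; apply: EP => t /= /andP[_ tb].
    by apply: sE => z zs; rewrite distrC; apply: Hv.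
  elim: s {sE} => [|z s IH]; first by apply: nearW.
  have := IH; have := H b _ (g z) e0.
  by apply: filterS2 => t H1 H2 z'; rewrite inE => /predU1P[->//|]; exact: H2.
move=> A [_ [[B Bop <-] Bfs] sBA].
have /cv H0 : nbhs (f0 u) B by apply: open_nbhs_nbhs.
by apply: (@filterS _ F FF _ _ _ H0) => v; exact: sBA.
Qed.

Lemma evaluation_continuous (t : time R) (z : Hspace Om) :
  continuous (fun u : Cw Om => ipH z (Cw_fun u t)).
Proof.
move=> u A /nbhs_ballP[e /= e0 eA].
have H0 := nbhs_path u (time_val t) z e0.
by apply: (@filterS _ (nbhs u) (nbhs_filter u) _ _ _ H0) => v /(_ t (lexx _)); rewrite distrC; exact: eA.
Qed.

Lemma shift_path_continuous (tau : time R) : continuous (@Defs.shift R Om tau).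
Proof.
move=> u; apply: (@cvg_path _ (nbhs u) _ _ (nbhs_filter u)) => m e z e0.
have H0 := nbhs_path u (m + time_val tau) z e0.
by apply: (@filterS _ (nbhs u) (nbhs_filter u) _ _ _ H0) => v H t tm; apply: H; rewrite /= lerD2r.
Qed.

Lemma time_val_inj : injective (@time_val R).
Proof. exact: val_inj. Qed.

End path_topology.

(** * H is a Hilbert space *)

Section Hspace_hilbert.
Variables (R : realType) (Om : smooth_domain R).
Local Notation mu := (lebesgue_dom Om).
Local Notation L := (Lfun mu 2%:E).

Lemma lebesgue_dom_finite : (mu [set: M3 R] < +oo)%E.
Proof.
have [M [_ /(_ (Num.max M 0 + 1))]] := @dom_bounded R Om.
set K := Num.max M 0 + 1.
have MK : M < K by rewrite /K ltr_pwDr// le_max lexx.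
move=> /(_ MK) domK.
pose B : set (measurableTypeR R) := `[- K, K]%classic.
have mB : measurable B by exact: measurable_itv.
rewrite /lebesgue_dom /= /mrestr setTI.
apply: (@le_lt_trans _ _ (lebesgue3 R ((B `*` B) `*` B))).
  apply: le_measure.
  - by rewrite inE; exact: open_measurable3 (@dom_open R Om).
  - by rewrite inE; apply: measurableX => //; exact: measurableX.
  - move=> x /domK /=; rewrite /Num.norm/= !ge_max => /andP[/andP[x1 x2] x3].
    by rewrite /B/= !in_itv/= -!ler_norml; split; [split|].
rewrite [X in (X < _)%E](_ : _ = (@lebesgue_measure R B * @lebesgue_measure R B *
    @lebesgue_measure R B)%E); last first.
  apply: etrans; first exact: (product_measure1E _ _ (measurableX mB mB) mB).
  by congr (_ * _)%E; exact: (product_measure1E _ _ mB mB).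
have Bf : (@lebesgue_measure R B < +oo)%E.
  rewrite lebesgue_measure_itv/=; case: ifP => _; last exact: ltry.
  by rewrite -EFinD ltry.
rewrite lte_mul_pinfty ?ge0_fin_numE ?mule_ge0//.
by rewrite lte_mul_pinfty ?ge0_fin_numE.
Qed.

Lemma continuous_measurable3 (g : E3 R -> R) : continuous g ->
  measurable_fun [set: M3 R] (g : M3 R -> measurableTypeR R).
Proof.
move=> cg; apply: (measurability _ (RGenOpens.measurableE R)).
move=> _ [_ [a [b ->] <-]]; rewrite setTI; apply: open_measurable3.
by apply: open_comp => //; exact: interval_open.
Qed.

(** Continuous functions of compact support are bounded, and the
    domain has finite measure. *)
Lemma test_function_L2 (g : E3 R -> R) : test_function (dom Om) g -> g \in L.
Proof.
move=> [sg [K [Kc KO g0]]].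
have gc : continuous g := (sg [::]).1.
have mg := continuous_measurable3 gc.
have [M [Mreal /(_ (M + 1))]] := compact_bounded (continuous_compact (continuous_subspaceT gc) Kc).
rewrite ltrDl => /(_ ltr01) MP.
have gM x : g x ^+ 2 <= (`|M| + 1) ^+ 2.
  rewrite -[leLHS]real_normK ?num_real// ler_sqr ?nnegrE//.
  have [Kx|Kx] := pselect (K x).
    by apply: (@le_trans _ _ (M + 1)); [apply: MP; exists x|rewrite lerD2r ler_norm].
  by rewrite g0// normr0 addr_ge0.
apply/Lfun2P; split => //.
apply: (@le_lt_trans _ _ (\int[mu]_x (((`|M| + 1) ^+ 2)%:E))%E).
  apply: ge0_le_integral => //.
  - by move=> x _; rewrite lee_fin sqr_ge0.
  - by apply/measurable_EFinP; exact: measurable_funX.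
  - by move=> x _; rewrite lee_fin.
rewrite integral_cst// lte_mul_pinfty ?lee_fin ?sqr_ge0//.
exact: lebesgue_dom_finite.
Qed.

(** The elements of the quotient are classes: a square-integrable
    function is replaced by the representative of its class. *)
Lemma L2_of_Lfun (g : M3 R -> R) : g \in L ->
  exists w : L2 Om, {ae mu, forall x, L2_fun w x = g x}.
Proof.
move=> /Lfun2P[mg ig].
have mg' : @measurable_fun _ _ (M3 R) (measurableTypeR R) setT g by exact: mg.
pose F : {mfun M3 R >-> measurableTypeR R} :=
  HB.pack (g : M3 R -> measurableTypeR R)
    (@isMeasurableFun.Build _ _ (M3 R) (measurableTypeR R) g mg').
pose W : {mfun_ mu, M3 R >-> measurableTypeR R} := \pi_({mfun_ mu, M3 R >-> measurableTypeR R})%qT F.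
have Wae : {ae mu, forall x, (W : M3 R -> R) x = g x}.
  have : repr W = F %[mod {mfun_ mu, M3 R >-> measurableTypeR R}]%qT.
    by rewrite reprK.
  move/eqP; rewrite eqmodE => /asboolP.
  by apply: filterS => x /(_ I).
have Wn : finite_norm mu 2%:R%:E W.
  rewrite /finite_norm unlock /Lnorm; apply: poweR_lty.
  rewrite (ge0_ae_eq_integral (g := fun x => (g x ^+ 2)%:E))//=.
  - apply/measurable_EFinP; apply: (@measurableT_comp _ _ _ _ _ _ (fun y : R => y `^ 2)) => //.
    by apply: measurableT_comp => //; exact: measurable_funP.
  - by apply/measurable_EFinP; exact: measurable_funX.
  - by move=> x _; rewrite lee_fin sqr_ge0.
  - apply: filterS Wae => x /= -> _.
    by rewrite powR_mulrn// real_normK ?num_real.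
pose w : LspaceType2 mu := HB.pack W (@isFinLebesgue.Build _ _ _ _ _ (lee1n 2) W Wn).
by exists w.
Qed.

Lemma L2_fun_Lfun (w : L2 Om) : L2_fun w \in L.
Proof.
rewrite inE; apply/andP; split; rewrite inE/=.
  pose W : {mfun_ mu, M3 R >-> measurableTypeR R} := (w : LspaceType2 mu).
  have mW : @measurable_fun _ _ (M3 R) (measurableTypeR R) setT W.
    exact: (measurable_funP (repr W)).
  exact: mW.
exact: (@Lebesgue_finite _ _ _ _ _ _ (w : LspaceType2 mu)).
Qed.

Lemma distL2E (I : finType) (f g : L2family mu I) :
  distL2 Om (sval f) (sval g) = ip_dist (@L2dot _ _ _ mu I) f g.
Proof.
have [w Hw Nw] := ip_sub (L2dot_inner_product mu I) f g.
have := L2distE f g.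
rewrite family_sqrE => [[E]|i]; last first.
  rewrite (_ : (fun x => _) = (fun x => 1 * sval f i x + (-1) * sval g i x)).
    by apply: Lfun2_lincomb; [exact: svalP f i|exact: svalP g i].
  by apply/funext => x; ring.
by rewrite /distL2 /normL2 /dotL2 -[RHS]ger0_norm ?ip_dist_ge0// -sqrtr_sqr E.
Qed.

Definition Hfamily (u : Hspace Om) : L2family mu 'I_3 :=
  exist (fun f : 'I_3 -> M3 R -> R => forall i, f i \in L)
    (components (Hval u)) (fun i => L2_fun_Lfun (Hval u i)).

Lemma ipHE u v : ipH u v = L2dot (Hfamily u) (Hfamily v).
Proof. by []. Qed.

Lemma distHE u v : distH (Hval u) (Hval v) = ip_dist (@ipH R Om) u v.
Proof. exact: (distL2E (Hfamily u) (Hfamily v)). Qed.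

Lemma derive_lincomb (V : normedModType R) (a b : R) (f g : V -> R) x v :
  derivable f x v -> derivable g x v ->
  derivable (fun y => a * f y + b * g y) x v /\
  'D_v (fun y => a * f y + b * g y) x = a * 'D_v f x + b * 'D_v g x.
Proof.
move=> df dg.
have daf : derivable (a \*: f) x v by exact: derivableZ.
have dbg : derivable (b \*: g) x v by exact: derivableZ.
have E : (fun y => a * f y + b * g y) = (a \*: f) + (b \*: g) by [].
rewrite E; split; first exact: derivableD.
by rewrite (deriveD daf dbg) (deriveZ _ df) (deriveZ _ dg).
Qed.

Lemma test_lincomb (V : normedModType R) (O : set V) (a b : R) (f g : V -> R) :
  test_function O f -> test_function O g ->
  test_function O (fun x => a * f x + b * g x).
Proof.
move=> [sf [K [Kc KO f0]]] [sg [K' [Kc' KO' g0]]]; split; last first.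
  exists (K `|` K'); split; first exact: compactU.
    by move=> x [/KO|/KO'].
  by move=> x /not_orP[/f0 -> /g0 ->]; rewrite !mulr0 addr0.
have E vs : iter_derive vs (fun x => a * f x + b * g x) =
    (fun x => a * iter_derive vs f x + b * iter_derive vs g x).
  elim: vs => //= v vs ->; apply/funext => x.
  exact: (derive_lincomb a b ((sf vs).2 v x) ((sg vs).2 v x)).2.
move=> vs; rewrite E; split=> [x|v x].
  by apply: cvgD; apply: cvgM; (try exact: cvg_cst); [exact: (sf vs).1|exact: (sg vs).1].
exact: (derive_lincomb a b ((sf vs).2 v x) ((sg vs).2 v x)).1.
Qed.

Lemma solenoidal_lincomb (a b : R) (f g : 'I_3 -> E3 R -> R) :
  solenoidal_test Om f -> solenoidal_test Om g ->
  solenoidal_test Om (fun i x => a * f i x + b * g i x).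
Proof.
move=> [tf df] [tg dg]; split=> [i|x]; first exact: test_lincomb.
have H : a * (\sum_(i < 3) 'D_(basis_vec R i) (f i) x) +
  b * (\sum_(i < 3) 'D_(basis_vec R i) (g i) x) = 0.
  by rewrite df dg !mulr0 addr0.
rewrite -[RHS]H !mulr_sumr -big_split/=; apply: eq_bigr => i _.
exact: (derive_lincomb a b (((tf i).1 [::]).2 _ x) (((tg i).1 [::]).2 _ x)).2.
Qed.

Definition solenoidal_family (phi : 'I_3 -> E3 R -> R)
    (tphi : solenoidal_test Om phi) : L2family mu 'I_3 :=
  exist (fun f : 'I_3 -> M3 R -> R => forall i, f i \in L)
    phi (fun i => test_function_L2 (tphi.1 i)).

Local Notation dist := (ip_dist (@L2dot _ _ _ mu 'I_3)).
Let ipP := L2dot_inner_product mu 'I_3.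

Lemma Hfamily_approx (u : Hspace Om) (e : R) : 0 < e ->
  exists phi (tphi : solenoidal_test Om phi),
    dist (Hfamily u) (solenoidal_family tphi) < e.
Proof.
move=> e0; have [phi tphi] := set_mem (svalP u) e e0.
by exists phi, tphi; rewrite -distL2E.
Qed.

(** H is closed in the space of square-integrable families: a
    family that solenoidal test fields approximate is, up to null sets, an
    element of H. Both the linear combinations and the limits of H are built
    in the larger space and brought back by this lemma. *)
Lemma Hspace_of_family (x : L2family mu 'I_3) :
  (forall e, 0 < e -> exists phi (tphi : solenoidal_test Om phi),
    dist x (solenoidal_family tphi) < e) ->
  exists h : Hspace Om, forall z, L2dot (Hfamily h) z = L2dot x z.
Proof.
move=> xe.
have ex i : exists w : L2 Om, {ae mu, forall y, L2_fun w y = sval x i y}.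
  exact/L2_of_Lfun/(svalP x).
pose w : vL2 Om := [ffun i => sval (cid (ex i))].
have wae i : {ae mu, forall y, components w i y = sval x i y}.
  by rewrite /components ffunE; exact: svalP (cid (ex i)).
pose W : L2family mu 'I_3 := exist (fun f : 'I_3 -> M3 R -> R => forall i, f i \in L)
    (components w) (fun i => L2_fun_Lfun (w i)).
have Wz z : L2dot W z = L2dot x z.
  apply: eq_bigr => i _; congr fine; apply: ae_eq_integral => //.
  - apply/measurable_EFinP; apply: measurable_funM.
      exact: Lfun2_measurable (svalP W i).
    exact: Lfun2_measurable (svalP z i).
  - apply/measurable_EFinP; apply: measurable_funM.
      exact: Lfun2_measurable (svalP x i).
    exact: Lfun2_measurable (svalP z i).
  - have H := wae i; apply: (@filterS _ _ (ae_filter_ringOfSetsType mu) _ _ _ H).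
    by move=> y yx _; rewrite /W/= yx.
have wH : w \in Hset (Om := Om).
  apply/mem_set => e e0; have [phi [tphi xphi]] := xe _ e0; exists phi => //.
  rewrite (distL2E W (solenoidal_family tphi)).
  by apply: le_lt_trans xphi; rewrite /ip_dist !Wz (ipC ipP x W) Wz.
by exists (exist (fun u => u \in Hset (Om:=Om)) w wH).
Qed.

Lemma ipH_inner_product : inner_product (@ipH R Om).
Proof.
split=> [u v|u|a b u v]; first exact: ipHC.
  exact: (ip_ge0 ipP (Hfamily u)).
have [x Hx] := ip_lincomb ipP a b (Hfamily u) (Hfamily v).
have [|h Hh] := @Hspace_of_family x; last first.
  by exists h => z; rewrite ipHE Hh Hx.
move=> e e0.
have c0 : 0 < `|a| + `|b| + 1 by rewrite ltr_wpDl// addr_ge0.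
have e1 : 0 < e / (`|a| + `|b| + 1) by rewrite divr_gt0.
have [phi [tphi uphi]] := Hfamily_approx u e1.
have [psi [tpsi vpsi]] := Hfamily_approx v e1.
exists _, (solenoidal_lincomb a b tphi tpsi).
set s := solenoidal_family _.
have sE z : L2dot s z = a * L2dot (solenoidal_family tphi) z +
    b * L2dot (solenoidal_family tpsi) z.
  exact: family_dot_lincomb (svalP (solenoidal_family tphi))
    (svalP (solenoidal_family tpsi)) (svalP z).
(* The error r = x - s of the combined approximation is bounded through
   |r|^2 = a (p, r) + b (q, r), with [p] and [q] the two errors. *)
have [p Hp Np] := ip_sub ipP (Hfamily u) (solenoidal_family tphi).
have [q Hq Nq] := ip_sub ipP (Hfamily v) (solenoidal_family tpsi).
have [r Hr Nr] := ip_sub ipP x s.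
have rE z : L2dot r z = a * L2dot p z + b * L2dot q z.
  by rewrite Hr Hp Hq Hx sE; ring.
rewrite -Nr.
have rr : ip_norm (@L2dot _ _ _ mu 'I_3) r <= `|a| * dist (Hfamily u) (solenoidal_family tphi) +
    `|b| * dist (Hfamily v) (solenoidal_family tpsi).
  rewrite -Np -Nq.
  have [->|rn0] := eqVneq (ip_norm (@L2dot _ _ _ mu 'I_3) r) 0.
    by rewrite addr_ge0// mulr_ge0// ip_norm_ge0.
  have r0 : 0 < ip_norm (@L2dot _ _ _ mu 'I_3) r by rewrite lt_def rn0 ip_norm_ge0.
  rewrite -(ler_pM2r r0) -expr2 (ip_normE ipP) rE mulrDl -!mulrA.
  apply: lerD; (apply: (le_trans (ler_norm _)); rewrite normrM;
    apply: ler_wpM2l => //; exact: ip_le).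
apply: le_lt_trans rr _.
set z := dist (Hfamily u) _ in uphi *; set y := dist (Hfamily v) _ in vpsi *.
set A := `|a| in c0 uphi vpsi *; set B := `|b| in c0 uphi vpsi *.
have : A * z + B * y <= (A + B) * (e / (A + B + 1)).
  by rewrite mulrDl lerD// ler_wpM2l ?normr_ge0//; exact: ltW.
move=> /le_lt_trans; apply.
rewrite mulrCA gtr_pMr// ltr_pdivrMr// mul1r; lra.
Qed.

Lemma ipH_complete : ip_complete (@ipH R Om).
Proof.
move=> h hC.
have [x Hx] := @L2dot_complete _ _ _ mu 'I_3 (fun n => Hfamily (h n)) hC.
have [|l Hl] := @Hspace_of_family x; last first.
  exists l => e /Hx[N HN]; exists N => n /HN.
  rewrite /ip_dist !ipHE Hl.
  by rewrite (ipC ipP _ (Hfamily l)) Hl (ipC ipP x (Hfamily l)) Hl (ipC ipP x (Hfamily (h n))).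
move=> e e0; have e2 : 0 < e / 2 by rewrite divr_gt0.
have [N /(_ N (leqnn _)) HN] := Hx _ e2.
have [phi [tphi uphi]] := Hfamily_approx (h N) e2.
exists phi, tphi; apply: le_lt_trans (ip_dist_triangle ipP (Hfamily (h N)) _ _) _.
by rewrite (ip_distC ipP) (splitr e) ltrD.
Qed.

End Hspace_hilbert.

(** * H is separable *)

(** The point [y] may lie outside [K], as the points of a finite net of [K]
    do. *)
Lemma compact_modulus (R : realType) (T : pseudoMetricType R) (K : set T)
    (f : T -> R) (e : R) : compact K -> continuous f -> 0 < e ->
  exists n : nat, forall x y, K x -> ball x n.+1%:R^-1 y -> `|f x - f y| < e.
Proof.
move=> /compact_near_coveringP Kc fc e0.
pose P (n : nat) (x : T) := forall y, ball x n.+1%:R^-1 y -> `|f x - f y| < e.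
have : \forall n \near \oo, K `<=` P n.
  apply: Kc => x Kx.
  have e2 : 0 < e / 2 by rewrite divr_gt0.
  have /cvgrPdist_lt /(_ _ e2) /nbhs_ballP[r /= r0 rf] := fc x.
  have r2 : 0 < r / 2 by rewrite divr_gt0.
  exists (ball x (r / 2), [set n | n.+1%:R^-1 < r / 2]); first split => /=.
  - exact: nbhsx_ballx.
  - exact: (near_infty_natSinv_lt (PosNum r2)).
  move=> [x' n] /= [xx' nr] y x'y.
  have A : `|f x - f x'| < e / 2.
    by apply: rf; apply: le_ball xx'; move: r0; lra.
  have B : `|f x - f y| < e / 2.
    apply: rf; rewrite /= (splitr r); apply: (ball_triangle xx').
    by apply: le_ball x'y; exact: ltW.
  rewrite (_ : f x' - f y = (f x - f y) - (f x - f x')); last ring.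
  by rewrite (le_lt_trans (ler_normB _ _))// (splitr e) ltrD.
case=> N _ /(_ N (leqnn N)) H; exists N => x y Kx; exact: H.
Qed.

Lemma compact_net (R : realType) (T : pseudoMetricType R) (K : set T) (r : R) :
  compact K -> 0 < r ->
  exists s : seq T, forall x, K x -> exists2 t, t \in s & ball t r x.
Proof.
move=> /compact_near_coveringP Kc r0.
(* The filter of the lists that contain all entries of a given list. *)
pose F := filter_from [set: seq T] (fun s => [set s' : seq T | {subset s <= s'}]).
have FF : Filter F.
  apply: filter_from_filter; first by exists [::].
  move=> s s' _ _; exists (s ++ s') => // l H; split => t ts;
    by apply: H; rewrite mem_cat ts ?orbT.
have [|s _ H] := Kc _ F (fun s x => exists2 t, t \in s & ball t r x) FF.
  move=> x Kx.
  exists (ball x r, [set s : seq T | {subset [:: x] <= s}]); first split => /=.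
  - exact: nbhsx_ballx.
  - by exists [:: x].
  by move=> [x' s] /= [xx' xs]; exists x => //; apply: xs; rewrite inE.
by exists s => x Kx; apply: H.
Qed.

Lemma floor_eq_dist (R : archiRealFieldType) (x y : R) :
  Num.floor x = Num.floor y -> `|x - y| < 1.
Proof.
move=> E; have /andP[] := floor_itv x; have /andP[] := floor_itv y.
rewrite E intrD; move: (_%:~R) => z; rewrite ltr_norml => *.
by apply/andP; split; lra.
Qed.

(** A countable invariant that determines a continuous function up to
    [e] on a compact set: the index of a modulus of continuity, and the values
    rounded to multiples of [e / 4] on the corresponding finite net. It expresses
    that continuous functions on a compact set form a separable space. *)
Lemma compact_code (R : realType) (T : pseudoMetricType R) (K : set T) (e : R) :
  compact K -> 0 < e ->
  exists code : (T -> R) -> nat * seq int,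
    forall f g, continuous f -> continuous g -> code f = code g ->
      forall x, K x -> `|f x - g x| <= e.
Proof.
move=> Kc e0; have e4 : 0 < e / 4 by rewrite divr_gt0.
have n0 n : 0 < n.+1%:R^-1 :> R by rewrite invr_gt0.
pose net n := sval (cid (compact_net Kc (n0 n))).
have netP n x : K x -> exists2 t, t \in net n & ball t n.+1%:R^-1 x.
  exact: (svalP (cid (compact_net Kc (n0 n)))).
pose mod (f : T -> R) := [set n | forall x y, K x -> ball x n.+1%:R^-1 y ->
  `|f x - f y| < e / 4].
exists (fun f => (xget 0%N (mod f), map (fun t => Num.floor (f t / (e / 4)))
  (net (xget 0%N (mod f))))).
move=> f g fc gc [nE sE] x Kx.
have modP h : continuous h -> mod h (xget 0%N (mod h)).
  move=> hc; have [n nP] := compact_modulus Kc hc e4.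
  exact: (xgetI 0%N (nP : mod h n)).
have fP := modP f fc; have gP := modP g gc.
rewrite -nE in sE gP; move: (xget 0%N (mod f)) sE fP gP => n sE fP gP.
(* Three errors below [e / 4]: from [x] to the net for [f] and for [g], and the
   rounding at the net point. *)
have [t tn tx] := netP n x Kx.
have F := fP _ _ Kx (ball_sym tx); have G := gP _ _ Kx (ball_sym tx).
have /eq_in_map /(_ t tn) /floor_eq_dist := sE.
rewrite -mulrBl normrM normfV [X in _ / X]gtr0_norm// ltr_pdivrMr// mul1r => H.
rewrite (_ : f x - g x = (f x - f t) + (f t - g t) - (g x - g t)); last ring.
apply: (le_trans (ler_normB _ _)); apply: (le_trans (lerD (ler_normD _ _) (lexx _))).
lra.
Qed.

Lemma closed_box_compact (R : realType) (M : R) :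
  compact [set x : E3 R | `|x| <= M].
Proof.
pose I : set R := `[- M, M]%classic.
have Ic : compact I by exact: segment_compact.
have := compact_setX (compact_setX Ic Ic) Ic.
congr compact; apply/seteqP; split => x /=;
  rewrite /I/= !in_itv/= -!ler_norml /Num.norm/= !ge_max.
  by move=> [[-> ->] ->].
by move=> /andP[/andP[]].
Qed.

Section Hspace_separable.
Variables (R : realType) (Om : smooth_domain R).
Local Notation mu := (lebesgue_dom Om).
Local Notation dist := (ip_dist (@L2dot _ _ _ mu 'I_3)).

Lemma dom_norm_bound : exists M : R, forall x, dom Om x -> `|x| <= M.
Proof.
have [M [_ /(_ (M + 1))]] := @dom_bounded R Om.
by rewrite ltrDl => /(_ ltr01) H; exists (M + 1).
Qed.

(** Test fields vanish outside the domain, which lies in a compact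
    box: a uniform bound on the box bounds the distance in L^2. *)
Lemma solenoidal_code (e : R) : 0 < e ->
  exists code : ('I_3 -> E3 R -> R) -> {ffun 'I_3 -> nat * seq int},
    forall phi psi (tphi : solenoidal_test Om phi) (tpsi : solenoidal_test Om psi),
      code phi = code psi ->
      dist (solenoidal_family tphi) (solenoidal_family tpsi) < e.
Proof.
move=> e0; have [M HM] := dom_norm_bound.
pose m := fine (mu setT).
have m0 : 0 <= m by rewrite fine_ge0.
(* The squared distance is at most 3 m d^2, where [m] is the measure of the
   domain and [d] the uniform precision. *)
pose k := 3 * m + 1.
have k0 : 0 < k by rewrite /k ltr_wpDl// mulr_ge0.
have d0 : 0 < Num.min 1 (e ^+ 2 / k) / 2.
  by rewrite divr_gt0// lt_min ltr01 divr_gt0// exprn_gt0.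
have [code codeP] := compact_code (@closed_box_compact R M) d0.
set d := Num.min 1 (e ^+ 2 / k) / 2 in codeP d0.
exists (fun phi => [ffun i => code (phi i)]) => phi psi tphi tpsi /ffunP E.
rewrite -ltr_sqr ?nnegrE ?ip_dist_ge0 ?(ltW e0)// -lte_fin L2distE /family_sqr.
have B i x : dom Om x -> (phi i x - psi i x) ^+ 2 <= d ^+ 2.
  move=> Dx; rewrite -[leLHS]real_normK ?num_real// ler_sqr ?nnegrE ?(ltW d0)//.
  apply: codeP; [exact: ((tphi.1 i).1 [::]).1|exact: ((tpsi.1 i).1 [::]).1| |].
    by have := E i; rewrite !ffunE.
  exact: HM.
have z (f : 'I_3 -> E3 R -> R) (tf : solenoidal_test Om f) i x : ~ dom Om x -> f i x = 0.
  by move=> Dx; have [_ [K [_ KO f0]]] := tf.1 i; apply: f0 => /KO.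
have I i : (\int[mu]_x ((phi i x - psi i x) ^+ 2)%:E <= (d ^+ 2 * m)%:E)%E.
  apply: (@le_trans _ _ (\int[mu]_x (d ^+ 2)%:E)%E).
    apply: ge0_le_integral => //.
    - by move=> x _; rewrite lee_fin sqr_ge0.
    - apply/measurable_EFinP; apply: measurable_funX; apply: measurable_funB.
        exact: continuous_measurable3 ((tphi.1 i).1 [::]).1.
      exact: continuous_measurable3 ((tpsi.1 i).1 [::]).1.
    - move=> x _; rewrite lee_fin.
      have [Dx|Dx] := pselect (dom Om x); first exact: B.
      by rewrite (z phi)// (z psi)// subrr expr0n/= sqr_ge0.
  rewrite integral_cst// [leRHS]EFinM /m fineK// ge0_fin_numE//.
  exact: lebesgue_dom_finite.
apply: (@le_lt_trans _ _ (\sum_(i < 3) (d ^+ 2 * m)%:E)%E).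
  by apply: lee_sum => i _; exact: I.
rewrite sumEFin lte_fin sumr_const card_ord -mulr_natl.
have d1 : d <= 2^-1 by rewrite /d ler_pdivrMr// mulVf// ge_min lexx.
have d2 : d * k <= e ^+ 2 / 2.
  rewrite -ler_pdivlMr// mulrAC ler_pM2r// ge_min lexx orbT//.
have e20 : 0 < e ^+ 2 by rewrite exprn_gt0.
have : d ^+ 2 * k <= d * k.
  by rewrite ler_pM2r// expr2 ger_pMr//; lra.
move: d2 e20; rewrite /k mulrDr mulr1 mulrDr mulr1.
have := sqr_ge0 d; move: (e ^+ 2) (d ^+ 2) => E2 d22; nra.
Qed.

(** One element of H is chosen for each precision [2 ^- k] and each code
    [c] among those close to a test field of code [c]: the codes are
    countable, and two elements sharing a code are within 3 * 2 ^- k. *)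
Lemma ipH_dense : exists d : nat -> Hspace Om, ip_dense (@ipH R Om) d.
Proof.
have h0 k : 0 < 2 ^- k :> R by rewrite invr_gt0 exprn_gt0.
pose code k := sval (cid (solenoidal_code (h0 k))).
have codeP k phi psi (tphi : solenoidal_test Om phi) (tpsi : solenoidal_test Om psi) :
    code k phi = code k psi ->
    dist (solenoidal_family tphi) (solenoidal_family tpsi) < 2 ^- k.
  exact: (svalP (cid (solenoidal_code (h0 k)))).
pose C : countType := {ffun 'I_3 -> nat * seq int}.
pose coded (k : nat) (c : C) := [set u : Hspace Om |
  exists phi (tphi : solenoidal_test Om phi), code k phi = c /\
    dist (Hfamily u) (solenoidal_family tphi) < 2 ^- k].
exists (fun n => if (choice.unpickle n : option (nat * C)) is Some (k, c) then xget point (coded k c) else point).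
move=> u e e0; have e3 : 0 < e / 3 by rewrite divr_gt0.
have [k kP] := exists_half_pow_lt e3.
have [phi [tphi uphi]] := Hfamily_approx u (h0 k).
have nu : coded k (code k phi) u by exists phi, tphi.
exists (choice.pickle (k, code k phi : C)); rewrite choice.pickleK.
have [psi [tpsi [cE vpsi]]] := xgetI point nu.
set v := xget _ _ in vpsi *.
have ipP := L2dot_inner_product mu 'I_3.
rewrite -[ip_dist _ _ _]/(dist (Hfamily v) (Hfamily u)).
apply: le_lt_trans (ip_dist_triangle ipP (solenoidal_family tpsi) _ _) _.
apply: (@le_lt_trans _ _ (2 ^- k + (2 ^- k + 2 ^- k))); last lra.
apply: lerD; first exact: ltW.
apply: le_trans (ip_dist_triangle ipP (solenoidal_family tphi) _ _) _.
apply: lerD; apply: ltW; last by rewrite (ip_distC ipP).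
exact: codeP.
Qed.

End Hspace_separable.

(** * Measurability of evaluation along paths *)

Lemma le_at_rational (R : realType) (g : R -> R) (m c : R) : continuous g ->
  (forall q : rat, ratr q <= m -> g (ratr q) <= c) -> forall t, t <= m -> g t <= c.
Proof.
move=> gc H t tm; apply/ler_addgt0Pr => e e0.
have /cvgrPdist_lt /(_ _ e0) /nbhs_ballP[r /= r0 rg] := gc t.
have [q] : exists q : rat, ratr q \in `](t - r), t[%R.
  by apply: rat_in_itvoo; rewrite ltrBlDr ltrDl.
rewrite in_itv/= => /andP[q1 q2].
have := H q (ltW (lt_le_trans q2 tm)).
have /rg /= : ball t r (ratr q).
  by rewrite /ball/= ltr_norml; apply/andP; split; lra.
by rewrite ltr_norml => /andP[_]; lra.
Qed.

Lemma bigcup_countType_measurable dT (T : measurableType dT) (I : countType)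
    (P : set I) (F : I -> set T) :
  (forall i, P i -> measurable (F i)) -> measurable (\bigcup_(i in P) F i).
Proof.
move=> mF; rewrite bigcup_mkcond.
apply: countable_bigcupT_measurable => [|i]; first exact: countableP.
by case: ifP => // /set_mem; exact: mF.
Qed.

Section path_measurability.
Variables (R : realType) (Om : smooth_domain R).
Local Notation ip := (@ipH R Om).
Local Notation norm := (ip_norm (@ipH R Om)).
Local Notation Hp := (ipH_inner_product Om).

(** Negative times are sent to 0, so that time ranges over the whole line and
    the Lebesgue measure applies to it. *)
Definition path_at (u : Cw Om) (t : R) : Hspace Om := Cw_fun u (time_of t).

Lemma time_of_val (t : time R) : time_of (time_val t) = t.
Proof.
apply: time_val_inj; rewrite /time_val /=; apply/max_idPr.
exact: set_mem (svalP t).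
Qed.

Lemma time_of_continuous : continuous (@time_of R).
Proof.
apply: continuous_comp_initial => t.
have -> : set_val \o @time_of R = (fun s => Num.max 0 s) by [].
by apply: (@continuous_max _ _ (cst 0) id); [exact: cvg_cst|exact: cvg_id].
Qed.

Lemma path_at_continuous (u : Cw Om) (z : Hspace Om) :
  continuous (fun t => ip z (path_at u t)).
Proof.
move=> t; apply: (@continuous_comp _ _ _ (@time_of R) (fun s => ip z (Cw_fun u s))).
  exact: time_of_continuous.
exact: path_continuous.
Qed.

Lemma open_borelCw (U : set (Cw Om)) : open U -> measurable (U : set (borelCw Om)).
Proof. by move=> oU; apply: sub_sigma_algebra. Qed.

Lemma continuous_borelCw (g : Cw Om -> R) : continuous g ->
  measurable_fun setT (g : borelCw Om -> R).
Proof.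
move=> cg; apply: (measurability _ (RGenOpens.measurableE R)).
move=> _ [_ [a [b ->] <-]]; rewrite setTI; apply: open_borelCw.
by apply: open_comp => //; exact: interval_open.
Qed.

Lemma path_at_measurable (t : R) (z : Hspace Om) :
  measurable_fun setT (fun u : borelCw Om => ip z (path_at u t)).
Proof. exact: (continuous_borelCw (@evaluation_continuous _ _ (time_of t) z)). Qed.

Lemma shift_measurable (tau : time R) :
  measurable_fun setT (Defs.shift tau : borelCw Om -> borelCw Om).
Proof.
apply: measurability => //.
move=> _ [U oU <-]; rewrite setTI; apply: open_borelCw.
by apply: open_comp => //; move=> x _; exact: shift_path_continuous.
Qed.

Variables (d : nat -> Hspace Om) (dd : ip_dense ip d).

(** A norm bound is a countable family of closed conditions on the
    coordinates: this is how strong balls become visible to the weak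
    structure. *)
Lemma norm_le_coord (M : R) u : 0 <= M ->
  (norm u <= M) <-> (forall i, ip (d i) u <= M * norm (d i)).
Proof.
move=> M0; split=> [uM i|H]; last first.
  by apply: (ip_norm_lbound Hp dd M0) => i; rewrite ipHC.
have := ip_le Hp (d i) u; rewrite ler_norml => /andP[_ /le_trans]; apply.
by rewrite mulrC ler_wpM2r// ip_norm_ge0.
Qed.

Lemma dist_le_coord (M : R) u v : 0 <= M ->
  (ip_dist ip u v <= M) <->
  (forall i, ip (d i) u - ip (d i) v <= M * norm (d i)).
Proof.
move=> M0; have [w Hw <-] := ip_sub Hp u v.
have E i : ip (d i) w = ip (d i) u - ip (d i) v.
  by rewrite ipHC Hw (ipHC u) (ipHC v).
by rewrite norm_le_coord//; split=> H i; have := H i; rewrite E.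
Qed.

(** A strongly open set is a countable union of closed balls
    with centres in the dense sequence, and a closed ball is a countable
    intersection of conditions on the coordinates. In particular the Borel
    sets of the strong topology are generated by the coordinates. *)
Lemma measurable_fun_borelH dT (T : measurableType dT) (g : T -> borelH Om) :
  (forall i, measurable_fun setT (fun x => ip (d i) (g x))) ->
  measurable_fun setT g.
Proof.
move=> mg; apply: measurability => //.
move=> _ [U oU <-]; rewrite setTI.
pose B (kr : nat * rat) : set (Hspace Om) :=
  [set v | 0 <= ratr kr.2 :> R /\ ip_dist ip v (d kr.1) <= ratr kr.2].
pose P (kr : nat * rat) := `[< B kr `<=` U >].
have -> : U = \bigcup_(kr in [set kr | P kr]) B kr.
  apply/seteqP; split=> [u Uu|u [kr /asboolP]]; last exact.
  have [r r0 rU] := oU u Uu.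
  have r2 : 0 < r / 2 by rewrite divr_gt0.
  have [q] : exists q : rat, ratr q \in `]0, (r / 2)[%R by exact: rat_in_itvoo.
  rewrite in_itv/= => /andP[q0 qr].
  have [k kq] := dd u q0.
  exists (k, q); last by split; [exact: ltW|rewrite (ip_distC Hp) ltW].
  apply/asboolP => v [_ /= vk]; apply: rU; rewrite distHE.
  apply: (le_lt_trans (ip_dist_triangle Hp (d k) _ _)).
  by rewrite (splitr r) ltrD// ?(le_lt_trans vk)// (lt_trans kq).
rewrite preimage_bigcup; apply: bigcup_countType_measurable => -[k q] _.
have [q0|q0] := boolP (0 <= ratr q :> R); last first.
  by rewrite [X in measurable X](_ : _ = set0)// -subset0 => x [] /=; rewrite (negbTE q0).
have -> : g @^-1` B (k, q) = \bigcap_i ([set: T] `&`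
    (fun x => ip (d i) (g x)) @^-1` `]-oo, (ratr q * norm (d i) + ip (d i) (d k))]).
  apply/seteqP; split=> x.
    by move=> [_ /dist_le_coord H] i _; split=> //=; rewrite in_itv/= -lerBlDr; exact: H.
  move=> H; split => //=; apply/dist_le_coord => // i.
  by have [_ /=] := H i I; rewrite in_itv/= -lerBlDr.
by apply: bigcap_measurable => [|i _]; [exact: ex_intro _ 0%N _|exact: mg].
Qed.

Lemma path_at_measurable_borelH (t : R) :
  measurable_fun setT ((fun u => path_at u t) : borelCw Om -> borelH Om).
Proof. by apply: measurable_fun_borelH => i; exact: path_at_measurable. Qed.

Lemma initial_value_measurable :
  measurable_fun setT (@initial_value R Om).
Proof. exact: path_at_measurable_borelH. Qed.

(** A function that is continuous in time and measurable
    in the path is the limit of its discretizations at the grid points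
    floor(t (n+1)) / (n+1). *)
Lemma joint_coordinate_measurable (z : Hspace Om) :
  measurable_fun setT (fun x : measurableTypeR R * borelCw Om => ip z (path_at x.2 x.1)).
Proof.
pose a (n : nat) (k : int) : R := k%:~R / n.+1%:R.
pose h (n : nat) (x : measurableTypeR R * borelCw Om) : R :=
  ip z (path_at x.2 (a n (Num.floor (x.1 * n.+1%:R)))).
apply: (measurable_fun_cvg (h := h)) => [n|[t u] _].
  move=> _ Y mY; rewrite setTI.
  have -> : h n @^-1` Y = \bigcup_k (([set t | Num.floor (t * n.+1%:R) = k] : set (measurableTypeR R)) `*`
      ([set: borelCw Om] `&` (fun u => ip z (path_at u (a n k))) @^-1` Y)).
    apply/seteqP; split=> [[t u] /= H|[t u] [k _ [/= <- []]]//].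
    by exists (Num.floor (t * n.+1%:R)).
  apply: bigcup_countType_measurable => k _; apply: measurableX; last exact: path_at_measurable.
  have -> : [set t : R | Num.floor (t * n.+1%:R) = k] = `[(a n k), (a n (k + 1))[%classic.
    apply/seteqP; split=> t; rewrite /= in_itv/= /a ler_pdivrMr// ltr_pdivlMr//.
      by move=> <-; exact: floor_itv.
    by move=> H; apply: floor_def.
  exact: measurable_itv.
have /= c := @path_at_continuous u z t.
apply: (cvg_comp (fun n => a n (Num.floor (t * n.+1%:R))) (fun t => ip z (path_at u t)) _ c).
apply/cvgrPdist_lt => e e0; near=> n.
have n0 : 0 < n.+1%:R :> R by [].
have /andP[] := floor_itv (t * n.+1%:R); rewrite intrD /a.
move: (_%:~R) => k k1 k2.
rewrite ger0_norm ?subr_ge0 ?ler_pdivrMr//.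
apply: (@le_lt_trans _ _ n.+1%:R^-1).
  by rewrite lerBlDr -[X in _ <= X + _]mul1r -mulrDl ler_pdivlMr// addrC ltW.
near: n; exact: (near_infty_natSinv_lt (PosNum e0)).
Unshelve. all: by end_near. Qed.

Lemma joint_path_measurable :
  measurable_fun setT
    ((fun x => path_at x.2 x.1) : measurableTypeR R * borelCw Om -> borelH Om).
Proof. by apply: measurable_fun_borelH => i; exact: joint_coordinate_measurable. Qed.

End path_measurability.

(** * Borel sets of locally bounded paths *)

Section locally_bounded_paths.
Variables (R : realType) (Om : smooth_domain R).
Local Notation ip := (@ipH R Om).
Local Notation norm := (ip_norm (@ipH R Om)).
Local Notation Hp := (ipH_inner_product Om).
Variables (d : nat -> Hspace Om) (dd : ip_dense ip d).

Definition coordinate_events : set_system (Cw Om) :=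
  [set A | exists (q : rat) (i : nat) (c : R),
    A = [set u | ip (d i) (path_at u (ratr q)) < c]].

(** The Borel sets of the path space are generated by open sets, and
    arbitrary unions of basic open sets may a priori leave the sigma-algebra
    of the countably many coordinates. *)
Definition coordCw : Type := g_sigma_algebraType coordinate_events.
HB.instance Definition _ := Measurable.on coordCw.

Lemma coordCw_sub (A : set (Cw Om)) :
  measurable (A : set coordCw) -> measurable (A : set (borelCw Om)).
Proof.
apply: smallest_sub; first exact: sigma_algebra_measurable.
move=> _ [q [i [c ->]]].
have := @path_at_measurable R Om (ratr q) (d i) measurableT _ (measurable_itv `]-oo, c[).
by rewrite setTI; congr measurable; apply/seteqP; split=> u /=; rewrite in_itv.
Qed.

Lemma coordinate_measurable (q : rat) (i : nat) :
  measurable_fun setT (fun u : coordCw => ip (d i) (path_at u (ratr q))).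
Proof.
apply: (measurability _ (RGenInftyO.measurableE R)) => _ [_ [c ->] <-].
rewrite setTI; apply: sub_sigma_algebra; exists q, i, c.
by apply/seteqP; split=> u /=; rewrite in_itv.
Qed.

Lemma rational_event_measurable (m : R) (P : rat -> set (Cw Om)) :
  (forall q, measurable (P q : set coordCw)) ->
  measurable ([set u : coordCw | forall q, ratr q <= m -> P q u]).
Proof.
move=> mP.
rewrite (_ : [set u | _] = ~` (\bigcup_(q in [set q : rat | ratr q <= m]) ~` P q)).
  by apply: measurableC; apply: bigcup_countType_measurable => q _; exact: measurableC.
apply/seteqP; split=> u /= H.
  by move=> [q qm]; apply; exact: H.
by move=> q qm; apply: contrapT => nP; apply: H; exists q.
Qed.

Lemma forall_measurable (P : nat -> set (Cw Om)) :
  (forall i, measurable (P i : set coordCw)) ->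
  measurable ([set u : coordCw | forall i, P i u]).
Proof.
move=> mP; rewrite (_ : [set u | _] = \bigcap_i (P i)); first exact: bigcapT_measurable.
by apply/seteqP; split=> u /= H i; [move=> _; exact: H|exact: H].
Qed.

Definition norm_bounded (m r : R) : set (Cw Om) :=
  [set u | forall t, t <= m -> norm (path_at u t) <= r].

(** The bound at all times follows from the bound at rational
    times, coordinate by coordinate, since the coordinates are continuous. *)
Lemma norm_bounded_measurable (m r : R) : 0 <= r ->
  measurable (norm_bounded m r : set coordCw).
Proof.
move=> r0.
have -> : norm_bounded m r = [set u | forall i, forall q, ratr q <= m ->
    ip (d i) (path_at u (ratr q)) <= r * norm (d i)].
  apply/seteqP; split=> u H.
    by move=> i q qm; exact: ((norm_le_coord dd _ r0).1 (H _ qm) i).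
  move=> t tm; apply/(norm_le_coord dd _ r0) => i.
  apply: (@le_at_rational _ (fun t => ip (d i) (path_at u t)) m) => //.
    exact: path_at_continuous.
  exact: H.
apply: forall_measurable => i; apply: rational_event_measurable => q.
have := coordinate_measurable q i measurableT (measurable_itv `]-oo, (r * norm (d i))]).
by rewrite setTI; congr measurable; apply/seteqP; split=> u /=; rewrite in_itv.
Qed.

Lemma close_measurable (m c : R) (i : nat) (u0 : Cw Om) :
  measurable ([set v | forall t, t <= m ->
    `|ip (d i) (path_at v t) - ip (d i) (path_at u0 t)| <= c] : set coordCw).
Proof.
rewrite (_ : [set v | _] = [set v | forall q, ratr q <= m ->
    `|ip (d i) (path_at v (ratr q)) - ip (d i) (path_at u0 (ratr q))| <= c]); last first.
  apply/seteqP; split=> u H; first by move=> q; exact: H.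
  apply: (@le_at_rational _ (fun t => `|ip (d i) (path_at u t) -
    ip (d i) (path_at u0 t)|)) => // t.
  apply: (@cvg_norm _ R^o); apply: (@cvgB _ R^o); exact: path_at_continuous.
apply: rational_event_measurable => q.
set a := ip (d i) (path_at u0 _).
have := coordinate_measurable q i measurableT (measurable_itv `[a - c, a + c]).
rewrite setTI; congr measurable; apply/seteqP; split=> u /=;
  by rewrite in_itv/= ler_distl.
Qed.

Definition locally_bounded : set (Cw Om) :=
  [set u | forall m : nat, exists r : nat, norm_bounded m%:R r%:R u].

Lemma locally_bounded_measurable : measurable (locally_bounded : set coordCw).
Proof.
apply: (@forall_measurable (fun m => [set u | exists r : nat,
  norm_bounded m%:R r%:R u])) => m.
rewrite (_ : [set u | _] = \bigcup_r norm_bounded m%:R r%:R).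
  by apply: bigcupT_measurable => r; exact: norm_bounded_measurable.
by apply/seteqP; split=> u /= [r]; exists r.
Qed.

Section neighbourhood_base.
Variables (u : Cw Om) (r : nat -> nat).
Hypothesis ur : forall m, norm_bounded m%:R (r m)%:R u.

(** A basic neighbourhood of [v0], cut down to the paths that satisfy
    prescribed norm bounds. The bounds are a finite list, so that they range
    over a countable set. *)
Definition base_nbhs (n : nat) (bounds : seq nat) (v0 : Cw Om) : set (Cw Om) :=
  [set v | (forall m, (m <= n)%N -> norm_bounded m%:R (nth 0%N bounds m)%:R v) /\
    forall i, (i <= n)%N -> forall t, t <= n%:R ->
      `|ip (d i) (path_at v t) - ip (d i) (path_at v0 t)| <= n.+1%:R^-1].

(** Under the bounds, finitely many coordinates [d i] control the
    pairing with any [z]. *)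
Lemma base_nbhs_sub (U : set (Cw Om)) : open U -> U u ->
  exists n, base_nbhs n (mkseq r n.+1) u `<=` U.
Proof.
move=> oU Uu.
pose F := filter_from [set: nat] (fun n => base_nbhs n (mkseq r n.+1) u).
have FF : Filter F.
  apply: filter_from_filter; first by exists 0%N.
  move=> n n' _ _; exists (maxn n n') => // v [v1 v2].
  have W k : (k <= maxn n n')%N -> base_nbhs k (mkseq r k.+1) u v.
    move=> kn; split=> [m mk|i ik t tk].
      have := v1 m (leq_trans mk kn).
      by rewrite !nth_mkseq ?ltnS// (leq_trans mk kn).
    apply: le_trans (v2 i (leq_trans ik kn) t _) _.
      by apply: (le_trans tk); rewrite ler_nat.
    by rewrite lef_pV2 ?posrE// ler_nat.
  by split; apply: W; rewrite leq_max leqnn ?orbT.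
(* The filter [F] of all these sets is shown to converge to [u]; only paths
   that satisfy the bounds are in its sets. *)
suff /(_ U) : F --> u.
  case; first exact: open_nbhs_nbhs.
  by move=> n _ H; exists n.
apply: (@cvg_path _ _ _ F id) => m e z e0.
pose M := (Num.truncn `|m|).+1.
have mM : m <= M%:R by apply: (le_trans (ler_norm _)); apply/ltW/truncnS_gt.
have k0 : 0 < 4 * ((r M)%:R + 1) :> R by rewrite mulr_gt0// ltr_wpDl.
have e1 : 0 < e / (4 * ((r M)%:R + 1)) by rewrite divr_gt0.
have [i iz] := dd z e1.
have e4 : 0 < e / 4 by rewrite divr_gt0.
have [N _ /(_ N (leqnn N)) NP] := near_infty_natSinv_lt (PosNum e4).
pose n := maxn M (maxn i N).
exists n => // v [v1 v2] t tm.
have tM : time_val t <= M%:R := le_trans tm mM.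
have Mn : (M <= n)%N by rewrite leq_max leqnn.
have vt : Cw_fun v t = path_at v (time_val t) by rewrite /path_at time_of_val.
have ut : Cw_fun u t = path_at u (time_val t) by rewrite /path_at time_of_val.
rewrite vt ut; set s := time_val t in tM *.
have A1 := v1 M Mn s tM; rewrite nth_mkseq ?ltnS// in A1.
have A2 := ur tM.
have A3 : `|ip (d i) (path_at v s) - ip (d i) (path_at u s)| <= e / 4.
  apply: le_trans (v2 i _ s _) _.
  - by rewrite !leq_max leqnn orbT.
  - by apply: (le_trans tM); rewrite ler_nat.
  - apply: le_trans (ltW NP); rewrite lef_pV2 ?posrE// ler_nat ltnS.
    by rewrite !leq_max leqnn !orbT.
exact: (ip_diff_lt Hp _ iz A1 A2 A3).
Qed.

End neighbourhood_base.

Lemma base_nbhs_measurable n bounds v0 :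
  measurable (base_nbhs n bounds v0 : set coordCw).
Proof.
rewrite (_ : base_nbhs n bounds v0 =
  (\bigcap_(m in [set m | (m <= n)%N]) norm_bounded m%:R (nth 0%N bounds m)%:R) `&`
  (\bigcap_(i in [set i | (i <= n)%N]) [set v | forall t, t <= n%:R ->
      `|ip (d i) (path_at v t) - ip (d i) (path_at v0 t)| <= n.+1%:R^-1]))//.
apply: measurableI; apply: bigcap_measurableType => i _.
  exact: norm_bounded_measurable.
exact: close_measurable.
Qed.

Lemma path_code (n : nat) : exists code : Cw Om -> seq (nat * seq int),
  forall u v, code u = code v -> forall i, (i <= n)%N -> forall t, t <= n%:R ->
    `|ip (d i) (path_at v t) - ip (d i) (path_at u t)| <= n.+1%:R^-1.
Proof.
have n0 : 0 < n.+1%:R^-1 :> R by rewrite invr_gt0.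
have Kc : compact (`[0, n%:R]%classic : set R) by exact: segment_compact.
have [code codeP] := compact_code Kc n0.
exists (fun u => [seq code (fun t => ip (d i) (path_at u t)) | i <- iota 0 n.+1]).
move=> u v /eq_in_map E i i_n t tn.
have := E i; rewrite mem_iota add0n ltnS => /(_ i_n) Ei.
have H s : 0 <= s <= n%:R ->
    `|ip (d i) (path_at v s) - ip (d i) (path_at u s)| <= n.+1%:R^-1.
  move=> sn; rewrite distrC.
  apply: (codeP _ _ _ _ Ei); [exact: path_at_continuous|exact: path_at_continuous|].
  by rewrite /= in_itv.
have tE : time_of t = time_of (Num.max 0 t).
  by apply: time_val_inj; rewrite /time_val/= maxA maxxx.
rewrite /path_at tE.
by apply: H; rewrite le_max lexx/= ge_max ler0n.
Qed.

(** The bounded paths of an open set are covered by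
    the sets [base_nbhs n bounds v0] contained in it. Uncountably many centres
    [v0] occur, but two centres with the same code are within 1/(n+1) on the
    coordinates up to [n], so one centre for each [n], bounds and code is
    enough. *)
Lemma open_locally_bounded_measurable (U : set (Cw Om)) : open U ->
  measurable (U `&` locally_bounded : set coordCw).
Proof.
move=> oU; pose code n := sval (cid (path_code n)).
have codeP n u v : code n u = code n v -> forall i, (i <= n)%N -> forall t, t <= n%:R ->
    `|ip (d i) (path_at v t) - ip (d i) (path_at u t)| <= n.+1%:R^-1.
  exact: (svalP (cid (path_code n))).
pose I : countType := (nat * seq nat * seq (nat * seq int))%type.
(* The centres allowed for the index [k] = (n, bounds, code); [xget] selects
   one of them. *)
pose S (k : I) := [set v0 | code k.1.1 v0 = k.2 /\
  base_nbhs k.1.1 k.1.2 v0 `<=` U].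
pose V (k : I) := base_nbhs k.1.1 k.1.2 (xget point (S k)).
rewrite (_ : U `&` locally_bounded =
    (\bigcup_(k in [set k | S k !=set0]) V k) `&` locally_bounded).
  apply: measurableI; last exact: locally_bounded_measurable.
  by apply: bigcup_countType_measurable => k _; exact: base_nbhs_measurable.
apply/seteqP; split=> u [Uu ub]; split => //; last first.
  move: Uu => [k [v0 Sv0] kv]; have [_] := xgetI point Sv0; exact.
pose r m := sval (cid (ub m)).
have rP m : norm_bounded m%:R (r m)%:R u := svalP (cid (ub m)).
have [n nU] := base_nbhs_sub rP oU Uu.
have Su : S (n, mkseq r n.+1, code n u) u by [].
exists (n, mkseq r n.+1, code n u); first by exists u.
have [/= cE _] := xgetI point Su.
split=> [m mn|i i_n t tn]; first by rewrite nth_mkseq.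
exact: codeP cE _ i_n _ tn.
Qed.

(** The sets whose bounded part lies in the
    coordinate sigma-algebra form a sigma-algebra, because the bounded paths
    are themselves such a set. *)
Lemma borelCw_locally_bounded_measurable (A : set (borelCw Om)) : measurable A ->
  measurable (A `&` locally_bounded : set coordCw).
Proof.
pose G : set_system (Cw Om) := [set A | measurable (A `&` locally_bounded : set coordCw)].
suff : <<s @open (Cw Om) >> `<=` G by apply.
apply: smallest_sub; last exact: open_locally_bounded_measurable.
have mB := locally_bounded_measurable.
split.
- by rewrite /G/= set0I.
- move=> B GB; rewrite /G/= setTD (_ : ~` B `&` _ = locally_bounded `\` (B `&` locally_bounded)).
    exact: measurableD.
  apply/seteqP; split=> u; first by move=> [nB b]; split=> // -[].
  by move=> [b nB]; split=> // Bu; apply: nB.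
- move=> F GF; rewrite /G/= setI_bigcupl; exact: bigcupT_measurable.
Qed.

End locally_bounded_paths.

(** * Leray-Hopf solutions are locally bounded *)

(** An essential bound holds at every interior point by
    continuity: a violation would persist on an interval. *)
Lemma ae_le_everywhere (R : realType) (g : R -> R) (a b c : R) : continuous g ->
  {ae @lebesgue_measure R, forall t, a <= t <= b -> g t <= c} ->
  forall t, a < t < b -> g t <= c.
Proof.
move=> gc gae t /andP[ta tb]; rewrite leNgt; apply/negP => ct.
have e0 : 0 < g t - c by rewrite subr_gt0.
have /cvgrPdist_lt /(_ _ e0) /nbhs_ballP[r /= r0 rg] := gc t.
pose s := Num.min r (Num.min (t - a) (b - t)).
have s0 : 0 < s by rewrite !lt_min r0 !subr_gt0 ta.
have sr : s <= r by rewrite ge_min lexx.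
have sa : s <= t - a by rewrite !ge_min lexx orbT.
have sb : s <= b - t by rewrite !ge_min lexx !orbT.
have : (@lebesgue_measure R).-negligible `]t, t + s[%classic.
  apply: negligibleS gae => x /=; rewrite in_itv/= => /andP[x1 x2].
  apply/not_implyP; split; first by apply/andP; split; lra.
  apply/negP; rewrite -ltNge.
  have /rg /= : ball t r x by rewrite /ball/= ltr_norml; apply/andP; split; lra.
  by rewrite ltr_norml => /andP[_]; lra.
move=> H; have H0 := @measure_negligible _ _ _ (@lebesgue_measure R) _ (measurable_itv _) H.
have := etrans (esym (lebesgue_measure_itv `]t, (t + s)[)) H0.
rewrite /= lte_fin ltrDl s0 -EFinD => -[]; lra.
Qed.

Section leray_hopf_bounded.
Variables (R : realType) (Om : smooth_domain R).
Local Notation ip := (@ipH R Om).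
Local Notation norm := (ip_norm (@ipH R Om)).
Local Notation Hp := (ipH_inner_product Om).

(** The chosen zero of H is the representative of the zero class, which
    vanishes only almost everywhere. *)
Lemma ip_zero (z : Hspace Om) : ip point z = 0.
Proof.
rewrite ipHE /L2dot /family_dot big1// => i _.
rewrite /Rintegral (ae_eq_integral (cst 0%E))//; first by rewrite integral0.
- apply/measurable_EFinP; apply: measurable_funM.
    exact: Lfun2_measurable (svalP (Hfamily point) i).
  exact: Lfun2_measurable (svalP (Hfamily z) i).
- have H := zero_class_ae Om.
  apply: (@filterS _ _ (ae_filter_ringOfSetsType (lebesgue_dom Om)) _ _ _ H).
  by move=> x /= xz _; rewrite /components ffunE /L2_fun /= xz mul0r.
Qed.

Lemma distH_zero (u : Hspace Om) :
  distH (Hval u) [ffun=> zeroL2 Om] = norm u.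
Proof.
have := distHE u point; rewrite /ip_dist (ipHC u) !ip_zero mulr0 subr0 addr0.
by move=> E; rewrite -[LHS]/(distH (Hval u) (Hval point)) E.
Qed.

(** The essential bound covers intervals away from 0
    only, because the norm is essentially bounded locally on the open half
    line; near 0, the strong continuity at the initial time gives a bound.
    Away from 0, the bound at almost every time becomes a bound at every time by
    continuity of the coordinates. *)
Lemma leray_hopf_locally_bounded (nu : R) (f : Hspace Om) :
  leray_hopf nu f `<=` locally_bounded (Om := Om).
Proof.
move=> u [[_ ub] _ _ u0 _] m.
have [d dd] := ipH_dense Om.
have /cvgrPdist_lt /(_ _ ltr01) := u0.
move=> /nbhs_ballP[r /= r0 rg].
pose a := r / 2.
have a0 : 0 < a by rewrite divr_gt0.
have am : a < m%:R + 1 + a by rewrite ltrDr ltr_wpDl.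
have [M Mae] := ub a (m%:R + 1 + a) a0 am.
have far t : a < t < m%:R + 1 + a -> norm (path_at u t) <= `|M|.
  move=> tab; apply/(norm_le_coord dd) => // i.
  apply: (@ae_le_everywhere _ (fun t => ip (d i) (path_at u t)) a (m%:R + 1 + a)) => //.
    exact: path_at_continuous.
  apply: (@filterS _ _ (ae_filter_ringOfSetsType (@lebesgue_measure R)) _ _ _ Mae).
  move=> s sM /sM; rewrite distH_zero => sM'.
  have := ip_le Hp (d i) (path_at u s); rewrite ler_norml => /andP[_ /le_trans]; apply.
  rewrite mulrC ler_wpM2r ?ip_norm_ge0//; apply: (le_trans sM'); exact: ler_norm.
pose C := norm (path_at u 0) + 1 + `|M|.
have bnd t : t <= m%:R -> norm (path_at u t) <= C.
  move=> tm.
  have N0 := ip_norm_ge0 ip (path_at u 0).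
  have M0 := normr_ge0 M.
  have [t0|t0] := leP t 0.
    have -> : path_at u t = path_at u 0.
      rewrite /path_at (_ : time_of t = time_of 0)//; apply: time_val_inj.
      by rewrite /time_val/= maxxx; apply/max_idPl.
    by rewrite /C; lra.
  have [ta|ta] := leP t a.
    have tr : t < r by apply: (le_lt_trans ta); rewrite /a; move: r0; lra.
    have := rg t; rewrite /ball/= sub0r normrN (gtr0_norm t0) => /(_ tr t0).
    rewrite sub0r normrN distHE ger0_norm ?ip_dist_ge0// => H.
    have := ip_norm_le_dist Hp (path_at u t) (path_at u 0).
    by move: H; rewrite -/(path_at u t) -/(path_at u 0) /C; lra.
  have := far t; rewrite ta (_ : t < _)//=; last first.
    by apply: (le_lt_trans tm); rewrite -addrA ltrDl addr_gt0.
  by move=> /(_ isT); rewrite /C; lra.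
exists (Num.truncn C).+1 => t tm; apply: (le_trans (bnd t tm)).
exact/ltW/truncnS_gt.
Qed.

End leray_hopf_bounded.

(** * Compact sets of paths and their initial values *)

Section pointwise_topology.
Variables (R : realType) (I : choiceType).

Lemma cvg_ptws (T : Type) (F : set_system T) (h : T -> {ptws I -> R})
    (l : {ptws I -> R}) : Filter F ->
  (forall i, h t i @[t --> F] --> l i) -> h @ F --> l.
Proof.
move=> FF hl; apply/cvg_sup => i A [_ [[B Bop <-] Bfs] sBA].
have /hl H0 : nbhs (l i) B by apply: open_nbhs_nbhs.
by apply: (@filterS _ F FF _ _ _ H0) => v; exact: sBA.
Qed.

Lemma ptws_proj_continuous (i : I) : continuous (fun f : {ptws I -> R} => f i).
Proof. exact: (@proj_continuous I (fun=> R) i). Qed.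

Lemma nbhs_ptws (f : {ptws I -> R}) (s : seq I) (e : R) : 0 < e ->
  nbhs f [set g | forall i, i \in s -> `|g i - f i| < e].
Proof.
move=> e0; have FF := nbhs_filter f; elim: s => [|i s IH].
  by apply: (@filterS _ (nbhs f) FF setT) => //; exact: filterT.
have H := @ptws_proj_continuous i f _ (nbhsx_ballx (f i) e e0).
apply: (@filterS2 _ (nbhs f) FF _ _ _ _ H IH) => g H1 H2 j.
rewrite inE => /predU1P[->|]; last exact: H2.
by rewrite distrC.
Qed.

Lemma ptws_hausdorff : hausdorff_space {ptws I -> R}.
Proof. apply: (@hausdorff_product I (fun=> R)) => i; exact: Rhausdorff. Qed.

End pointwise_topology.

Section compact_images.
Variables (R : realType) (Om : smooth_domain R).
Local Notation ip := (@ipH R Om).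
Local Notation norm := (ip_norm (@ipH R Om)).
Local Notation Hp := (ipH_inner_product Om).

(** Weakly open sets are strongly open. *)
Lemma weak_open_borelH (U : set (Hw Om)) : open U -> measurable (U : set (borelH Om)).
Proof.
move=> oU; apply: sub_sigma_algebra => u Uu.
pose F := filter_from [set r : R | 0 < r]
  (fun r => [set v : Hspace Om | distH (Hval v) (Hval u) < r]).
have FF : Filter F.
  apply: filter_from_filter; first by exists 1 => /=.
  move=> r s /= r0 s0; exists (Num.min r s); first by rewrite /= lt_min r0.
  by move=> v /=; rewrite lt_min => /andP[].
have Fu : F --> (u : Hw Om).
  apply: (@cvg_weak _ _ _ F id) => z; apply/cvgrPdist_lt => e e0.
  have k0 : 0 < norm z + 1 by rewrite ltr_wpDl// ip_norm_ge0.
  exists (e / (norm z + 1)); first by rewrite /= divr_gt0.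
  move=> v; rewrite /= distHE ltr_pdivlMr// => H.
  rewrite distrC !(ipHC z); apply: (le_lt_trans (ip_dist_le Hp v u z)).
  apply: le_lt_trans H; rewrite ler_wpM2l ?ip_dist_ge0// lerDl//.
have [r r0 rU] := Fu _ (open_nbhs_nbhs (conj oU Uu)).
by exists r.
Qed.

Variables (d : nat -> Hspace Om) (dd : ip_dense ip d).

(** All times are kept, so that a limit of coordinates determines a
    path directly and Tychonoff's theorem applies to the whole product. *)
Definition path_coords (u : Cw Om) : {ptws (time R * nat) -> R} :=
  fun ti => ip (d ti.2) (Cw_fun u ti.1).

Lemma path_coords_continuous : continuous path_coords.
Proof.
move=> u; apply: (@cvg_ptws _ _ _ (nbhs u) _ _ (nbhs_filter u)) => ti.
exact: evaluation_continuous.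
Qed.

(** Bounds and moduli are indexed by countable sets, so that they can be chosen
    simultaneously up to a small measure. *)
Definition equicontinuous_paths (r : nat -> nat) (del : nat * nat * nat -> nat) :
    set (Cw Om) :=
  [set u | (forall m, norm_bounded m%:R (r m)%:R u) /\
    forall k m j t s, time_val t <= m%:R -> time_val s <= m%:R ->
      `|time_val t - time_val s| < (del (k, m, j)).+1%:R^-1 ->
      `|ip (d k) (Cw_fun u t) - ip (d k) (Cw_fun u s)| <= j.+1%:R^-1].

Lemma dense_eq (u v : Hspace Om) : (forall i, ip (d i) u = ip (d i) v) ->
  forall z, ip z u = ip z v.
Proof.
move=> E z; have : ip_dist ip u v <= 0.
  by apply/(dist_le_coord dd) => // i; rewrite mul0r E subrr.
have := ip_dist_le Hp u v z; rewrite !(ipHC _ z) => H D.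
apply/eqP; rewrite -subr_eq0 -normr_le0; apply: (le_trans H).
by rewrite mulr_le0_ge0 ?ip_norm_ge0.
Qed.

Lemma truncn_bound (x : R) : x <= (Num.truncn `|x|).+1%:R.
Proof. by apply: (le_trans (ler_norm _)); apply/ltW/truncnS_gt. Qed.

(** The limits of coordinates of equicontinuous paths are
    coordinates of a path with the same moduli: a weak limit provides each
    [h t], and the moduli pass to the limit and make the path weakly
    continuous. *)
Lemma path_of_coords (r : nat -> nat) (del : nat * nat * nat -> nat)
    (x : {ptws (time R * nat) -> R}) :
  (forall (s : seq (time R * nat)) e, 0 < e -> exists2 u,
     equicontinuous_paths r del u &
     forall c, c \in s -> `|path_coords u c - x c| < e) ->
  exists2 u, equicontinuous_paths r del u & path_coords u = x.
Proof.
move=> ex.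
(* The value at time [t]: a weak limit, whose norm bounds are recovered for all
   [m] from the coordinates. *)
have hex (t : time R) : exists h : Hspace Om, (forall i, ip h (d i) = x (t, i)) /\
    forall m, time_val t <= m%:R -> norm h <= (r m)%:R.
  have [h hM hx] : exists2 h, norm h <= (r (Num.truncn `|time_val t|).+1)%:R &
      forall i, ip h (d i) = x (t, i).
    apply: (weak_limit Hp (@ipH_complete R Om)) => n.
    have n0 : 0 < n.+1%:R^-1 :> R by rewrite invr_gt0.
    have [u [ub _] ux] := ex [seq (t, i) | i <- iota 0 n.+1] _ n0.
    exists (Cw_fun u t).
      by have := ub _ _ (truncn_bound (time_val t)); rewrite /path_at time_of_val.
    move=> i i_n; rewrite ipHC; apply: ltW; apply: (ux (t, i)).
    by apply: map_f; rewrite mem_iota add0n ltnS.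
  exists h; split => // m tm.
  apply/(norm_le_coord dd) => // i.
  rewrite ipHC hx; apply/ler_addgt0Pr => e e0.
  have [u [ub _] ux] := ex [:: (t, i)] _ e0.
  have := ux (t, i); rewrite inE eqxx => /(_ isT).
  rewrite ltr_norml /path_coords/= => /andP[H _].
  have nu := ub _ _ tm; rewrite /path_at time_of_val in nu.
  have := (norm_le_coord dd (Cw_fun u t) (ler0n R (r m))).1 nu i.
  move: H; lra.
pose h t := sval (cid (hex t)).
have hx t i : ip (d i) (h t) = x (t, i).
  by rewrite ipHC; have [H _] := svalP (cid (hex t)); exact: H.
have hb t m : time_val t <= m%:R -> norm (h t) <= (r m)%:R.
  by have [_ H] := svalP (cid (hex t)); exact: H.
have xe k m j t s : time_val t <= m%:R -> time_val s <= m%:R ->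
      `|time_val t - time_val s| < (del (k, m, j)).+1%:R^-1 ->
      `|ip (d k) (h t) - ip (d k) (h s)| <= j.+1%:R^-1.
  move=> tm sm ts; rewrite !hx; apply/ler_addgt0Pr => e e0.
  have e2 : 0 < e / 2 by rewrite divr_gt0.
  have [u [_ ue] ux] := ex [:: (t, k); (s, k)] _ e2.
  have := ux (t, k); rewrite !inE eqxx => /(_ isT).
  have := ux (s, k); rewrite !inE eqxx orbT => /(_ isT).
  have := ue k m j t s tm sm ts; rewrite /path_coords/=.
  move: (j.+1%:R^-1) => y.
  rewrite !ler_norml !ltr_norml => /andP[? ?] /andP[? ?] /andP[? ?].
  by apply/andP; split; lra.
(* Equicontinuity is known for the coordinates [d k] only; density and the
   bound [r m] extend continuity to all pairings. *)
have hc z : continuous (fun t => ip z (h t)).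
  move=> t A /nbhs_ballP[e /= e0 eA].
  pose m := (Num.truncn `|time_val t + 1|).+1.
  have tm : time_val t + 1 <= m%:R := truncn_bound _.
  have k0 : 0 < 4 * ((r m)%:R + 1) :> R by rewrite mulr_gt0// ltr_wpDl.
  have e1 : 0 < e / (4 * ((r m)%:R + 1)) by rewrite divr_gt0.
  have [k kz] := dd z e1.
  have e4 : 0 < e / 4 by rewrite divr_gt0.
  have [j _ /(_ j (leqnn j)) jP] := near_infty_natSinv_lt (PosNum e4).
  pose del0 : R := Num.min 1 (del (k, m, j)).+1%:R^-1.
  have del00 : 0 < del0 by rewrite lt_min ltr01/= invr_gt0.
  have nt : nbhs t [set s : time R | `|time_val t - time_val s| < del0].
    have := @initial_continuous _ _ (@set_val _ [set t : R | 0 <= t]) t (ball (time_val t) del0).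
    by apply; exact: nbhsx_ballx.
  apply: (@filterS _ (nbhs t) (nbhs_filter t) _ _ _ nt) => s /= st.
  apply: eA; rewrite /ball/=.
  have st1 : `|time_val t - time_val s| < 1 by apply: lt_le_trans st _; rewrite ge_min lexx.
  have sm : time_val s <= m%:R.
    by move: st1 tm; rewrite ltr_norml => /andP[]; lra.
  have tm' : time_val t <= m%:R by apply: le_trans tm; rewrite lerDl.
  have A3 : `|ip (d k) (h t) - ip (d k) (h s)| <= e / 4.
    apply: le_trans (ltW jP); apply: (xe k m j) => //.
    by apply: lt_le_trans st _; rewrite ge_min lexx orbT.
  exact: (ip_diff_lt Hp _ kz (hb _ _ tm') (hb _ _ sm) A3).
have [u uh] := path_of_weakly_continuous hc.
exists u; last by apply/funext => -[t i]; rewrite /path_coords uh hx.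
split=> [m t tm|k m j t s tm sm ts]; last by rewrite uh; exact: (xe k m).
by rewrite /path_at uh; apply: hb; rewrite /time_val/= ge_max ler0n tm.
Qed.

(** Ascoli's theorem: the coordinates lie in a product of
    intervals, compact by Tychonoff, and form a closed subset by
    [path_of_coords]. *)
Lemma path_coords_image_compact r del (F : set {ptws (time R * nat) -> R}) :
  closed F -> compact [set x | F x /\
    exists2 u, equicontinuous_paths r del u & path_coords u = x].
Proof.
move=> Fcl.
pose b (ti : time R * nat) : R :=
  (r (Num.truncn `|time_val ti.1|).+1)%:R * norm (d ti.2).
have bc : compact [set x : {ptws (time R * nat) -> R} | forall ti, `[- b ti, b ti]%classic (x ti)].
  exact: (@tychonoff (time R * nat)%type (fun=> R) (fun ti => `[- b ti, b ti]%classic)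
    (fun ti => @segment_compact R _ _)).
apply: (subclosed_compact _ bc); last first.
  move=> _ [_ [u [ub _] <-]] [t i] /=.
  rewrite in_itv/= -ler_norml /path_coords/= /b/=.
  apply: (le_trans (ip_le Hp _ _)); rewrite mulrC ler_wpM2r ?ip_norm_ge0//.
  by have := ub _ _ (truncn_bound (time_val t)); rewrite /path_at time_of_val.
move=> x xcl; split.
  by apply: Fcl => B /xcl[y [[Fy _] By]]; exists y.
apply: path_of_coords => s e e0.
have [_ [[_ [u uC <-]] ux]] := xcl _ (nbhs_ptws x s e0).
by exists u.
Qed.

(** The coordinates at time 0 of the compact set
    [path_coords_image_compact] form a compact, hence closed, set of
    sequences, and the image is its preimage under the weakly continuous map
    of H to its coordinates. *)
Lemma initial_value_image_measurable r del (F : set {ptws (time R * nat) -> R}) :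
  closed F ->
  measurable ([set h | exists u : Cw Om, [/\ equicontinuous_paths r del u,
     F (path_coords u) & initial_value u = h]] : set (borelH Om)).
Proof.
move=> Fcl.
set P := [set h | _].
pose ev0 (x : {ptws (time R * nat) -> R}) : {ptws nat -> R} :=
  fun i => x (time_of 0, i).
have ev0c : continuous ev0.
  move=> x; apply: (@cvg_ptws _ _ _ (nbhs x) _ _ (nbhs_filter x)) => i.
  exact: (@ptws_proj_continuous R (time R * nat)%type (time_of 0, i) x).
pose coordsH (h : Hw Om) : {ptws nat -> R} := fun i => ip (d i) h.
have cHc : continuous coordsH.
  move=> h; apply: (@cvg_ptws _ _ _ (nbhs h) _ _ (nbhs_filter h)) => i.
  exact: (@pairing_continuous _ _ (d i) h).
pose A := ev0 @` [set x | F x /\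
    exists2 u, equicontinuous_paths r del u & path_coords u = x].
have Acl : closed A.
  apply: compact_closed; first exact: ptws_hausdorff.
  apply: continuous_compact; last exact: path_coords_image_compact.
  exact: continuous_subspaceT.
have -> : P = coordsH @^-1` A.
  apply/seteqP; split=> [h [u [uC Fu <-]]|h [x [Fx [u uC ux]] E]].
    by exists (path_coords u) => //; split=> //; exists u.
  rewrite -ux in Fx E.
  have E' i : ip (d i) (Cw_fun u (time_of 0)) = ip (d i) h by exact: (congr1 (fun g => g i) E).
  (* Equal coordinates give [h] and [u] at time 0 the same pairings; the path is
     changed at this single time so as to start at [h] itself. *)
  pose g (t : time R) := if t == time_of 0 then h else Cw_fun u t.
  have gE t z : ip z (g t) = ip z (Cw_fun u t).
    by rewrite /g; case: eqP => // ->; rewrite (dense_eq E').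
  have [|v vg] := @path_of_weakly_continuous R Om g.
    by move=> z; rewrite (funext (fun t => gE t z)); exact: path_continuous.
  have vu : path_coords v = path_coords u.
    by apply/funext => ti; rewrite /path_coords vg gE.
  exists v; split; last by rewrite /initial_value vg /g eqxx.
    case: uC => ub ue; split=> [m t tm|k m j t s tm sm ts].
      apply/(norm_le_coord dd) => // i.
      rewrite /path_at vg gE; apply: (norm_le_coord dd _ _).1 => //.
      exact: ub.
    by rewrite vg !gE; exact: (ue k m).
  by rewrite vu.
rewrite -[X in measurable X]setCK; apply: measurableC.
apply: weak_open_borelH; rewrite preimage_setC; apply: open_comp.
  by move=> x _; exact: cHc.
exact: closed_openC.
Qed.

End compact_images.

(** * Inner approximation of measurable sets *)

Section probability_limits.
Context d (T : measurableType d) (R : realType) (rho : probability T R).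

Lemma probability_small_tail (F : nat -> set T) (e : R) : 0 < e ->
  (forall n, measurable (F n)) -> nonincreasing_seq F ->
  rho (\bigcap_n F n) = 0%E -> exists n, (rho (F n) < e%:E)%E.
Proof.
move=> e0 mF Fd F0.
have c : rho (F n) @[n --> \oo] --> rho (\bigcap_n F n).
  apply: nonincreasing_cvg_mu => //; last exact: bigcapT_measurable.
  by apply: le_lt_trans (probability_le1 rho (mF 0%N)) _; exact: ltry.
rewrite F0 in c.
move/fine_cvgP : c => [_ /cvgrPdist_lt /(_ _ e0)] [N _ /(_ N (leqnn N))].
rewrite /= sub0r normrN ger0_norm ?fine_ge0// => H.
by exists N; rewrite -[X in (X < _)%E]fineK ?lte_fin// fin_num_measure.
Qed.

Lemma probability_bigcup_le (F : nat -> set T) (e : R) : 0 <= e ->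
  (forall n, measurable (F n)) ->
  (forall n, (rho (F n) <= (e / (2 ^ n.+1)%:R)%:E)%E) ->
  (rho (\bigcup_n F n) <= e%:E)%E.
Proof.
move=> e0 mF Fe.
apply: (@le_trans _ _ (\sum_(n <oo) rho (F n))%E).
  by apply: measure_sigma_subadditive => //; exact: bigcupT_measurable.
apply: le_trans (epsilon_trick0 xpredT e0).
by apply: lee_nneseries => n *.
Qed.

(** A countable choice of indices, with the loss e / 2^(n+1) for the
    index numbered [n]. *)
Lemma choose_moduli (I : countType) (A : I -> nat -> set T) (e : R) : 0 < e ->
  (forall i n, measurable (A i n)) ->
  (forall i n m, (n <= m)%N -> A i n `<=` A i m) ->
  (forall i, rho (~` \bigcup_n A i n) = 0%E) ->
  exists c : I -> nat, (rho (~` \bigcap_i A i (c i)) <= e%:E)%E.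
Proof.
move=> e0 mA Ad A0.
have ex i : exists n, (rho (~` A i n) < (e / (2 ^ (choice.pickle i).+1)%:R)%:E)%E.
  apply: probability_small_tail.
  - by rewrite divr_gt0// ltr0n expn_gt0.
  - by move=> n; exact: measurableC.
  - by move=> n m nm; apply/subsetPset; apply: subsetC; exact: Ad.
  - by rewrite -setC_bigcup.
pose c i := sval (cid (ex i)).
have cP i : (rho (~` A i (c i)) < (e / (2 ^ (choice.pickle i).+1)%:R)%:E)%E.
  exact: svalP (cid (ex i)).
exists c; rewrite setC_bigcap.
pose F n := if (choice.pickle_inv n : option I) is Some i then ~` A i (c i) else set0.
have mF n : measurable (F n).
  by rewrite /F; case: choice.pickle_inv => // i; exact: measurableC.
rewrite (_ : \bigcup_i _ = \bigcup_n F n).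
  apply: probability_bigcup_le => // [|n]; first exact: ltW.
  rewrite /F; case E : (choice.pickle_inv n : option I) => [i|]; last first.
    by rewrite measure0 lee_fin divr_ge0// ltW.
  have := @choice.pickle_invK I n; rewrite E /= => <-; exact: ltW.
apply/seteqP; split=> x; last first.
  by move=> [n _]; rewrite /F; case: choice.pickle_inv => // i; exists i.
by move=> [i _ Ai]; exists (choice.pickle i) => //; rewrite /F choice.pickleK_inv.
Qed.

End probability_limits.

Section inner_regularity.
Context d (T : measurableType d) (R : realType) (rho : probability T R).
Variable K : set_system T.
Hypotheses (mK : forall A, K A -> measurable A) (K0 : K set0) (KT : K setT)
  (KU : forall A B, K A -> K B -> K (A `|` B))
  (KI : forall F : nat -> set T, (forall n, K (F n)) -> K (\bigcap_n F n)).

(** Inner regularity with respect to the class [K], assumed closed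
    under finite unions and countable intersections. *)
Definition inner_approximable (A : set T) : Prop := measurable A /\
  forall e : R, 0 < e -> exists C, [/\ K C, C `<=` A & (rho (A `\` C) <= e%:E)%E].

Lemma inner_approximable_self A : K A -> inner_approximable A.
Proof.
move=> KA; split=> [|e e0]; first exact: mK.
by exists A; split=> //; rewrite setDv measure0 lee_fin ltW.
Qed.

Lemma inner_approximable_bigcup (F : nat -> set T) : (forall n, inner_approximable (F n)) ->
  inner_approximable (\bigcup_n F n).
Proof.
move=> iF; have mF n : measurable (F n) by have [] := iF n.
have mU : measurable (\bigcup_n F n) by exact: bigcupT_measurable.
split=> // e e0.
have e2 : 0 < e / 2 by rewrite divr_gt0.
have ex n : exists C, [/\ K C, C `<=` F n &
    (rho (F n `\` C) <= (e / 2 / (2 ^ n.+1)%:R)%:E)%E].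
  by have [_] := iF n; apply; rewrite divr_gt0// ltr0n expn_gt0.
pose C n := sval (cid (ex n)).
have [KC CF Ce] : [/\ forall n, K (C n), forall n, C n `<=` F n &
    forall n, (rho (F n `\` C n) <= (e / 2 / (2 ^ n.+1)%:R)%:E)%E].
  by split=> n; have [] := svalP (cid (ex n)).
pose G N := \bigcup_n F n `\` \big[setU/set0]_(n < N) F n.
have mG N : measurable (G N) by apply: measurableD => //; exact: bigsetU_measurable.
(* [K] is closed under finite unions only: the union is first truncated. *)
have [||N GN] := @probability_small_tail _ _ _ rho G _ e2 mG.
- move=> n m nm; apply/subsetPset => x [Fx nx]; split=> //; apply: contra_not nx.
  exact: subset_bigsetU.
- rewrite (_ : \bigcap_n G n = set0) ?measure0// -subset0 => x Gx.
  have [[n _ Fx] _] := Gx 0%N I.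
  by have [_] := Gx n.+1 I; apply; rewrite -bigcup_mkord; exists n => /=.
exists (\big[setU/set0]_(n < N) C n); split.
- by elim/big_ind: _ => // n _; exact: KC.
- rewrite -bigcup_mkord => x [n _ Cx]; exists n => //; exact: CF.
have mCF n : measurable (F n `\` C n) by apply: measurableD => //; exact: mK.
apply: (@le_trans _ _ (rho (G N `|` \bigcup_n (F n `\` C n)))).
  apply: le_measure; rewrite ?inE.
  - by apply: measurableD => //; apply: bigsetU_measurable => n _; exact: mK.
  - by apply: measurableU => //; exact: bigcupT_measurable.
  - rewrite -bigcup_mkord => x [[n _ Fx] nC].
    have [[k kN Fk]|nF] := pselect ((\bigcup_(k in `I_N) F k) x).
      by right; exists k => //; split=> // Ck; apply: nC; exists k.
    by left; split; [exists n|rewrite -bigcup_mkord].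
apply: le_trans; first by apply: measureU2 => //; exact: bigcupT_measurable.
rewrite (splitr e) EFinD leeD//; first exact: ltW.
by apply: probability_bigcup_le => //; exact: ltW.
Qed.

Lemma inner_approximable_bigcap (F : nat -> set T) : (forall n, inner_approximable (F n)) ->
  inner_approximable (\bigcap_n F n).
Proof.
move=> iF; have mF n : measurable (F n) by have [] := iF n.
split=> [|e e0]; first exact: bigcapT_measurable.
have ex n : exists C, [/\ K C, C `<=` F n &
    (rho (F n `\` C) <= (e / (2 ^ n.+1)%:R)%:E)%E].
  by have [_] := iF n; apply; rewrite divr_gt0// ltr0n expn_gt0.
pose C n := sval (cid (ex n)).
have [KC CF Ce] : [/\ forall n, K (C n), forall n, C n `<=` F n &
    forall n, (rho (F n `\` C n) <= (e / (2 ^ n.+1)%:R)%:E)%E].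
  by split=> n; have [] := svalP (cid (ex n)).
have mCF n : measurable (F n `\` C n) by apply: measurableD => //; exact: mK.
exists (\bigcap_n C n); split; first exact: KI.
  by move=> x Cx n _; apply: CF; exact: Cx.
apply: (@le_trans _ _ (rho (\bigcup_n (F n `\` C n)))).
  apply: le_measure; rewrite ?inE.
  - apply: measurableD; first exact: bigcapT_measurable.
    by apply: bigcapT_measurable => n; exact: mK.
  - exact: bigcupT_measurable.
  - move=> x [Fx /existsNP[n /not_implyP[_ nC]]].
    by exists n => //; split=> //; exact: Fx.
by apply: probability_bigcup_le => //; exact: ltW.
Qed.

(** The sets that are approximable together with their complements form
    a sigma-algebra. *)
Lemma inner_regular (G : set_system T) :
  (forall A, G A -> inner_approximable A /\ inner_approximable (~` A)) ->
  forall A, <<s G >> A -> inner_approximable A.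
Proof.
move=> GK; pose S : set_system T := [set A | inner_approximable A /\ inner_approximable (~` A)].
suff : <<s G >> `<=` S by move=> H A /H[].
apply: smallest_sub; last exact: GK.
split.
- by split; [|rewrite setC0]; exact: inner_approximable_self.
- by move=> A [A1 A2]; rewrite setTD; split=> //; rewrite setCK.
- move=> F SF; split; first by apply: inner_approximable_bigcup => n; have [] := SF n.
  by rewrite setC_bigcup; apply: inner_approximable_bigcap => n; have [] := SF n.
Qed.

End inner_regularity.

(** * The maximal and the pointwise ergodic theorems *)

Section bounded_means.
Context d (T : measurableType d) (R : realType) (rho : probability T R).

Definition bounded_measurable (g : T -> R) : Prop :=
  measurable_fun setT g /\ exists C, forall x, `|g x| <= C.

Definition mean (g : T -> R) : R := \int[rho]_x g x.

Lemma bounded_integrable g : bounded_measurable g ->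
  rho.-integrable setT (EFin \o g).
Proof.
move=> [mg [C gC]]; apply: measurable_bounded_integrable => //.
  by apply: (le_lt_trans (probability_le1 rho measurableT)); exact: ltry.
exists C; split; first exact: num_real.
by move=> M CM x _; apply: (le_trans (gC x)); exact: ltW.
Qed.

Lemma bounded_measurableD f g : bounded_measurable f -> bounded_measurable g ->
  bounded_measurable (fun x => f x + g x).
Proof.
move=> [mf [C fC]] [mg [D gD]]; split; first exact: measurable_funD.
by exists (C + D) => x; rewrite (le_trans (ler_normD _ _))// lerD.
Qed.

Lemma bounded_measurableM f g : bounded_measurable f -> bounded_measurable g ->
  bounded_measurable (fun x => f x * g x).
Proof.
move=> [mf [C fC]] [mg [D gD]]; split; first exact: measurable_funM.
by exists (C * D) => x; rewrite normrM ler_pM.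
Qed.

Lemma bounded_measurable_cst c : bounded_measurable (cst c).
Proof. by split; [exact: measurable_cst|exists `|c|]. Qed.

Lemma bounded_measurable_indic A : measurable A -> bounded_measurable \1_A.
Proof.
move=> mA; split; first exact: measurable_indic.
by exists 1 => x; rewrite indicE; case: (x \in A); rewrite ?normr1 ?normr0.
Qed.

Lemma mean_indic A : measurable A -> mean \1_A = fine (rho A).
Proof. by move=> mA; rewrite /mean /Rintegral integral_indic// setIT. Qed.

Lemma meanD f g : bounded_measurable f -> bounded_measurable g ->
  mean (fun x => f x + g x) = mean f + mean g.
Proof. by move=> bf bg; apply: RintegralD => //; exact: bounded_integrable. Qed.

Lemma meanZ c f : bounded_measurable f -> mean (fun x => c * f x) = c * mean f.
Proof. by move=> bf; apply: RintegralZl => //; exact: bounded_integrable. Qed.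

Lemma mean_le f g : bounded_measurable f -> bounded_measurable g ->
  (forall x, f x <= g x) -> mean f <= mean g.
Proof. by move=> bf bg fg; apply: le_Rintegral => //; exact: bounded_integrable. Qed.

Variables (s : T -> T) (ms : measurable_fun setT s).
Hypothesis sP : forall A, measurable A -> rho (s @^-1` A) = rho A.

Lemma bounded_measurable_comp g : bounded_measurable g ->
  bounded_measurable (g \o s).
Proof. by move=> [mg [C gC]]; split; [exact: measurableT_comp|exists C => x; exact: gC]. Qed.

Lemma mean_comp g : bounded_measurable g -> mean (g \o s) = mean g.
Proof.
move=> bg; have [mg _] := bg.
have i1 := bounded_integrable bg.
have i2 := bounded_integrable (bounded_measurable_comp bg).
rewrite /mean /Rintegral; congr fine.
have := @integral_pushforward _ _ _ _ _ s ms rho setT (EFin \o g).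
rewrite preimage_setT => H.
rewrite -[LHS]H//; last exact/measurable_EFinP.
by apply: eq_measure_integral => A mA _; exact: sP.
Qed.

(** The maximum of 0 and of the Birkhoff sums of lengths at most [n],
    given by the recursion M' = max (0, f + M o s) on which the proof of the
    maximal inequality turns. *)
Fixpoint maximal_sum (f : T -> R) (n : nat) (x : T) : R :=
  if n is n'.+1 then Num.max 0 (f x + maximal_sum f n' (s x)) else 0.

Definition birkhoff_sum (f : T -> R) (n : nat) (x : T) : R :=
  \sum_(k < n) f (iter k s x).

Lemma birkhoff_sumS f n x :
  birkhoff_sum f n.+1 x = f x + birkhoff_sum f n (s x).
Proof.
rewrite /birkhoff_sum big_ord_recl/=; congr (_ + _).
by apply: eq_bigr => k _; rewrite -iterSr.
Qed.

Lemma maximal_sum_ge0 f n x : 0 <= maximal_sum f n x.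
Proof. by case: n => [|n] //=; rewrite le_max lexx. Qed.

Lemma maximal_sum_nd f n x : maximal_sum f n x <= maximal_sum f n.+1 x.
Proof.
elim: n x => [|n IH] x; first exact: maximal_sum_ge0.
rewrite [leLHS]/= [leRHS]/= ge_max le_max lexx/= le_max; apply/orP; right.
by rewrite lerD2l; exact: IH.
Qed.

Lemma birkhoff_le_maximal f n x : birkhoff_sum f n x <= maximal_sum f n x.
Proof.
elim: n x => [|n IH] x; first by rewrite /birkhoff_sum big_ord0.
by rewrite birkhoff_sumS /= le_max lerD2l IH orbT.
Qed.

Lemma bounded_maximal_sum f n : bounded_measurable f ->
  bounded_measurable (maximal_sum f n).
Proof.
move=> bf; elim: n => [|n IH]; first exact: bounded_measurable_cst.
have [mg [C gC]] := bounded_measurableD bf (bounded_measurable_comp IH).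
split; first exact: (measurable_maxr (@measurable_cst _ _ T R setT 0) mg).
exists C => x; rewrite /= ger0_norm ?le_max ?lexx//.
rewrite ge_max (le_trans (normr_ge0 _) (gC x))/=.
exact: le_trans (ler_norm _) (gC x).
Qed.

(** Garsia's argument. With M the maximal sum, f >= M - M o s where
    M > 0, and M - M o s <= 0 where M = 0. Integrating over the invariant set
    [A], the right-hand side vanishes by invariance of the measure, up to the
    part [B n] of [A] where the maximal sum of length [n] is still zero;
    the hypothesis makes that part shrink to the empty set. *)
Lemma maximal_ergodic f A : bounded_measurable f -> measurable A ->
  s @^-1` A = A -> (forall x, A x -> exists n, 0 < birkhoff_sum f n x) ->
  0 <= mean (fun x => f x * \1_A x).
Proof.
move=> bf mA sA Apos; have [mf [C fC]] := bf.
have C0 : 0 <= C by apply: (le_trans (normr_ge0 _) (fC point)).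
pose B n := A `&` [set x | maximal_sum f n x <= 0].
have mB n : measurable (B n).
  have [mM _] := bounded_maximal_sum n bf.
  have := mM measurableT _ (measurable_itv `]-oo, 0]).
  rewrite setTI => mM0; apply: measurableI; first exact: mA.
  move: mM0; congr measurable; apply/seteqP; split=> x /=; rewrite in_itv.
have key n : 0 <= mean (fun x => f x * \1_A x) + C * fine (rho (B n.+1)).
  have bM := bounded_maximal_sum n.+1 bf.
  have bA := bounded_measurable_indic mA.
  have bB := bounded_measurable_indic (mB n.+1).
  pose g x := maximal_sum f n.+1 x * \1_A x.
  have bg : bounded_measurable g by exact: bounded_measurableM.
  have bgs := bounded_measurable_comp bg.
  have bfA := bounded_measurableM bf bA.
  have bCB := bounded_measurableM (bounded_measurable_cst C) bB.
  have bN := bounded_measurableM (bounded_measurable_cst (-1)) bgs.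
  (* Invariance of [rho]: the integrals of M and of M o s over [A] cancel. *)
  have E0 : mean (fun x => g x + (-1) * (g \o s) x) = 0.
    by rewrite meanD// meanZ// mean_comp// mulN1r subrr.
  rewrite -mean_indic// -meanZ// -meanD// -E0.
  apply: mean_le; [exact: bounded_measurableD|exact: bounded_measurableD|].
  move=> x; rewrite /g /= mulN1r.
  have sAx : \1_A (s x) = \1_A x :> R.
    by rewrite !indicE; congr (_ %:R); congr nat_of_bool; apply/idP/idP => /set_mem H;
      apply/mem_set; [rewrite -sA|rewrite -sA in H].
  rewrite sAx.
  have [Ax|nAx] := pselect (A x); last first.
    rewrite !indicE (memNset nAx) (@memNset _ (B n.+1)) ?mulr0 ?subr0 ?addr0//.
    by move=> [].
  have AE : \1_A x = 1 :> R by rewrite indicE mem_set.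
  rewrite AE !mulr1.
  have Ms0 := maximal_sum_ge0 f n.+1 (s x).
  have [M0|M0] := leP (maximal_sum f n.+1 x) 0.
    rewrite indicE (@mem_set _ (B n.+1))// mulr1.
    have := fC x; rewrite ler_norml => /andP[H _].
    move: M0 Ms0; rewrite -/(maximal_sum f n.+1 x) -/(maximal_sum f n.+1 (s x)).
    move: (maximal_sum f n.+1 x) (maximal_sum f n.+1 (s x)) => a b; lra.
  rewrite indicE (@memNset _ (B n.+1)); last first.
    by move=> [_ /=]; apply/negP; rewrite -ltNge.
  rewrite mulr0 addr0.
  have H1 := maximal_sum_nd f n (s x).
  have H2 : maximal_sum f n.+1 x = f x + maximal_sum f n (s x).
    move: M0; rewrite /= lt_max ltxx/= => M0; apply/max_idPr; exact: ltW.
  rewrite -/(maximal_sum f n.+1 x) -/(maximal_sum f n.+1 (s x)) H2.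
  move: H1; move: (maximal_sum f n.+1 (s x)) => a; lra.
rewrite leNgt; apply/negP => m0.
set m := mean (fun x => f x * \1_A x) in key m0.
have e0 : 0 < - m / (C + 1) by rewrite divr_gt0 ?oppr_gt0// ltr_wpDl.
have Bd : nonincreasing_seq B.
  move=> n k nk; apply/subsetPset => x [Ax Mx]; split=> //=.
  apply: le_trans Mx; elim: k nk => [|k IH]; first by rewrite leqn0 => /eqP ->.
  rewrite leq_eqVlt => /predU1P[->//|]; rewrite ltnS => /IH /le_trans; apply.
  exact: maximal_sum_nd.
have B0 : rho (\bigcap_n B n) = 0%E.
  rewrite (_ : \bigcap_n B n = set0) ?measure0// -subset0 => x Bx.
  have [Ax _] := Bx 0%N I; have [n] := Apos x Ax.
  have [_ /= Mx] := Bx n I.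
  by rewrite ltNge (le_trans (birkhoff_le_maximal f n x)).
have [n Bn] := probability_small_tail e0 mB Bd B0.
have Bn1 : fine (rho (B n.+1)) <= - m / (C + 1).
  rewrite -lee_fin fineK ?fin_num_measure//; apply: le_trans (ltW Bn).
  by apply: le_measure; rewrite ?inE//; apply/subsetPset; exact: Bd.
have := key n; rewrite leNgt => /negP; apply.
have : C * fine (rho (B n.+1)) <= C * (- m / (C + 1)) by rewrite ler_wpM2l.
have : C * (- m / (C + 1)) < - m.
  rewrite mulrCA gtr_pMr ?oppr_gt0// ltr_pdivrMr ?ltr_wpDl// mul1r; lra.
lra.
Qed.

End bounded_means.

Section oscillation.
Variable R : realType.

(** The lower limit of [v] is less than [a]. The margin 1/(k+1) makes the
    property stable under perturbations of [v] that tend to zero, hence shift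
    invariant when [v] is a sequence of averages. *)
Definition often_below (v : nat -> R) (a : R) : Prop :=
  exists k : nat, forall N, exists2 n, (N <= n)%N & v n < a - k.+1%:R^-1.

Definition often_above (v : nat -> R) (b : R) : Prop :=
  often_below (fun n => - v n) (- b).

Lemma exists_inv_lt (e : R) : 0 < e -> exists k : nat, k.+1%:R^-1 < e.
Proof.
by move=> e0; have [k _ /(_ k (leqnn k))] := near_infty_natSinv_lt (PosNum e0); exists k.
Qed.

Lemma often_below_close (v w : nat -> R) (a : R) :
  (forall e, 0 < e -> exists N, forall n, (N <= n)%N -> `|v n - w n| <= e) ->
  often_below v a -> often_below w a.
Proof.
move=> vw [k kP].
have h0 : 0 < k.+1%:R^-1 / 2 :> R by rewrite divr_gt0// invr_gt0.
have [j jP] := exists_inv_lt h0.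
have [M MP] := vw _ h0.
exists j => N; have [n] := kP (maxn N M).
rewrite geq_max => /andP[Nn Mn] H; exists n => //.
have := MP n Mn; rewrite ler_norml => /andP[H1 _].
move: H H1 jP; move: (k.+1%:R^-1) (j.+1%:R^-1) => x y; lra.
Qed.

Lemma often_above_close (v w : nat -> R) (b : R) :
  (forall e, 0 < e -> exists N, forall n, (N <= n)%N -> `|v n - w n| <= e) ->
  often_above v b -> often_above w b.
Proof.
move=> vw; apply: often_below_close => e /vw[N NP]; exists N => n /NP.
by rewrite -opprD normrN.
Qed.

Lemma not_often_above (v : nat -> R) (b e : R) : 0 < e -> ~ often_above v b ->
  exists N, forall n, (N <= n)%N -> v n <= b + e.
Proof.
move=> e0 H; have [k kP] := exists_inv_lt e0.
apply: contrapT => nN; apply: H; exists k => N.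
apply: contrapT => nn; apply: nN; exists N => n Nn.
rewrite leNgt; apply/negP => bv; apply: nn; exists n => //.
move: kP bv; move: (k.+1%:R^-1) => x; lra.
Qed.

Lemma not_often_below (v : nat -> R) (a e : R) : 0 < e -> ~ often_below v a ->
  exists N, forall n, (N <= n)%N -> a - e <= v n.
Proof.
move=> e0 H; have [|N NP] := @not_often_above (fun n => - v n) (- a) e e0.
  by rewrite /often_above opprK; under eq_fun do rewrite opprK.
by exists N => n /NP; lra.
Qed.

(** The limit is the infimum of the numbers above which [v] is not
    often. *)
Lemma no_oscillation_cvg (v : nat -> R) : (forall n, 0 <= v n <= 1) ->
  (forall a b : rat, ratr a < ratr b :> R ->
     ~ (often_below v (ratr a) /\ often_above v (ratr b))) ->
  exists l : R, v n @[n --> \oo] --> l.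
Proof.
move=> v01 H.
pose B := [set b | ~ often_above v b].
have B1 : B 1.
  move=> [k /(_ 0%N)[n _]]; have /andP[_ vn] := v01 n.
  have : 0 < k.+1%:R^-1 :> R by rewrite invr_gt0.
  move: (k.+1%:R^-1) => x; lra.
have Blb : lbound B (-1).
  move=> b Bb; rewrite leNgt; apply/negP => b1; apply: Bb.
  have b0 : 0 < - 1 - b by lra.
  have [k kP] := exists_inv_lt b0.
  exists k => N; exists N => //; have /andP[vn _] := v01 N.
  move: kP; move: (k.+1%:R^-1) => x; lra.
have hB : has_inf B by split; [exists 1|exists (-1)].
exists (inf B); apply/cvgrPdist_le => e e0.
have e2 : 0 < e / 2 by rewrite divr_gt0.
have [b Bb bl] := inf_adherent e2 hB.
have [N1 N1P] := not_often_above e2 Bb.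
have e4 : 0 < e / 4 by rewrite divr_gt0.
have [q2] : exists q : rat, ratr q \in `](inf B - e / 4), (inf B)[%R.
  by apply: rat_in_itvoo; lra.
rewrite in_itv/= => /andP[q21 q22].
have [q1] : exists q : rat, ratr q \in `](inf B - e / 2), (inf B - e / 4)[%R.
  by apply: rat_in_itvoo; lra.
rewrite in_itv/= => /andP[q11 q12].
have A2 : often_above v (ratr q2).
  apply: contrapT => nq; have := ge_inf hB.2 (nq : B (ratr q2)); lra.
have [|N2 N2P] := @not_often_below v (ratr q1) _ e2.
  by move=> A1; apply: (H q1 q2) => //; lra.
exists (maxn N1 N2) => // n /=; rewrite geq_max => /andP[/N1P n1 /N2P n2].
by rewrite ler_norml; apply/andP; split; lra.
Qed.

End oscillation.

Section birkhoff.
Context d (T : measurableType d) (R : realType) (rho : probability T R).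
Variables (s : T -> T) (ms : measurable_fun setT s).
Hypothesis sP : forall A, measurable A -> rho (s @^-1` A) = rho A.
Variables (F : T -> R) (mF : measurable_fun setT F) (F01 : forall x, 0 <= F x <= 1).

Definition birkhoff_average (n : nat) (x : T) : R := birkhoff_sum s F n x / n%:R.

Lemma birkhoff_average_ge0_le1 n x : 0 <= birkhoff_average n x <= 1.
Proof.
have [->|n0] := posnP n; first by rewrite /birkhoff_average invr0 mulr0 lexx ler01.
rewrite divr_ge0//=; last by apply: sumr_ge0 => k _; have /andP[] := F01 (iter k s x).
rewrite ler_pdivrMr ?ltr0n// mul1r -[X in X%:R]card_ord -sumr_const.
by apply: ler_sum => k _; have /andP[] := F01 (iter k s x).
Qed.

Lemma birkhoff_sum_measurable n : measurable_fun setT (birkhoff_sum s F n).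
Proof.
elim: n => [|n IH].
  rewrite (_ : birkhoff_sum s F 0 = cst 0); first exact: measurable_cst.
  by apply/funext => x; rewrite /birkhoff_sum big_ord0.
rewrite (_ : birkhoff_sum s F n.+1 = F \+ (birkhoff_sum s F n \o s)).
  by apply: measurable_funD => //; exact: measurableT_comp.
by apply/funext => x; rewrite birkhoff_sumS.
Qed.

Lemma birkhoff_average_measurable n : measurable_fun setT (birkhoff_average n).
Proof. by apply: measurable_funM => //; exact: birkhoff_sum_measurable. Qed.

Lemma birkhoff_average_shift x e : 0 < e -> exists N, forall n, (N <= n)%N ->
  `|birkhoff_average n (s x) - birkhoff_average n x| <= e.
Proof.
move=> e0; have [k kP] := exists_inv_lt e0; exists k.+1 => n kn.
have n0 : 0 < n%:R :> R by rewrite ltr0n (leq_trans _ kn).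
rewrite /birkhoff_average -mulrBl normrM [X in _ * X]gtr0_norm ?invr_gt0//.
rewrite ler_pdivrMr//; apply: (@le_trans _ _ 1).
  have S1 := birkhoff_sumS s F n x.
  have S2 : birkhoff_sum s F n.+1 x = birkhoff_sum s F n x + F (iter n s x).
    by rewrite /birkhoff_sum big_ord_recr.
  rewrite (_ : _ - _ = F (iter n s x) - F x); last by move: S1 S2; lra.
  have /andP[? ?] := F01 x; have /andP[? ?] := F01 (iter n s x).
  by rewrite ler_norml; apply/andP; split; lra.
rewrite -ler_pdivrMr// mul1r; apply: le_trans (ltW kP).
by rewrite lef_pV2 ?posrE// ler_nat.
Qed.

Lemma often_below_measurable (v : nat -> T -> R) (a : R) :
  (forall n, measurable_fun setT (v n)) ->
  measurable [set x | often_below (v^~ x) a].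
Proof.
move=> mv.
rewrite (_ : [set x | _] = \bigcup_k \bigcap_N \bigcup_(n in [set n | (N <= n)%N])
    (v n @^-1` `]-oo, (a - k.+1%:R^-1)[)).
  apply: bigcupT_measurable => k; apply: bigcapT_measurable => N.
  apply: bigcup_measurable => n _; rewrite -[X in measurable X]setTI.
  exact: mv.
apply/seteqP; split=> x.
  move=> [k kP]; exists k => // N _; have [n Nn H] := kP N; exists n => //.
move=> [k _ kP]; exists k => N; have [n Nn] := kP N I.
by rewrite /= in_itv/= => H; exists n.
Qed.

Let bF : bounded_measurable F.
Proof.
split=> //; exists 1 => x; have /andP[? ?] := F01 x.
by rewrite ger0_norm.
Qed.

Lemma birkhoff_sum_affine (a b : R) n x :
  birkhoff_sum s (fun x => a * F x + b) n x = a * birkhoff_sum s F n x + n%:R * b.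
Proof.
rewrite /birkhoff_sum big_split/= -mulr_sumr; congr (_ + _).
by rewrite sumr_const card_ord mulr_natl.
Qed.

Lemma mean_affine (a b : R) A : measurable A ->
  mean rho (fun x => (a * F x + b) * \1_A x) =
  a * mean rho (fun x => F x * \1_A x) + b * fine (rho A).
Proof.
move=> mA; have bA := bounded_measurable_indic R mA.
have bFA := bounded_measurableM bF bA.
rewrite -(mean_indic rho mA) -!meanZ// -meanD.
- by congr mean; apply/funext => x; ring.
- exact: (bounded_measurableM (bounded_measurable_cst _ a) bFA).
- exact: (bounded_measurableM (bounded_measurable_cst _ b) bA).
Qed.

(** The maximal inequality for the function [a F + b], whose averages
    are affine in those of [F]. Values -1 and 1 of [a] give the lower and the
    upper estimate. *)
Lemma maximal_affine (a b : R) A : measurable A -> s @^-1` A = A ->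
  (forall x, A x -> exists2 n, (0 < n)%N & 0 < a * birkhoff_average n x + b) ->
  0 <= a * mean rho (fun x => F x * \1_A x) + b * fine (rho A).
Proof.
move=> mA sA H; rewrite -mean_affine//; apply: (maximal_ergodic ms sP) => //.
  apply: bounded_measurableD; last exact: bounded_measurable_cst.
  exact: (bounded_measurableM (bounded_measurable_cst _ a) bF).
move=> x /H[n n0 Hn]; exists n; rewrite birkhoff_sum_affine.
have : 0 < n%:R * (a * birkhoff_average n x + b) by rewrite mulr_gt0// ltr0n.
rewrite (_ : n%:R * _ = a * birkhoff_sum s F n x + n%:R * b)//.
by rewrite /birkhoff_average; field; rewrite pnatr_eq0 -lt0n.
Qed.

(** If the averages oscillate across rationals a < b on an invariant
    set [B], the two maximal inequalities give
    b rho(B) <= int_B F <= a rho(B), so rho(B) = 0. Countably many pairs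
    (a, b) account for all divergent averages. *)
Lemma birkhoff_ergodic :
  {ae rho, forall x, exists l : R, birkhoff_average n x @[n --> \oo] --> l}.
Proof.
pose A (ab : rat * rat) : set T := if ratr ab.1 < ratr ab.2 :> R then
  [set x | often_below (birkhoff_average^~ x) (ratr ab.1)] `&`
  [set x | often_above (birkhoff_average^~ x) (ratr ab.2)] else set0.
have mA ab : measurable (A ab).
  rewrite /A; case: ifP => // _; apply: measurableI.
    exact: often_below_measurable birkhoff_average_measurable.
  apply: (often_below_measurable (v := fun n x => - birkhoff_average n x)) => n.
  by apply: measurableT_comp => //; exact: birkhoff_average_measurable.
have A0 ab : rho (A ab) = 0%E.
  have := mA ab; rewrite /A; case: ifP => [ab12 mA'|_ _]; last exact: measure0.
  set B := _ `&` _ in mA' *.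
  have sB : s @^-1` B = B.
    apply/seteqP; split=> x [Ba Bb]; split.
    - by apply: often_below_close Ba => e; exact: birkhoff_average_shift.
    - by apply: often_above_close Bb => e; exact: birkhoff_average_shift.
    - apply: often_below_close Ba => e /(birkhoff_average_shift x)[N NP].
      by exists N => n /NP; rewrite distrC.
    - apply: often_above_close Bb => e /(birkhoff_average_shift x)[N NP].
      by exists N => n /NP; rewrite distrC.
  have H1 : 0 <= 1 * mean rho (fun x => F x * \1_B x) + (- ratr ab.2) * fine (rho B).
    apply: maximal_affine => // x [_ [k /(_ 1%N)[n n1 H]]]; exists n => //.
    have : 0 < k.+1%:R^-1 :> R by rewrite invr_gt0.
    move: H; move: (k.+1%:R^-1) => y; lra.
  have H2 : 0 <= (-1) * mean rho (fun x => F x * \1_B x) + ratr ab.1 * fine (rho B).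
    apply: maximal_affine => // x [[k /(_ 1%N)[n n1 H]] _]; exists n => //.
    have : 0 < k.+1%:R^-1 :> R by rewrite invr_gt0.
    move: H; move: (k.+1%:R^-1) => y; lra.
  have r0 : 0 <= fine (rho B) by rewrite fine_ge0.
  have : (ratr ab.2 - ratr ab.1) * fine (rho B) <= 0 by rewrite mulrBl; lra.
  rewrite pmulr_rle0 ?subr_gt0// => r1.
  rewrite -[LHS]fineK ?fin_num_measure//; congr EFin; apply/eqP.
  by rewrite eq_le r1.
pose A' (n : nat) := oapp A set0 (choice.unpickle n).
have nA : rho.-negligible (\bigcup_n A' n).
  apply: negligible_bigcup => n; rewrite /A'; case: choice.unpickle => [ab|] /=.
    by apply/negligibleP; [exact: mA|exact: A0].
  exact: negligible_set0.
apply: negligibleS nA => x /= nc; apply: contrapT => H; apply: nc.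
apply: no_oscillation_cvg => [n|a b ab [Ha Hb]].
  exact: birkhoff_average_ge0_le1.
have Aab : A (a, b) x by rewrite /A /= ab.
apply: H; exists (choice.pickle (a, b)); first exact: I.
by rewrite /A' choice.pickleK.
Qed.

(** On [A] the function [e - F] has a positive Birkhoff sum, for
    every positive [e]. *)
Lemma mean_vanishing_average A : measurable A -> s @^-1` A = A ->
  (forall x, A x -> birkhoff_average n x @[n --> \oo] --> (0 : R)) ->
  mean rho (fun x => F x * \1_A x) <= 0.
Proof.
move=> mA sA H; apply/ler_addgt0Pr => e e0; rewrite add0r.
have : 0 <= (-1) * mean rho (fun x => F x * \1_A x) + e * fine (rho A).
  apply: maximal_affine => // x /H /cvgrPdist_lt /(_ _ e0)[N _ NP].
  exists N.+1 => //; have := NP N.+1 (leqnSn N); rewrite /= sub0r normrN.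
  by rewrite ltr_norml => /andP[_]; lra.
have : fine (rho A) <= 1 by rewrite -lee_fin fineK ?fin_num_measure// probability_le1.
have : 0 <= fine (rho A) by rewrite fine_ge0.
move: (fine (rho A)) (mean _ _) => p m p0 p1; nra.
Qed.

End birkhoff.

(** * Occupation times *)

Section occupation_time.
Variable R : realType.
Local Notation leb := (@lebesgue_measure R).
Local Notation mR := (measurableTypeR R).

Lemma measurable_shiftr (c : R) : measurable_fun setT ((fun t => t + c) : mR -> mR).
Proof. by apply: measurable_funD => //; exact: measurable_cst. Qed.

(** The translate of the measure gives intervals their
    length, which characterizes the Lebesgue measure. *)
Lemma lebesgue_measure_translate (c : R) (A : set mR) : measurable A ->
  leb ((fun t => t + c) @^-1` A) = leb A.
Proof.
move=> mA; apply/esym; have ms := measurable_shiftr c.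
apply: (@lebesgue_measure_unique R (pushforward leb ((fun t => t + c) : mR -> mR))) => //.
move=> _ [[a b]] _ <-; rewrite /pushforward.
transitivity (leb `](a - c), (b - c)]%classic); last first.
  by congr (leb _); apply/seteqP; split=> t; rewrite /= !in_itv/= ltrBlDr lerBrDr.
by rewrite /= !lebesgue_measure_itv/= !lte_fin ltrD2r -!EFinB opprB addrA subrK.
Qed.

Variable S : set mR.
Hypothesis mS : measurable S.

(** Half-open intervals make occupation times exactly additive. *)
Definition occupation (S : set mR) (a b : R) : R := fine (leb (`]a, b]%classic `&` S)).

Let mI (a b : R) : measurable (`]a, b]%classic `&` S : set mR).
Proof. by apply: measurableI. Qed.

Lemma lebesgue_itvoc (a b : R) : a <= b -> leb `]a, b]%classic = (b - a)%:E.
Proof.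
rewrite le_eqVlt => /predU1P[->|ab].
  by rewrite lebesgue_measure_itv/= ltxx subrr.
by rewrite lebesgue_measure_itv/= lte_fin ab -EFinB.
Qed.

Lemma occupation_fin (a b : R) : a <= b -> leb (`]a, b]%classic `&` S) \is a fin_num.
Proof.
move=> ab; rewrite ge0_fin_numE//.
apply: (@le_lt_trans _ _ (leb `]a, b]%classic)); last by rewrite lebesgue_itvoc// ltry.
by apply: le_measure; rewrite ?inE//.
Qed.

Lemma occupation_ge0 (a b : R) : 0 <= occupation S a b.
Proof. by rewrite fine_ge0. Qed.

Lemma occupation_le (a b : R) : a <= b -> occupation S a b <= b - a.
Proof.
move=> ab; rewrite -lee_fin fineK ?occupation_fin// -lebesgue_itvoc//.
by apply: le_measure; rewrite ?inE//.
Qed.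

Lemma occupation_add (a b c : R) : a <= b -> b <= c ->
  occupation S a c = occupation S a b + occupation S b c.
Proof.
move=> ab bc; rewrite /occupation -fineD ?occupation_fin//; congr fine.
rewrite -measureU//.
- congr (leb _); apply/seteqP; split=> t.
    move=> [/=]; rewrite !in_itv/= => /andP[t1 t2] St.
    by have [tb|tb] := leP t b; [left|right]; split=> //=; rewrite ?in_itv/= ?t1 ?tb ?t2.
  by move=> [] [/=]; rewrite !in_itv/= => /andP[t1 t2] St; split=> //=;
    rewrite ?in_itv/=; apply/andP; split=> //;
    [apply: le_trans bc|apply: le_lt_trans t1].
- by rewrite -subset0 => t [[/= + _] [/= + _]];
    rewrite !in_itv/= => /andP[_ t1] /andP[t2 _]; move: (lt_le_trans t2 t1); rewrite ltxx.
Qed.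

Lemma occupation_itvcc (T : R) : 0 <= T ->
  fine (leb (`[0, T]%classic `&` S)) = occupation S 0 T.
Proof.
move=> T0; have m0 : measurable ([set 0] `&` S : set mR).
  by apply: measurableI => //; exact: measurable_set1.
rewrite /occupation; congr fine.
rewrite (_ : `[0, T]%classic `&` S = ([set 0] `&` S) `|` (`]0, T]%classic `&` S)); last first.
  by rewrite -setIUl setU1itv.
rewrite measureU//.
  have Z : leb ([set 0] `&` S) = 0%E.
    apply/eqP; rewrite eq_le measure_ge0 andbT -(lebesgue_measure_set1 (0 : R)).
    by apply: le_measure; rewrite ?inE//.
  by apply: etrans (congr1 (fun z => z + _)%E Z) _; rewrite add0e.
by rewrite -subset0 => t [[/= -> _] [/=]]; rewrite in_itv/= ltxx.
Qed.

Lemma occupation_translate (a b c : R) :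
  occupation ((fun t => t + c) @^-1` S) a b = occupation S (a + c) (b + c).
Proof.
rewrite /occupation -(lebesgue_measure_translate c (mI (a + c) (b + c))).
congr (fine (leb _)); apply/seteqP; split=> t [/=];
  by rewrite !in_itv/= ltrD2r lerD2r => ? ?; split=> //=; rewrite ?in_itv/= ?ltrD2r ?lerD2r.
Qed.

Lemma eq_occupation (S' : set mR) a b : (forall t, a < t -> S t <-> S' t) ->
  occupation S a b = occupation S' a b.
Proof.
move=> H; congr (fine (leb _)); apply/seteqP; split=> t [/= tab St]; split=> //;
  move: (tab); rewrite in_itv/= => /andP[ta _]; exact/(H t ta).
Qed.

(** Replacing [T] by its integer part changes the mean by at most
    2 / T. *)
Lemma occupation_average_cvg (l : R) :
  occupation S 0 n%:R / n%:R @[n --> \oo] --> l ->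
  occupation S 0 T / T @[T --> +oo] --> l.
Proof.
move=> H; apply/cvgrPdist_le => e e0.
have e2 : 0 < e / 2 by rewrite divr_gt0.
have e4 : 0 < e / 4 by rewrite divr_gt0.
have /cvgrPdist_le /(_ _ e2)[N _ NP] := H.
exists (N%:R + 1 + (e / 4)^-1); split; first exact: num_real.
move=> T HT.
have ei : 0 < (e / 4)^-1 by rewrite invr_gt0.
have N0 : 0 <= N%:R :> R by [].
have T0 : 0 < T by move: HT ei N0; lra.
pose n := Num.truncn T.
have /andP[nT Tn] : n%:R <= T < n.+1%:R by apply: truncn_itv; exact: ltW.
have Nn : (N < n.+1)%N by rewrite -(ltr_nat R); apply: lt_trans Tn; move: HT ei; lra.
rewrite ltnS in Nn.
have n0 : 0 < n%:R :> R.
  by move: Tn; rewrite -addn1 natrD; move: HT ei N0; lra.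
have := NP n Nn; rewrite /=.
have O1 := occupation_add (ltW n0) nT.
have O2 := occupation_ge0 n%:R T; have O3 := occupation_le nT.
have O4 := occupation_ge0 0 n%:R; have O5 := occupation_le (ltW n0).
rewrite subr0 in O5; rewrite O1.
set x := occupation S 0 n%:R in O4 O5 *; set y := occupation S n%:R T in O2 O3 *.
have Tn1 : T - n%:R <= 1 by move: Tn; rewrite -addn1 natrD; lra.
have Ti : T^-1 <= e / 4.
  by rewrite invf_ple ?posrE//; move: HT N0; lra.
have Ti0 : 0 < T^-1 by rewrite invr_gt0.
have D : `|x / n%:R - (x + y) / T| <= e / 2.
  (* [x / n] is at most 1, and [y] at most T - n <= 1. *)
  have -> : x / n%:R - (x + y) / T = ((x / n%:R) * (T - n%:R) - y) * T^-1.
    by field; rewrite !gt_eqF.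
  rewrite normrM [X in _ * X]gtr0_norm//.
  have X1 : 0 <= x / n%:R <= 1 by rewrite divr_ge0 ?(ltW n0)//= ler_pdivrMr// mul1r.
  move: X1; move: (x / n%:R) => z /andP[z0 z1].
  have X2 : `|z * (T - n%:R) - y| <= 2.
    rewrite (le_trans (ler_normB _ _))// ger0_norm ?mulr_ge0 ?subr_ge0//.
    by rewrite (ger0_norm O2); nra.
  apply: (@le_trans _ _ (2 * T^-1)); first by rewrite ler_wpM2r// ltW.
  move: Ti; lra.
move=> D'; rewrite (_ : l - _ = (l - x / n%:R) + (x / n%:R - (x + y) / T)); last ring.
by rewrite (le_trans (ler_normD _ _))//; move: D D'; lra.
Qed.

End occupation_time.

Section sojourn_times.
Variables (R : realType) (Om : smooth_domain R).
Local Notation leb := (@lebesgue_measure R).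
Variables (E : set (borelH Om)) (mE : measurable E).

Definition visits (u : Cw Om) : set (measurableTypeR R) := [set t | E (path_at u t)].

Lemma visits_graph_measurable :
  measurable ([set x | E (path_at x.2 x.1)] : set (measurableTypeR R * borelCw Om)).
Proof.
have [d dd] := ipH_dense Om.
have := joint_path_measurable dd measurableT mE.
by rewrite setTI.
Qed.

(** Paths are only weakly continuous, so even for open [E] the visits
    need not form an open set; measurability comes from that of the graph. *)
Lemma visits_measurable u : measurable (visits u).
Proof.
have := measurable_ysection (u : borelCw Om) visits_graph_measurable.
by congr measurable; apply/seteqP; split=> t; rewrite /ysection/= inE.
Qed.

Definition unit_occupation (u : borelCw Om) : R := occupation (visits u) 0 1.

Lemma unit_occupation_measurable : measurable_fun setT unit_occupation.
Proof.
have mB : measurable ((`]0, 1]%classic `*` setT) `&` [set x | E (path_at x.2 x.1)] :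
    set (measurableTypeR R * borelCw Om)).
  by apply: measurableI visits_graph_measurable; exact: measurableX.
have := measurable_fun_ysection leb mB.
move=> /(measurableT_comp (fine_measurable (D := setT) measurableT)).
congr measurable_fun; apply/funext => u /=; rewrite /unit_occupation /occupation.
congr (fine (leb _)); apply/seteqP; split=> t; rewrite /ysection/= inE/=.
  by move=> [[]].
by move=> [].
Qed.

Lemma unit_occupation01 u : 0 <= unit_occupation u <= 1.
Proof.
rewrite occupation_ge0/= -[X in _ <= X]subr0.
by apply: occupation_le => //; exact: visits_measurable.
Qed.

Lemma time_of_add (tau : time R) (t : R) : 0 <= t ->
  time_add tau (time_of t) = time_of (t + time_val tau).
Proof.
move=> t0; apply: time_val_inj.
rewrite -[LHS]/(Num.max 0 t + time_val tau) -[RHS]/(Num.max 0 (t + time_val tau)).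
rewrite (max_idPr t0).
by apply/esym/max_idPr; rewrite addr_ge0//; exact: set_mem (svalP tau).
Qed.

Lemma path_at_shift (tau : time R) (u : Cw Om) (t : R) : 0 <= t ->
  path_at (Defs.shift tau u) t = path_at u (t + time_val tau).
Proof. by move=> t0; rewrite /path_at -time_of_add. Qed.

Lemma occupation_shift (tau : time R) (u : Cw Om) (a b : R) : 0 <= a ->
  occupation (visits (Defs.shift tau u)) a b =
  occupation (visits u) (a + time_val tau) (b + time_val tau).
Proof.
move=> a0; rewrite -occupation_translate; last exact: visits_measurable.
apply: eq_occupation => t ta.
have := @path_at_shift tau u t (ltW (le_lt_trans a0 ta)).
by rewrite /visits /preimage /= => ->.
Qed.

Local Notation step := (@Defs.shift R Om (time_of 1) : borelCw Om -> borelCw Om).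

Lemma time_of1 : time_val (time_of (1 : R)) = 1.
Proof. by rewrite /time_val/=; apply/max_idPr. Qed.

(** The unit intervals ]k, k+1] tile ]0, n]. *)
Lemma birkhoff_sum_occupation n u :
  birkhoff_sum step unit_occupation n u = occupation (visits u) 0 n%:R.
Proof.
elim: n u => [|n IH] u.
  rewrite /birkhoff_sum big_ord0; apply/eqP; rewrite eq_sym eq_le occupation_ge0 andbT.
  by have := occupation_le (visits_measurable u) (lexx 0); rewrite subrr.
rewrite birkhoff_sumS IH occupation_shift// time_of1 add0r.
have n1 : 1 <= n.+1%:R :> R by rewrite ler1n.
by rewrite (occupation_add (visits_measurable u) ler01 n1) natr1.
Qed.

Lemma mean_time_occupation u (T : R) : 0 <= T ->
  mean_time_in E u T = occupation (visits u) 0 T / T.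
Proof.
by move=> T0; rewrite /mean_time_in -(occupation_itvcc (visits_measurable u) T0).
Qed.

Lemma positive_sojourn_of_average u (l : R) :
  birkhoff_average step unit_occupation n u @[n --> \oo] --> l -> 0 < l ->
  positive_sojourn E u.
Proof.
move=> H l0.
have c : mean_time_in E u T @[T --> +oo] --> l.
  have := occupation_average_cvg (visits_measurable u) (l := l).
  rewrite (_ : (fun n => _) = birkhoff_average step unit_occupation ^~ u); last first.
    by apply/funext => n; rewrite /birkhoff_average birkhoff_sum_occupation.
  move=> /(_ H); apply: cvg_trans; apply: near_eq_cvg.
  exists 0; split=> // T T0 /=; rewrite mean_time_occupation//; exact: ltW.
have sl : sojourn E u = l by apply: cvg_lim.
split; [by apply/cvg_ex; exists l| |by rewrite sl].
rewrite sl; apply: cvg_trans c; apply: near_eq_cvg.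
exists 0; split=> // T T0 /=.
rewrite mean_time_occupation ?(ltW T0)// mulrC; congr (_ * _).
rewrite -occupation_itvcc ?(ltW T0)//; last exact: visits_measurable.
rewrite /Rintegral; congr fine.
rewrite (_ : (fun t => _) = (fun t => (\1_(visits u) t)%:E)); last first.
  by apply/funext => t; rewrite !indicE; congr (_%:R)%:E.
have mI : measurable (`[0, T]%classic : set (measurableTypeR R)) by exact: measurable_itv.
by rewrite (integral_indic leb mI (visits_measurable u)) setIC.
Qed.

End sojourn_times.

(** * Existence and positivity of sojourn times *)

Section recurrence.
Variables (R : realType) (Om : smooth_domain R).
Local Notation leb := (@lebesgue_measure R).
Variables (E : set (borelH Om)) (mE : measurable E).
Variable rho : probability (borelCw Om) R.
Hypothesis rho_shift : forall (tau : time R) (A : set (borelCw Om)),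
  measurable A -> rho (Defs.shift tau @^-1` A) = rho A.

Local Notation step := (@Defs.shift R Om (time_of 1) : borelCw Om -> borelCw Om).
Local Notation F := (unit_occupation E).
Local Notation avg := (birkhoff_average step F).

Let mF : measurable_fun setT F. Proof. exact: unit_occupation_measurable. Qed.
Let F01 u : 0 <= F u <= 1. Proof. exact: unit_occupation01. Qed.
Let mstep : measurable_fun setT step. Proof. exact: shift_measurable. Qed.

(** Convergence of the averages to 0, with countable quantifiers. *)
Definition zero_average : set (borelCw Om) :=
  [set u | forall k : nat, exists N : nat, forall n, (N <= n)%N -> avg n u <= k.+1%:R^-1].

Lemma zero_average_measurable : measurable zero_average.
Proof.
rewrite (_ : zero_average = \bigcap_k \bigcup_N \bigcap_(n in [set n | (N <= n)%N])
    (avg n @^-1` `]-oo, k.+1%:R^-1])).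
  apply: bigcapT_measurable => k; apply: bigcupT_measurable => N.
  apply: bigcap_measurableType => n _; rewrite -[X in measurable X]setTI.
  by apply: (birkhoff_average_measurable mstep mF).
apply/seteqP; split=> u.
  move=> H k _; have [N NP] := H k; exists N; first exact: I.
  by move=> n Nn; rewrite /= in_itv/=; exact: NP.
move=> H k; have [N _ NP] := H k I; exists N => n Nn.
by have := NP n Nn; rewrite /= in_itv/=.
Qed.

Lemma zero_average_cvg u : zero_average u <-> avg n u @[n --> \oo] --> (0 : R).
Proof.
split=> H.
  apply/cvgrPdist_le => e e0; have [k kP] := exists_inv_lt e0.
  have [N NP] := H k; exists N => // n /= /NP H1.
  have /andP[a0 _] := birkhoff_average_ge0_le1 step F01 n u.
  by rewrite sub0r normrN ger0_norm// (le_trans H1)// ltW.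
move=> k; have k0 : 0 < k.+1%:R^-1 :> R by rewrite invr_gt0.
have /cvgrPdist_le /(_ _ k0)[N _ NP] := H.
exists N => n /NP /=; rewrite sub0r normrN; apply: le_trans; exact: ler_norm.
Qed.

(** A shift by [tau], not only by 1, moves the window of observation: the two
    occupation times differ by the parts of length [tau] at both ends. *)
Lemma average_shift (tau : time R) u n : (0 < n)%N ->
  `|avg n (Defs.shift tau u) - avg n u| <= time_val tau / n%:R.
Proof.
move=> n0; have n0' : 0 < n%:R :> R by rewrite ltr0n.
have t0 : 0 <= time_val tau := set_mem (svalP tau).
rewrite /birkhoff_average -mulrBl normrM [X in _ * X]gtr0_norm ?invr_gt0//.
rewrite ler_wpM2r ?invr_ge0 ?ler0n// !birkhoff_sum_occupation// occupation_shift//.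
rewrite add0r; set t := time_val tau in t0 *.
have mv := visits_measurable mE u.
have nt : n%:R <= n%:R + t by rewrite lerDl.
have tn : t <= n%:R + t by rewrite lerDr ltW.
have A1 := occupation_add mv t0 tn.
have A2 := occupation_add mv (ltW n0') nt.
have B1 := occupation_ge0 (visits E u) 0 t.
have B2 := occupation_ge0 (visits E u) n%:R (n%:R + t).
have B3 := occupation_le mv t0; have B4 := occupation_le mv nt.
rewrite subr0 in B3; rewrite addrAC subrr add0r in B4.
by rewrite ler_norml; apply/andP; split; move: A1 A2 B1 B2 B3 B4; lra.
Qed.

Lemma zero_average_shift (tau : time R) :
  Defs.shift tau @^-1` zero_average = zero_average.
Proof.
have close u w : (forall n, (0 < n)%N -> `|avg n u - avg n w| <= time_val tau / n%:R) ->
    zero_average u -> zero_average w.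
  move=> H ru k.
  have t0 : 0 <= time_val tau := set_mem (svalP tau).
  have h0 : 0 < k.+1%:R^-1 / 2 :> R by rewrite divr_gt0// invr_gt0.
  have [j jP] := exists_inv_lt h0.
  have [N NP] := ru j.
  have h1 : 0 < k.+1%:R^-1 / 2 / (time_val tau + 1) by rewrite divr_gt0// ltr_wpDl.
  have [M MP] := exists_inv_lt h1.
  exists (maxn N M.+1) => n; rewrite geq_max => /andP[/NP n1 n2].
  have n0 : (0 < n)%N by apply: leq_trans n2.
  have H1 : time_val tau / n%:R <= k.+1%:R^-1 / 2.
    apply: (@le_trans _ _ (time_val tau * M.+1%:R^-1)).
      by rewrite ler_wpM2l// lef_pV2 ?posrE ?ltr0n// ler_nat.
    move: MP; rewrite ltr_pdivlMr ?ltr_wpDl// mulrDr mulr1 => MP.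
    have : 0 < M.+1%:R^-1 :> R by rewrite invr_gt0.
    move: MP; move: (M.+1%:R^-1) (k.+1%:R^-1) => x y; lra.
  have := H n n0; rewrite ler_norml => /andP[H2 _].
  move: n1 jP H1 H2; move: (j.+1%:R^-1) (k.+1%:R^-1) (_ / n%:R) => x y z; lra.
apply/seteqP; split=> u; apply: close => n n0.
  exact: average_shift.
by rewrite distrC; exact: average_shift.
Qed.

Lemma visit_at_measurable (t : R) :
  measurable ([set u | E (path_at u t)] : set (borelCw Om)).
Proof.
have [d dd] := ipH_dense Om.
have := path_at_measurable_borelH dd t measurableT mE.
by rewrite setTI.
Qed.

Lemma rho_visit_at (t : R) : 0 <= t ->
  rho (zero_average `&` [set u | E (path_at u t)]) =
  rho (zero_average `&` [set u | E (path_at u 0)]).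
Proof.
move=> t0; have mA : measurable (zero_average `&` [set u | E (path_at u 0)]).
  by apply: measurableI; [exact: zero_average_measurable|exact: visit_at_measurable].
rewrite -(rho_shift (time_of t) mA) preimage_setI zero_average_shift.
congr (rho (_ `&` _)); apply/funext => u.
have tu : path_at (Defs.shift (time_of t) u) 0 = path_at u t.
  by rewrite path_at_shift// add0r; congr (path_at u _); exact/max_idPr.
by rewrite /preimage /mkset tu.
Qed.

(** Fubini: the integral of [F] over the invariant set is the
    integral over t in ]0, 1] of the probability that u(t) is in [E], a
    constant in [t] by [rho_visit_at]. *)
Lemma mean_occupation_zero_average :
  mean rho (fun u => F u * \1_zero_average u) =
  fine (rho (zero_average `&` [set u | E (path_at u 0)])).
Proof.
set c := rho _.
pose B : set (measurableTypeR R * borelCw Om) :=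
  (`]0, 1]%classic `*` zero_average) `&` [set x | E (path_at x.2 x.1)].
have mB : measurable B.
  apply: measurableI (visits_graph_measurable mE); apply: measurableX => //.
  exact: zero_average_measurable.
pose f : measurableTypeR R * borelCw Om -> \bar R := fun x => (\1_B x)%:E.
have mf : measurable_fun setT f by apply/measurable_EFinP; exact: measurable_indic.
have f0 x : (0 <= f x)%E by rewrite lee_fin.
have := @fubini_tonelli _ _ _ _ R leb rho f mf f0.
have -> : (\int[leb]_t \int[rho]_u f (t, u) = c)%E.
  have m01 : measurable (`]0, 1]%classic : set (measurableTypeR R)) by exact: measurable_itv.
  transitivity (\int[leb]_t (c * (\1_(`]0, 1]%classic : set (measurableTypeR R)) t)%:E))%E.
    apply: eq_integral => t _; rewrite /f.
    have mAt : measurable (zero_average `&` [set u | E (path_at u t)]).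
      by apply: measurableI; [exact: zero_average_measurable|exact: visit_at_measurable].
    have [t01|t01] := pselect ((`]0, 1]%classic : set R) t).
      rewrite [in RHS]indicE mem_set// mule1.
      have t0 : 0 <= t by move: t01; rewrite /= in_itv/= => /andP[/ltW].
      rewrite /c -(rho_visit_at t0) -[X in _ = rho X]setIT.
      rewrite -(integral_indic rho measurableT mAt).
      apply: eq_integral => u _; rewrite !indicE; congr (_%:R)%:E; congr nat_of_bool.
      apply/idP/idP => /set_mem H; apply/mem_set.
        by case: H => [[_ /= H1] H2].
      by case: H.
    rewrite [in RHS]indicE memNset// mule0.
    rewrite (eq_integral (cst 0%E)) ?integral0// => u _.
    by rewrite indicE memNset// => -[[]].
  rewrite ge0_integralZl//.
  - have L : leb `]0, 1]%classic = 1%E by rewrite lebesgue_itvoc// subr0.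
    rewrite (integral_indic leb measurableT m01) setIT.
    exact: etrans (congr1 (fun z => c * z)%E L) (mule1 c).
  - by apply/measurable_EFinP; exact: measurable_indic.
  - exact: measure_ge0.
move=> ->; rewrite /mean /Rintegral; congr fine; apply: eq_integral => u _.
rewrite /f.
have [Au|Au] := pselect (zero_average u); last first.
  rewrite [in LHS]indicE memNset// mulr0.
  rewrite (eq_integral (cst 0%E)) ?integral0// => t _.
  by rewrite indicE memNset// => -[[]].
rewrite [in LHS]indicE mem_set// mulr1.
have mV : measurable (`]0, 1]%classic `&` visits E u : set (measurableTypeR R)).
  by apply: measurableI; [exact: measurable_itv|exact: visits_measurable].
rewrite fineK; last first.
  by apply: occupation_fin; [exact: visits_measurable|exact: ler01].
rewrite -[LHS]/(leb (`]0, 1]%classic `&` visits E u)) -[X in leb X]setIT.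
rewrite -(integral_indic leb measurableT mV).
apply: eq_integral => t _; rewrite !indicE; congr (_%:R)%:E; congr nat_of_bool.
apply/idP/idP => /set_mem H; apply/mem_set.
  by case: H.
by case: H => [[H1 _] H2].
Qed.

(** A limit equal to 0 would put the path in [zero_average]; almost
    no such path starts in [E], because the mean of [F] on [zero_average] is
    at once the probability of that event and at most 0. *)
Lemma positive_sojourn_ae :
  {ae rho, forall u, E (initial_value u) -> positive_sojourn E u}.
Proof.
have mA := zero_average_measurable.
have step_rho A : measurable A -> rho (step @^-1` A) = rho A by exact: rho_shift.
have c0 : rho (zero_average `&` [set u | E (path_at u 0)]) = 0%E.
  have := mean_vanishing_average mstep step_rho mF F01 mA (zero_average_shift _).
  rewrite mean_occupation_zero_average => /(_ (fun u => (zero_average_cvg u).1)) H.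
  rewrite -[LHS]fineK ?fin_num_measure//; last first.
    by apply: measurableI => //; exact: visit_at_measurable.
  by congr EFin; apply/eqP; rewrite eq_le H fine_ge0.
have H1 := birkhoff_ergodic mstep step_rho mF F01.
have H2 : {ae rho, forall u, ~ (zero_average `&` [set u | E (path_at u 0)]) u}.
  exists (zero_average `&` [set u | E (path_at u 0)]); split => //.
  - by apply: measurableI => //; exact: visit_at_measurable.
  - by move=> u /= H; apply: contrapT.
apply: filterS2 H1 H2 => u [l ul] nu Eu.
apply: (positive_sojourn_of_average mE ul).
have l0 : 0 <= l.
  rewrite -(cvg_lim (@Rhausdorff R) ul); apply: limr_ge; first by apply/cvg_ex; exists l.
  by apply: nearW => n; have /andP[] := birkhoff_average_ge0_le1 step F01 n u.
rewrite lt_def l0 andbT; apply/eqP => lE; apply: nu; split=> //.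
by apply/zero_average_cvg; rewrite -lE.
Qed.

End recurrence.

(** * Initial values of almost all paths *)

Lemma closed_preimage (T U : topologicalType) (f : T -> U) (F : set U) :
  continuous f -> closed F -> closed (f @^-1` F).
Proof. by move=> fc Fcl; apply: preimage_closed => // x _; exact: fc. Qed.

Section full_measure_images.
Variables (R : realType) (Om : smooth_domain R).
Local Notation ip := (@ipH R Om).
Variable rho : probability (borelCw Om) R.
Variables (d : nat -> Hspace Om) (dd : ip_dense ip d).

Lemma closed_borelCw (A : set (Cw Om)) : closed A -> measurable (A : set (borelCw Om)).
Proof.
move=> Acl; rewrite -[X in measurable X]setCK; apply: measurableC.
by apply: open_borelCw; exact: closed_openC.
Qed.

(** Closedness is for pointwise convergence of the coordinates, the
    topology in which equicontinuous paths are compact. *)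
Definition coordinate_closed : set_system (borelCw Om) :=
  [set A | exists2 F, closed F & A = path_coords d @^-1` F].

Lemma coordinate_closed_le (q : rat) (i : nat) (c : R) :
  coordinate_closed [set u | ip (d i) (path_at u (ratr q)) <= c] /\
  coordinate_closed [set u | c <= ip (d i) (path_at u (ratr q))].
Proof.
have pc := @ptws_proj_continuous R (time R * nat)%type (time_of (ratr q), i).
split.
  exists [set x : {ptws (time R * nat) -> R} | x (time_of (ratr q), i) <= c] => //.
  exact: (closed_preimage pc (@closed_le R c)).
exists [set x : {ptws (time R * nat) -> R} | c <= x (time_of (ratr q), i)] => //.
exact: (closed_preimage pc (@closed_ge R c)).
Qed.

(** A generator, given by a strict inequality on a coordinate, is a
    countable union of sets given by large inequalities. *)
Lemma coordCw_inner_approximable (A : set (Cw Om)) :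
  measurable (A : set (coordCw d)) -> inner_approximable rho coordinate_closed A.
Proof.
have mK B : coordinate_closed B -> measurable B.
  move=> [F Fcl ->]; apply: closed_borelCw.
  exact: (closed_preimage (@path_coords_continuous _ _ d)).
have K0 : coordinate_closed set0.
  by exists set0; [exact: closed0|rewrite preimage_set0].
have KT : coordinate_closed setT.
  by exists setT; [exact: closedT|rewrite preimage_setT].
have KU B C : coordinate_closed B -> coordinate_closed C -> coordinate_closed (B `|` C).
  move=> [F Fcl ->] [G Gcl ->]; exists (F `|` G); first exact: closedU.
  by rewrite preimage_setU.
have KI (B : nat -> set (borelCw Om)) : (forall n, coordinate_closed (B n)) ->
    coordinate_closed (\bigcap_n B n).
  move=> KB; pose F n := sval (cid2 (KB n)).
  have Fcl n : closed (F n) by rewrite /F; case: cid2.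
  have FE n : B n = path_coords d @^-1` F n by rewrite /F; case: cid2.
  exists (\bigcap_n F n); first by apply: closed_bigI => n _; exact: Fcl.
  by rewrite preimage_bigcap; apply: eq_bigcapr => n _; exact: FE.
apply: (inner_regular mK K0 KT KU KI) => B [q [i [c ->]]].
have KA := inner_approximable_self rho mK.
split.
  rewrite (_ : [set u | _] = \bigcup_k
      [set u | ip (d i) (path_at u (ratr q)) <= c - k.+1%:R^-1]).
    by apply: inner_approximable_bigcup => // k; apply: KA; exact: (coordinate_closed_le q i _).1.
  apply/seteqP; split=> u /=.
    rewrite -subr_gt0 => /exists_inv_lt[k kP]; exists k => //=.
    by move: kP; move: (k.+1%:R^-1) => x; lra.
  move=> [k _ /=]; have : 0 < k.+1%:R^-1 :> R by rewrite invr_gt0.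
  by move: (k.+1%:R^-1) => x; lra.
rewrite (_ : ~` _ = [set u | c <= ip (d i) (path_at u (ratr q))]).
  by apply: KA; exact: (coordinate_closed_le q i _).2.
apply/seteqP; split=> u /=; first by move/negP; rewrite -leNgt.
by rewrite leNgt => /negP.
Qed.

Definition oscillation_bounded (k m j n : nat) : set (Cw Om) :=
  [set u | forall t s, time_val t <= m%:R -> time_val s <= m%:R ->
    `|time_val t - time_val s| < n.+1%:R^-1 ->
    `|ip (d k) (Cw_fun u t) - ip (d k) (Cw_fun u s)| <= j.+1%:R^-1].

Lemma oscillation_bounded_measurable k m j n :
  measurable (oscillation_bounded k m j n : set (borelCw Om)).
Proof.
apply: closed_borelCw.
rewrite (_ : oscillation_bounded k m j n = \bigcap_(ts in [set ts : time R * time R |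
   [/\ time_val ts.1 <= m%:R, time_val ts.2 <= m%:R &
    `|time_val ts.1 - time_val ts.2| < n.+1%:R^-1]])
   [set u | `|ip (d k) (Cw_fun u ts.1) - ip (d k) (Cw_fun u ts.2)| <= j.+1%:R^-1]).
  apply: closed_bigI => ts _.
  suff fc : continuous (fun u : Cw Om => `|ip (d k) (Cw_fun u ts.1) - ip (d k) (Cw_fun u ts.2)|).
    exact: (closed_preimage fc (@closed_le R j.+1%:R^-1)).
  move=> u; apply: (@cvg_norm _ R^o _ (nbhs u) (nbhs_filter u)).
  apply: (@cvgB _ R^o _ (nbhs u) (nbhs_filter u)); exact: evaluation_continuous.
apply/seteqP; split=> u H; first by move=> [t s] [/= ? ? ?]; exact: H.
by move=> t s tm sm ts; apply: (H (t, s)).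
Qed.

(** The coordinates are uniformly continuous on
    [0, m]. *)
Lemma oscillation_bounded_exists u k m j : exists n, oscillation_bounded k m j n u.
Proof.
have j0 : 0 < j.+1%:R^-1 :> R by rewrite invr_gt0.
have Kc : compact (`[0, m%:R]%classic : set R) by exact: segment_compact.
have [n nP] := compact_modulus Kc (@path_at_continuous R Om u (d k)) j0.
exists n => t s tm _ ts.
have := nP (time_val t) (time_val s); rewrite /path_at !time_of_val => H.
apply: ltW; apply: H => //; rewrite /= in_itv/= tm andbT.
exact: set_mem (svalP t).
Qed.

Hypothesis rho_bounded : rho (~` locally_bounded (Om := Om)) = 0%E.

Lemma locally_bounded_borel : measurable (locally_bounded (Om := Om) : set (borelCw Om)).
Proof. exact: coordCw_sub (locally_bounded_measurable dd). Qed.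

(** Every locally bounded path satisfies some norm bound on each
    [0, m] and some modulus for each [(k, m, j)]; as the requirements are
    countable, one choice of bounds and moduli serves up to measure [e]. *)
Lemma equicontinuous_paths_large (e : R) : 0 < e -> exists r del C,
  [/\ measurable (C : set (borelCw Om)), C `<=` equicontinuous_paths d r del &
    (rho (~` C) <= e%:E)%E].
Proof.
move=> e0.
pose I : countType := (nat + nat * nat * nat)%type.
pose A (i : I) (n : nat) : set (borelCw Om) := match i with
  | inl m => norm_bounded m%:R n%:R
  | inr (k, m, j) => oscillation_bounded k m j n end.
have mA i n : measurable (A i n).
  case: i => [m|[[k m] j]]; last exact: oscillation_bounded_measurable.
  exact: (coordCw_sub (norm_bounded_measurable dd m%:R (ler0n R n))).
have Ad i n p : (n <= p)%N -> A i n `<=` A i p.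
  move=> np; case: i => [m|[[k m] j]] u H.
    by move=> t tm; apply: (le_trans (H t tm)); rewrite ler_nat.
  move=> t s tm sm ts; apply: H => //; apply: (lt_le_trans ts).
  by rewrite lef_pV2 ?posrE// ler_nat.
have [|c cP] := choose_moduli (rho := rho) e0 mA Ad.
  move=> i; apply/eqP; rewrite -measure_le0 -[X in (_ <= X)%E]rho_bounded.
  apply: le_measure; rewrite ?inE.
  - by apply: measurableC; exact: bigcupT_measurable.
  - by apply: measurableC; exact: locally_bounded_borel.
  - apply: subsetC => u ub; case: i => [m|[[k m] j]].
      by have [r ur] := ub m; exists r.
    by have [n un] := oscillation_bounded_exists u k m j; exists n.
exists (fun m => c (inl m)), (fun kmj => c (inr kmj)), (\bigcap_i A i (c i)); split.
- rewrite -[X in measurable X]setCK setC_bigcap; apply: measurableC.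
  by apply: bigcup_countType_measurable => i _; exact: measurableC.
- move=> u H; split=> [m|k m j]; first exact: (H (inl m) Logic.I).
  exact: (H (inr (k, m, j)) Logic.I).
- exact: cP.
Qed.

(** The set [P] consists of the initial values of equicontinuous paths
    in a closed set [F] of coordinates that approximates from inside the
    paths outside [N] that start in [E]. *)
Lemma image_inner_approximation (E : set (borelH Om)) (N : set (borelCw Om)) (e : R) :
  0 < e -> measurable E -> measurable N -> rho N = 0%E ->
  exists P : set (borelH Om), [/\ measurable P,
    P `<=` initial_value (Om := Om) @` ~` N &
    (stationary_solution rho (E `\` P) <= e%:E)%E].
Proof.
move=> e0 mE mN N0; have e2 : 0 < e / 2 by rewrite divr_gt0.
have mi := initial_value_measurable dd.
have mEN : measurable ((initial_value (Om := Om) @^-1` E) `\` N).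
  by apply: measurableD => //; rewrite -[X in measurable X]setTI; exact: mi.
set A := (initial_value (Om := Om) @^-1` E) `\` N in mEN.
have [_ /(_ _ e2)[_ [[F Fcl ->] FA Fe]]] := coordCw_inner_approximable
  (borelCw_locally_bounded_measurable dd mEN).
have [r [del [C [mC CE Ce]]]] := equicontinuous_paths_large e2.
pose P : set (borelH Om) := [set h | exists u : Cw Om,
  [/\ equicontinuous_paths d r del u, F (path_coords d u) & initial_value u = h]].
have mP : measurable P by exact: initial_value_image_measurable.
exists P; split=> //.
  by move=> _ [u [_ Fu <-]]; exists u => //; have [[]] := FA u Fu.
have mB := locally_bounded_borel.
have mAB : measurable (A `&` locally_bounded (Om := Om)) by exact: measurableI.
have mF : measurable (path_coords d @^-1` F : set (borelCw Om)).
  by apply: closed_borelCw; exact: (closed_preimage (@path_coords_continuous _ _ d)).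
rewrite /stationary_solution /pushforward.
(* A path that starts in [E] but outside [P] is exceptional for one of four
   reasons, two of them of measure zero and two of measure at most [e / 2]. *)
pose Q := (N `|` ~` locally_bounded (Om := Om)) `|`
   (((A `&` locally_bounded (Om := Om)) `\` (path_coords d @^-1` F)) `|` ~` C).
have mNB : measurable (N `|` ~` locally_bounded (Om := Om)).
  by apply: measurableU => //; exact: measurableC.
have mAF : measurable ((A `&` locally_bounded (Om := Om)) `\` (path_coords d @^-1` F)).
  exact: measurableD.
have mAFC : measurable (((A `&` locally_bounded (Om := Om)) `\` (path_coords d @^-1` F)) `|` ~` C).
  by apply: measurableU => //; exact: measurableC.
apply: (@le_trans _ _ (rho Q)).
  apply: le_measure; rewrite ?inE.
  - by rewrite -[X in measurable X]setTI; apply: mi => //; exact: measurableD.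
  - exact: measurableU.
  - move=> u [Eu nP].
    have [Nu|Nu] := pselect (N u); first by left; left.
    have [Bu|Bu] := pselect (locally_bounded u); last by left; right.
    right; have [Cu|Cu] := pselect (C u); last by right.
    left; split; first by split.
    by move=> Fu; apply: nP; exists u; split=> //; exact: CE.
have NB0 : (rho (N `|` ~` locally_bounded (Om := Om)) <= 0)%E.
  apply: le_trans; first by apply: measureU2 => //; exact: measurableC.
  by rewrite [X in (X + _)%E]N0 [X in (_ + X)%E]rho_bounded adde0.
apply: le_trans; first exact: measureU2.
rewrite -[leRHS]add0e (splitr e) EFinD; apply: leeD; first exact: NB0.
apply: le_trans; first by apply: measureU2 => //; exact: measurableC.
by apply: leeD; [exact: Fe|exact: Ce].
Qed.

Lemma image_full_measure (E : set (borelH Om)) (N : set (borelCw Om)) :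
  measurable E -> measurable N -> rho N = 0%E ->
  {ae stationary_solution rho, forall u0, E u0 ->
    exists2 u : Cw Om, ~ N u & initial_value u = u0}.
Proof.
move=> mE mN N0.
have ex n : exists P : set (borelH Om), [/\ measurable P,
    P `<=` initial_value (Om := Om) @` ~` N &
    (stationary_solution rho (E `\` P) <= (n.+1%:R^-1)%:E)%E].
  by apply: image_inner_approximation => //; rewrite invr_gt0.
pose P n := sval (cid (ex n)).
have [mP PN Pe] : [/\ forall n, measurable (P n),
    forall n, P n `<=` initial_value (Om := Om) @` ~` N &
    forall n, (stationary_solution rho (E `\` P n) <= (n.+1%:R^-1)%:E)%E].
  by split=> n; have [] := svalP (cid (ex n)).
have mi := initial_value_measurable dd.
have mpre (B : set (borelH Om)) : measurable B ->
    measurable (initial_value (Om := Om) @^-1` B).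
  by move=> mB; rewrite -[X in measurable X]setTI; exact: mi.
have mEP : measurable (E `\` \bigcup_n P n).
  by apply: measurableD => //; exact: bigcupT_measurable.
exists (E `\` \bigcup_n P n); split; first exact: mEP.
  suff H : (rho (initial_value (Om := Om) @^-1` (E `\` \bigcup_n P n)) <= 0)%E.
    by apply/eqP; rewrite eq_le; apply/andP; split; [exact: H|exact: (measure_ge0 rho)].
  apply/lee_addgt0Pr => e e0; rewrite add0e; have [k kP] := exists_inv_lt e0.
  apply: (@le_trans _ _ (rho (initial_value (Om := Om) @^-1` (E `\` P k)))).
    apply: le_measure; rewrite ?inE.
    - exact: mpre.
    - by apply: mpre; exact: measurableD.
    - by move=> u [Eu nP]; split=> // Pu; apply: nP; exists k.
  by apply: (le_trans (Pe k)); rewrite lee_fin ltW.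
move=> u0 /not_implyP[Eu0 nu]; split=> // -[n _ Pu0]; apply: nu.
by have [u Nu <-] := PN n _ Pu0; exists u.
Qed.

End full_measure_images.

Theorem theorem1p3 (R : realType) (Om : smooth_domain R) (nu : R)
    (f : Hspace Om) (rho : probability (borelCw Om) R) (E : set (borelH Om)) :
  0 < nu ->
  invariant_Vishik_Fursikov nu f rho ->
  measurable E ->
  (0 < stationary_solution rho E)%E ->
  {ae rho, forall u, leray_hopf nu f u -> E (initial_value u) ->
     positive_sojourn E u} /\
  {ae stationary_solution rho, forall u0, E u0 ->
     exists u : Cw Om, [/\ leray_hopf nu f u, initial_value u = u0 &
       positive_sojourn E u]}.
Proof.
move=> _ [rhoLH rhoinv] mE _.
have soj := positive_sojourn_ae mE rhoinv.
split; first by apply: filterS soj => u Eu _; exact: Eu.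
have [d dd] := ipH_dense Om.
have rho_bounded : rho (~` locally_bounded (Om := Om)) = 0%E.
  apply: measure_negligible; first by apply: measurableC; exact: (locally_bounded_borel dd).
  apply: negligibleS rhoLH; apply: subsetC; exact: leray_hopf_locally_bounded.
have [N [mN N0 NP]] : {ae rho, forall u, leray_hopf nu f u /\
    (E (initial_value u) -> positive_sojourn E u)}.
  apply: (@filterS2 _ _ (ae_filter_ringOfSetsType rho) _ _ _ _ rhoLH soj).
  by move=> u A B; split.
have := image_full_measure dd rho_bounded mE mN N0.
move=> [B [mB B0 BP]]; exists B; split=> // u0 /= nu0; apply: BP => /= H; apply: nu0.
move=> Eu0; have [u Nu ui] := H Eu0.
have [lu pu] : leray_hopf nu f u /\ (E (initial_value u) -> positive_sojourn E u).
  by apply: contrapT => nP; apply: Nu; exact: NP.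
by exists u; split=> //; apply: pu; rewrite ui.
Qed.
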